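(* Let the Cantor set $B$ be equipped with a quasiconformal structure by identifying $B=\partial T$ for some bounded valence, bushy tree $T$. Let $G\times B\to B$ be a uniformly quasiconformal action of a group $G$ on $B$, and suppose that the action of $G$ on the triple space of $B$ is cocompact. Then there exist a tree $T'$ and a quasiconformal homeomorphism $\phi\colon B\to\partial T'$ which conjugates the $G$-action on $B$ to an action on $\partial T'$ which is induced by some cocompact, isometric action of $G$ on $T'$.
   Context: Trees are simplicial with edges of length $1$. Bounded valence means vertices have uniformly finite valence. Bushy means each point is within a uniformly bounded distance of some vertex having at least $3$ unbounded complementary components. $\partial T$ is the Gromov boundary. The triple space of $B$ is the space of ordered triples of pairwise distinct points of $B$. For $K\ge1$, $C\ge0$, a map $f\colon X\to Y$ of metric spaces is a $K,C$ quasi-isometry if $\frac1Kd(x,y)-C\le d(f(x),f(y))\le Kd(x,y)+C$ for all $x,y$, and every point of $Y$ is within $C$ of $f(X)$; a quasi-isometry of proper geodesic hyperbolic spaces extends to a homeomorphism of Gromov boundaries. Cross-ratio: for pairwise distinct $a,b,c,d\in\partial X$, $$[a,b,c,d]=\exp\Bigl(\tfrac12\sup\liminf_{i\to\infty}\bigl(d(x_i,t_i)-d(t_i,z_i)+d(z_i,y_i)-d(y_i,x_i)\bigr)\Bigr),$$ the sup taken over sequences in $X$ with $x_i\to a$, $y_i\to b$, $z_i\to c$, $t_i\to d$. For a proper increasing function $I\colon[0,\infty)\to[0,\infty)$, a homeomorphism $f\colon\partial X\to\partial Y$ is $I$-quasimobius if $[a,b,c,d]\le I([fa,fb,fc,fd])$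 and $[fa,fb,fc,fd]\le I([a,b,c,d])$ for all such $(a,b,c,d)$. A homeomorphism $f\colon\partial X\to\partial Y$ is quasiconformal if it satisfies one of the following criteria: (i) $f$ is the continuous extension of some $K,C$ quasi-isometry $X\to Y$; (ii) $f$ is $I$-quasimobius for some proper increasing $I$; (iii) when $X,Y$ have cobounded isometry groups: for some compact set $\mathcal K$ in the space of homeomorphisms $\partial X\to\partial Y$ with the compact-open topology, for each isometry $\alpha$ of $X$ there is an isometry $\beta$ of $Y$ with $\partial\beta\circ f\circ\partial\alpha\in\mathcal K$. By a theorem of Paulin these criteria are equivalent, uniformly in the data $(K,C)$, $I$, $\mathcal K$, when $X,Y$ are proper, geodesic, Gromov hyperbolic with cobounded isometry groups. A group action on $\partial X$ by homeomorphisms $A_g$ is uniformly quasiconformal if all the $A_g$ satisfy one of these criteria uniformly, i.e. with the same $(K,C)$ (respectively the same $I$, the same $\mathcal K$). *)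

(* Defs.v *)
From HB Require Import structures.
From mathcomp Require Import all_boot all_order all_algebra.
From mathcomp Require Import all_classical all_reals all_analysis.

Set Implicit Arguments.
Unset Strict Implicit.
Unset Printing Implicit Defensive.

Import Order.TTheory GRing.Theory Num.Theory.
Import numFieldNormedType.Exports.

Local Open Scope classical_set_scope.
Local Open Scope ring_scope.

Section MetricNotions.
Context {R : realType}.
Implicit Types X Y : metricType R.

Definition self_isometry X (f : X -> X) : Prop :=
  (forall x y, mdist (f x) (f y) = mdist x y) /\ (forall y, exists x, f x = y).

Definition quasi_isometry X Y (K C : R) (f : X -> Y) : Prop :=
  (forall x y, K^-1 * mdist x y - C <= mdist (f x) (f y) <= K * mdist x y + C)
  /\ (forall y, exists x, mdist y (f x) <= C).

Definition bounded_subset X (A : set X) : Prop :=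
  exists M : R, forall x y, A x -> A y -> mdist x y <= M.

Definition proper_space X : Prop :=
  forall (x : X) (r : R), compact [set y | mdist x y <= r].

Definition cobounded_isometries X : Prop :=
  exists (x0 : X) (D : R), forall y, exists f : X -> X,
    self_isometry f /\ mdist (f x0) y <= D.

End MetricNotions.

Definition homeomorphism (U V : topologicalType) (f : U -> V) : Prop :=
  exists g : V -> U, [/\ cancel f g, cancel g f, continuous f & continuous g].

Definition is_action (G : groupType) (S : Type) (act : G -> S -> S) : Prop :=
  (forall x, act 1%g x = x) /\
  (forall g h x, act (g * h)%g x = act g (act h x)).

(* Cocompactness of the action restricted to the invariant subspace [S]; a
   subset of [S] is compact in [S] iff it is compact in [U]. *)
Definition cocompact_on (G : groupType) (U : topologicalType) (S : set U)
    (act : G -> U -> U) : Prop :=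
  exists C : set U, [/\ compact C, C `<=` S &
    forall x, S x -> exists (g : G) (c : U), C c /\ act g c = x].

Definition triples (B : Type) : set (B * B * B) :=
  [set p | [/\ p.1.1 <> p.1.2, p.1.1 <> p.2 & p.1.2 <> p.2]].

Definition triple_map (B : Type) (f : B -> B) (p : B * B * B) : B * B * B :=
  (f p.1.1, f p.1.2, f p.2).

Section GromovBoundary.
Context {R : realType} (X : metricType R).
Implicit Types (o : X) (x y : nat -> X).

Definition gromov_product o (p q : X) : R :=
  (mdist p o + mdist q o - mdist p q) / 2.

(* (x_i | y_j)_o tends to infinity as i, j do; this does not depend on [o].
   [asymptotic x x] says that x converges at infinity. *)
Definition asymptotic x y : Prop :=
  forall o (M : R),
    \forall i \near \oo & j \near \oo, M <= gromov_product o (x i) (y j).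

(* A boundary point is the set of all the sequences converging to it: an
   [asymptotic]-class of sequences converging at infinity. *)
Record boundary := Boundary {
  seqs_to : set (nat -> X);
  _ : exists2 x, asymptotic x x &
        seqs_to = [set y | asymptotic y y /\ asymptotic x y] }.

HB.instance Definition _ := gen_eqMixin boundary.
HB.instance Definition _ := gen_choiceMixin boundary.

Definition tends_to x (a : boundary) : Prop := seqs_to a x.

(* The points b with (a | b)_o >= r; for r -> +oo these are a neighbourhood
   basis of [a]. *)
Definition boundary_ball o (a : boundary) (r : R) : set boundary :=
  [set b | exists x y, [/\ tends_to x a, tends_to y b &
     \forall i \near \oo & j \near \oo, r <= gromov_product o (x i) (y j)]].

Definition boundary_open : set (set boundary) :=
  [set A | forall a, A a -> forall o, exists r, boundary_ball o a r `<=` A].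

Lemma boundary_ball_le o a (r s : R) :
  r <= s -> boundary_ball o a s `<=` boundary_ball o a r.
Proof.
move=> rs b [x [y [xa yb xy]]]; exists x, y; split=> //.
by apply: filterS xy => ij; apply: le_trans.
Qed.

Lemma boundary_openT : boundary_open setT.
Proof. by move=> a _ o; exists 0. Qed.

Lemma boundary_openI : setI_closed boundary_open.
Proof.
move=> A B oA oB a [Aa Ba] o.
have [r rA] := oA a Aa o; have [s sB] := oB a Ba o.
exists (Num.max r s) => b ab; split.
  by apply: rA; apply: boundary_ball_le ab; rewrite le_max lexx.
by apply: sB; apply: boundary_ball_le ab; rewrite le_max lexx orbT.
Qed.

Lemma boundary_open_bigU (I : Type) (f : I -> set boundary) :
  (forall i, boundary_open (f i)) -> boundary_open (\bigcup_i f i).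
Proof.
move=> fo a [i _ fa] o; have [r rf] := fo i a fa o.
by exists r => b /rf fb; exists i.
Qed.

HB.instance Definition _ := isOpenTopological.Build boundary
  boundary_openT boundary_openI boundary_open_bigU.

(* The supremum is finite for pairwise distinct a, b, c, d in the boundary of a
   Gromov hyperbolic space, so that [fine] loses nothing there. *)
Definition cross_ratio (a b c d : boundary) : R :=
  expR (2^-1 * fine (ereal_sup
    [set l : \bar R | exists x y z t : nat -> X,
      [/\ tends_to x a, tends_to y b, tends_to z c, tends_to t d &
        l = limn_einf (fun i => (mdist (x i) (t i) - mdist (t i) (z i)
                        + mdist (z i) (y i) - mdist (y i) (x i))%:E)]])).

End GromovBoundary.

Arguments tends_to {R X}.

Section Quasiconformal.
Context {R : realType}.
Implicit Types X Y : metricType R.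

Definition extends_to_boundary X Y (h : X -> Y)
    (f : boundary X -> boundary Y) : Prop :=
  forall a x, tends_to x a -> tends_to (h \o x) (f a).

(* Only the values of [I] on [0, +oo[ matter. *)
Definition proper_increasing (I : R -> R) : Prop :=
  [/\ forall s, 0 <= s -> 0 <= I s,
      forall s t, 0 <= s -> s < t -> I s < I t &
      I s @[s --> +oo] --> +oo].

Definition quasimobius X Y (I : R -> R) (f : boundary X -> boundary Y) : Prop :=
  forall a b c d, uniq [:: a; b; c; d] ->
    cross_ratio a b c d <= I (cross_ratio (f a) (f b) (f c) (f d)) /\
    cross_ratio (f a) (f b) (f c) (f d) <= I (cross_ratio a b c d).

(* The three criteria, satisfied by all the homeomorphisms in [F] with the same
   constants (K, C), the same [I], the same [KK] respectively. *)
Definition uniformly_qc_ext X Y (F : set (boundary X -> boundary Y)) : Prop :=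
  exists K C : R, [/\ 1 <= K, 0 <= C &
    forall f, F f -> exists h : X -> Y,
      quasi_isometry K C h /\ extends_to_boundary h f].

Definition uniformly_qc_mobius X Y (F : set (boundary X -> boundary Y)) : Prop :=
  exists I : R -> R, proper_increasing I /\ (forall f, F f -> quasimobius I f).

Definition uniformly_qc_compact X Y (F : set (boundary X -> boundary Y)) : Prop :=
  [/\ cobounded_isometries X, cobounded_isometries Y &
    exists KK : set {compact-open, boundary X -> boundary Y},
      [/\ compact KK, KK `<=` [set f | homeomorphism f] &
        forall f, F f ->
        forall (alpha : X -> X) (dalpha : boundary X -> boundary X),
          self_isometry alpha -> extends_to_boundary alpha dalpha ->
        exists (beta : Y -> Y) (dbeta : boundary Y -> boundary Y),
          [/\ self_isometry beta, extends_to_boundary beta dbeta &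
              KK (dbeta \o f \o dalpha)]]].

Definition uniformly_quasiconformal X Y
    (F : set (boundary X -> boundary Y)) : Prop :=
  (forall f, F f -> homeomorphism f) /\
  [\/ uniformly_qc_ext F, uniformly_qc_mobius F | uniformly_qc_compact F].

Definition quasiconformal X Y (f : boundary X -> boundary Y) : Prop :=
  uniformly_quasiconformal [set f].

End Quasiconformal.

Record tree := Tree {
  vertex : choiceType;
  adj : rel vertex;
  tree_nonempty : inhabited vertex;
  adj_sym : symmetric adj;
  adj_irr : irreflexive adj;
  tree_connected : forall u v, exists2 p, path adj u p & last u p = v;
  tree_acyclic : forall c, ucycle adj c -> (size c <= 2)%N }.

Section Realization.
Context (R : realType) (T : tree).
Local Notation V := (vertex T).

(* Barycentric coordinates of the point at distance [t] from [u] on the edge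
   from [u] to [v]; for [u = v] this is the vertex [u]. *)
Definition bary (u v : V) (t : R) : V -> R :=
  fun w => (1 - t) *+ (w == u) + t *+ (w == v).

Record realization := Point {
  coord : V -> R;
  _ : exists u v t, [/\ (u == v) || adj u v, 0 <= t <= 1 & coord = bary u v t] }.

HB.instance Definition _ := gen_eqMixin realization.
HB.instance Definition _ := gen_choiceMixin realization.

Lemma vertex_point_subproof (v : V) :
  exists u w t, [/\ (u == w) || adj u w, 0 <= t <= 1 & bary v v 0 = bary u w t].
Proof. by exists v, v, 0; rewrite eqxx lexx ler01. Qed.

Definition vertex_point (v : V) : realization := Point (vertex_point_subproof v).

(* [chain x y l]: a path of total length [l] from [x] to [y] which is a
   concatenation of finitely many segments, each inside a closed edge. *)
Inductive chain : realization -> realization -> R -> Prop :=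
| chain0 x : chain x x 0
| chainS x y z u v s t l :
    adj u v -> 0 <= s <= 1 -> 0 <= t <= 1 ->
    coord x = bary u v s -> coord y = bary u v t -> chain y z l ->
    chain x z (`|s - t| + l).

Definition tree_dist (x y : realization) : R := inf [set l | chain x y l].

Lemma coord_inj : injective coord.
Proof. by move=> [x Px] [y Py] /= E; subst y; congr Point; exact: Prop_irrelevance. Qed.

Lemma chain_ge0 x y l : chain x y l -> 0 <= l.
Proof. by elim=> // *; rewrite addr_ge0. Qed.

Lemma bary_lip u v s t w : adj u v -> `|bary u v s w - bary u v t w| <= `|s - t|.
Proof.
move=> uv; rewrite /bary; have [->|wu] := eqVneq w u.
  have [E|_] := eqVneq u v; first by move: uv; rewrite E adj_irr.
  rewrite !mulr1n !mulr0n !addr0 (_ : 1 - s - (1 - t) = t - s) 1?distrC//.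
  by rewrite opprB addrC addrA subrK.
have [_|_] := eqVneq w v; first by rewrite !mulr1n !mulr0n !add0r.
by rewrite !mulr0n !addr0 subrr normr0.
Qed.

Lemma chain_lip x y l : chain x y l -> forall w, `|coord x w - coord y w| <= l.
Proof.
elim=> [{}x w|{}x {}y z u v s t {}l uv _ _ xs yt _ IH w]; first by rewrite subrr normr0.
rewrite (le_trans (ler_distD (coord y w) _ _))// lerD//.
by rewrite xs yt bary_lip.
Qed.

Lemma chain_cat x y z l m : chain x y l -> chain y z m -> chain x z (l + m).
Proof.
move=> xy; elim: xy m => [a m|a b c u v s t k uv s1 t1 ae be _ IH m cz].
  by rewrite add0r.
by rewrite -addrA; apply: chainS uv s1 t1 ae be _; exact: IH.
Qed.

Lemma chain1 x y u v s t : adj u v -> 0 <= s <= 1 -> 0 <= t <= 1 ->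
  coord x = bary u v s -> coord y = bary u v t -> chain x y `|s - t|.
Proof.
move=> uv s1 t1 xe ye; rewrite -[`|_|]addr0.
exact: chainS uv s1 t1 xe ye (chain0 _).
Qed.

Lemma chain_sym x y l : chain x y l -> chain y x l.
Proof.
elim=> [a|a b c u v s t k uv s1 t1 ae be _ IH]; first exact: chain0.
by rewrite addrC; apply: chain_cat IH _; rewrite distrC; exact: chain1 uv t1 s1 be ae.
Qed.

Lemma bary_vertex0 u v : bary u v 0 = bary u u 0.
Proof. by apply/funext => w; rewrite /bary !mul0rn. Qed.

Lemma bary_vertex1 u v : bary u v 1 = bary v v 0.
Proof. by apply/funext => w; rewrite /bary subrr subr0 !mul0rn add0r addr0. Qed.

Lemma bary_diag u t : bary u u t = bary u u 0.
Proof. by apply/funext => w; rewrite /bary -!mulrnDl subr0 subrK addr0. Qed.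

Lemma chain_vertex u v : exists l, chain (vertex_point u) (vertex_point v) l.
Proof.
have [p] := tree_connected u v; elim: p u => [u _ <-|w p IH u /= /andP[uw wp] pv].
  by exists 0; exact: chain0.
have [l wl] := IH w wp pv; exists (`|0 - 1| + l).
apply: chainS uw _ _ _ _ wl; rewrite ?lexx ?ler01//=.
- by rewrite (bary_vertex0 u w).
- by rewrite bary_vertex1.
Qed.

Lemma chain_to_vertex x : exists u l, chain x (vertex_point u) l.
Proof.
case E: x => [f [u [v [t [uv t1 fe]]]]]; rewrite -E.
have {E} xe : coord x = bary u v t by rewrite E.
exists u; case/orP: uv => [/eqP vu|uv].
  exists 0; suff -> : x = vertex_point u by exact: chain0.
  by apply: coord_inj; rewrite xe -vu bary_diag.
exists `|t - 0|; apply: chain1 uv t1 _ xe _; rewrite ?lexx ?ler01//=.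
by rewrite (bary_vertex0 u v).
Qed.

Lemma chain_ex x y : [set l | chain x y l] !=set0.
Proof.
have [u [l xu]] := chain_to_vertex x; have [v [m yv]] := chain_to_vertex y.
have [n uv] := chain_vertex u v; exists (l + (n + m)).
exact: chain_cat xu (chain_cat uv (chain_sym yv)).
Qed.

Lemma tree_dist_le x y l : chain x y l -> tree_dist x y <= l.
Proof. by move=> xy; apply: ge_inf => //; exists 0 => m /chain_ge0. Qed.

Lemma le_tree_dist x y m :
  (forall l, chain x y l -> m <= l) -> m <= tree_dist x y.
Proof. by move=> h; apply: lb_le_inf => //; exact: chain_ex. Qed.

Lemma tree_distxx x : tree_dist x x = 0.
Proof.
apply/eqP; rewrite eq_le tree_dist_le ?le_tree_dist//; first exact: chain_ge0.
exact: chain0.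
Qed.

Lemma tree_dist_positivity x y : tree_dist x y = 0 -> x = y.
Proof.
move=> xy; apply: coord_inj; apply/funext => w; apply/eqP.
rewrite -subr_eq0 -normr_le0 -xy; apply: le_tree_dist => l xyl.
exact: chain_lip xyl w.
Qed.

Lemma tree_dist_sym x y : tree_dist x y = tree_dist y x.
Proof. by congr inf; apply/seteqP; split=> l /= /chain_sym. Qed.

Lemma tree_dist_triangle y x z : tree_dist x z <= tree_dist x y + tree_dist y z.
Proof.
rewrite -lerBlDr; apply: le_tree_dist => l xy; rewrite lerBlDr -lerBlDl.
by apply: le_tree_dist => m yz; rewrite lerBlDl tree_dist_le//; exact: chain_cat xy yz.
Qed.

HB.instance Definition _ := isMetric.Build R realization
  tree_distxx tree_dist_positivity tree_dist_sym tree_dist_triangle.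

Definition bushy : Prop :=
  exists D : R, forall x : realization, exists v : V,
    mdist x (vertex_point v) <= D /\
    exists C : 'I_3 -> set realization, injective C /\
      forall i, ~ bounded_subset (C i) /\
        exists2 p, p <> vertex_point v &
          C i = connected_component (~` [set vertex_point v]) p.

End Realization.

Definition bounded_valence (T : tree) : Prop :=
  exists N : nat, forall v : vertex T, exists2 s : seq (vertex T),
    (size s <= N)%N & forall u, adj v u -> u \in s.

(* Main.v *)
Require Import Defs.
From HB Require Import structures.
From mathcomp Require Import all_boot all_order all_algebra finmap.
From mathcomp Require Import all_classical all_reals all_analysis.
From mathcomp Require Import zify ring lra.

(* Each of the three criteria bounds the cross-ratio of the images of four points
   in terms of the cross-ratio of the points, uniformly over G.  Together with
   cocompactness on triples this yields a locally finite graph on which G acts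
   transitively and whose ends are the points of B: its vertices are the
   translates of the partition of B into balls of a fixed level, two of them
   being adjacent when they separate a common triple.

   Minimal edge cuts separating two points of B, and among them those crossing
   the fewest other minimal cuts, form a nested, G-invariant family with finitely
   many orbits (Dunwoody; the finiteness is due to Thomassen and Woess), and the
   sets of ends which they cut off form a basis of the topology of B.  Its
   structure tree T' is a locally finite tree on which G acts cocompactly, and
   the ends of T' are the points of B.

   The resulting equivariant homeomorphism B -> boundary T' is quasimobius: any
   three of the four points can be moved apart by an element of G, which changes
   both cross-ratios in a controlled way, and then both inequalities follow from
   uniform continuity. *)

Set Implicit Arguments.
Unset Strict Implicit.
Unset Printing Implicit Defensive.

Import Order.TTheory GRing.Theory Num.Theory.
Import numFieldNormedType.Exports.

Local Open Scope classical_set_scope.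

(** * Edge cuts of graphs *)

(** An element of G comes from T at best through a quasi-isometry, and these do not compose to an
    action on T. The only honest action is the one on B, so the graph is built from objects living
    on B alone, on which G acts by automorphisms. The geometry of T is condensed into one function
    [p] on pairs of points of B, the level up to which two rays agree. The logarithm of a
    cross-ratio becomes [p a b + p c d - p a d - p b c] up to a bounded error, and an upper bound on
    it says that two lines of the tree pass close to a common vertex.

    Local finiteness rests on equicontinuity: a group element that keeps one triple of points apart
    has a modulus of continuity independent of the element, so only finitely many partitions
    separate a triple of bounded size.

    The second minimization is needed because minimal cuts for different pairs of points may cross.
    Replacing two crossing cuts by opposite corners does not increase the total size, but need not
    decrease it; the number of crossings does decrease strictly, since a cut crosses neither corner
    that it bounds. *)

Definition csize (T : choiceType) (A : set T) : nat := #|` fset_set A|%fset.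

(** Counting by indicators over a common finite set turns inequalities between cardinals into
    inequalities at each element; the submodularity statements below are checked in this way. *)
Lemma csize_sum (T : choiceType) (U A : set T) : finite_set U -> A `<=` U ->
  csize A = \sum_(u <- fset_set U) (u \in A).
Proof.
move=> fU AU; have fA := sub_finite_set AU fU.
have -> : csize A = \sum_(u <- fset_set A) 1 by rewrite sum1_size.
rewrite [RHS](eq_bigr (fun u => if u \in A then 1 else 0)); last by move=> i _; case: (_ \in _).
rewrite -big_mkcond /= -[RHS]big_filter.
apply: perm_big; apply: uniq_perm => [||u]; rewrite ?filter_uniq ?fset_uniq//.
rewrite mem_filter !in_fset_set//.
apply/idP/andP => [uA|[]//]; split=> //; rewrite inE; apply: AU; by rewrite inE in uA.
Qed.

Lemma csize_le (T : choiceType) (U A : set T) : finite_set U -> A `<=` U ->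
  (csize A <= csize U)%N.
Proof.
move=> fU AU; rewrite /csize fsubset_leq_card//.
by rewrite -fset_set_sub//; exact: sub_finite_set fU.
Qed.

Lemma csize_lt (T : choiceType) (U A : set T) x : finite_set U -> A `<=` U ->
  U x -> ~ A x -> (csize A < csize U)%N.
Proof.
move=> fU AU Ux nAx; have fA := sub_finite_set AU fU.
rewrite /csize (cardfsD1 x (fset_set U)) in_fset_set// mem_set//= add1n ltnS.
apply: fsubset_leq_card; apply/fsubsetP => u; rewrite !inE !in_fset_set// !inE => Au.
by rewrite (mem_set (AU _ Au)) andbT; apply/eqP => ux; subst.
Qed.

Lemma csize0 (T : choiceType) (A : set T) : finite_set A -> csize A = 0%N -> A = set0.
Proof.
move=> fA /eqP; rewrite cardfs_eq0 => /eqP A0.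
apply/seteqP; split=> // x Ax.
have : x \in fset_set A by rewrite in_fset_set// inE.
by rewrite A0.
Qed.

Lemma csize_image (T U : choiceType) (f : T -> U) (A : set T) :
  injective f -> finite_set A -> csize (f @` A) = csize A.
Proof.
move=> fi fA; rewrite /csize fset_set_image// card_imfset//.
Qed.

Lemma finite_by_code (T U : Type) (A : set T) (f : T -> U) :
  (forall x y, A x -> A y -> f x = f y -> x = y) -> finite_set (f @` A) -> finite_set A.
Proof.
move=> fi; have /inj_card_eq/eq_finite_set -> // : {in A &, injective f}.
by move=> x y /set_mem Ax /set_mem Ay; exact: fi.
Qed.

Section Graphs.
Variable V : choiceType.
Implicit Types (adj : V -> V -> Prop) (S X : set V).

(** Edges are ordered pairs, so a symmetric relation contributes every cut edge twice. *)
Definition coboundary adj S : set (V * V) :=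
  [set e | adj e.1 e.2 /\ ~ (S e.1 <-> S e.2)].

(** Connectedness of the subgraph induced on [S], as an induction principle: no paths are needed to
    use it. The empty set qualifies. *)
Definition linked adj S : Prop := forall X, (exists x, S x /\ X x) ->
  (forall u w, S u -> S w -> adj u w -> X u -> X w) -> S `<=` X.

Lemma coboundaryC adj S : coboundary adj (~` S) = coboundary adj S.
Proof.
apply/seteqP; split=> -[u w] [/= a h]; split=> //= h'; apply: h.
- by split=> h1 h2; apply: h1; apply/h'.
- split=> h2; apply: contrapT => h3; first by case: h' => _ /(_ h3).
  by case: h' => /(_ h3).
Qed.

(** The list consists of the edges of a path from [x] to [y]. It reduces finiteness questions about
    cuts separating two vertices to cuts through one given edge. *)
Lemma crossing_edges adj S (x y : V) : linked adj S -> S x -> S y ->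
  exists l : seq (V * V), (forall e, e \in l -> adj e.1 e.2) /\
    forall X, X x -> ~ X y -> exists2 e, e \in l & X e.1 /\ ~ X e.2.
Proof.
move=> lS Sx; move: y; apply: lS.
  by exists x; split=> //; exists [::]; split=> // X Xx /(_ Xx).
move=> u w Su Sw uw [l [la lX]]; exists ((u, w) :: l); split.
  by move=> e; rewrite inE => /orP[/eqP->//|/la].
move=> X Xx Xw; have [Xu|/(lX _ Xx)[e el Xe]] := pselect (X u).
  by exists (u, w); rewrite ?inE ?eqxx.
by exists e => //; rewrite inE el orbT.
Qed.

(* Thomassen and Woess: delete the given edge and induct on the size of the
   coboundary; if the deletion disconnects the graph only two sets remain. *)
Lemma finite_linked_cuts k adj (x y : V) :
  (forall u w, adj u w -> adj w u) -> linked adj setT -> adj x y ->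
  finite_set [set S | [/\ S x /\ ~ S y, finite_set (coboundary adj S),
     (csize (coboundary adj S) <= k)%N, linked adj S & linked adj (~` S)]].
Proof.
elim: k adj x y => [|k IH] adj x y asym alink xy.
  apply: sub_finite_set (@finite_set0 _) => S [[Sx Sy] fS].
  rewrite leqn0 => /eqP/(csize0 fS) S0 _ _.
  have : coboundary adj S (x, y) by split=> //= -[/(_ Sx)].
  by rewrite S0.
pose adj' u w := [/\ adj u w, (u, w) <> (x, y) & (u, w) <> (y, x)].
have asym' u w : adj' u w -> adj' w u.
  by move=> [uw h1 h2]; split; [exact: asym|case=> ??; apply: h2; subst|case=> ??; apply: h1; subst].
have lk S : S x /\ ~ S y -> linked adj S -> linked adj' S.
  move=> [Sx Sy] lS X h1 h2; apply: lS h1 _ => u w Su Sw uw; apply: h2 => //.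
  by split=> // -[? ?]; subst.
have lkC S : S x /\ ~ S y -> linked adj (~` S) -> linked adj' (~` S).
  move=> [Sx Sy] lS X h1 h2; apply: lS h1 _ => u w Su Sw uw; apply: h2 => //.
  by split=> // -[? ?]; subst.
have [l'|nl'] := pselect (linked adj' setT).
  (* A path from [x] to [y] avoiding the deleted edge meets the coboundary of every [S], which has
     at most [k] edges left once [(x, y)] is gone; the induction hypothesis applies to each edge of
     the path. *)
  have [l [la lX]] := crossing_edges l' (I : setT x) (I : setT y).
  pose F (e : V * V) := [set S | [/\ S e.1 /\ ~ S e.2, finite_set (coboundary adj' S),
     (csize (coboundary adj' S) <= k)%N, linked adj' S & linked adj' (~` S)]].
  apply: (@sub_finite_set _ _ (\bigcup_(e in [set` l]) F e)).
    move=> S [Sxy fS cS lS lCS].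
    have sub : coboundary adj' S `<=` coboundary adj S.
      by move=> [u w] [[]].
    have [e el Se] := lX S Sxy.1 Sxy.2.
    exists e => //; split=> //; [exact: sub_finite_set fS| |exact: lk|exact: lkC].
    rewrite -ltnS; apply: leq_trans cS.
    apply: (csize_lt fS sub (x := (x, y))) => [|[[]]//].
    by split=> //= -[/(_ Sxy.1) /Sxy.2].
  apply: bigcup_finite => [|e el]; first exact: finite_seq.
  by apply: IH => //; exact: la.
(* [X] is a proper nonempty union of components of the remaining graph. Both [S] and its complement
   stay connected there, so [S] is [X] or its complement. *)
have [X [[z Xz] [Xc [w Xw]]]] : exists X, (exists z, X z) /\
    (forall u w, adj' u w -> X u -> X w) /\ exists w, ~ X w.
  apply: contrapT => nX; apply: nl' => X [z [_ Xz]] Xc w _; apply: contrapT => Xw.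
  by apply: nX; exists X; split; [exists z|split; [move=> *; apply: Xc; eauto|exists w]].
apply: (@sub_finite_set _ _ [set X; ~` X]); last exact: finite_set2.
move=> S [Sxy _ _ /(lk _ Sxy) lS /(lkC _ Sxy) lCS].
have h Y : linked adj' Y -> (exists v, Y v /\ X v) -> Y `<=` X.
  by move=> lY e; apply: lY e _ => u v _ _; exact: Xc.
have [/(h _ lS) SX|nSX] := pselect (exists v, S v /\ X v).
  left; apply/seteqP; split=> // v Xv; apply: contrapT => Sv.
  have /(h _ lCS) CX : exists v, (~` S) v /\ X v by exists v.
  by apply: Xw; have [/SX|/CX] := pselect (S w).
right; apply/seteqP; split=> v; first by move=> Sv Xv; apply: nSX; exists v.
move=> nXv; apply: contrapT => Sv.
have /(h _ lCS)/(_ v Sv)// : exists v, (~` S) v /\ X v.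
by exists z; split=> // Sz; apply: nSX; exists z.
Qed.

End Graphs.

Lemma nat_argmin (X : Type) (P : X -> Prop) (f : X -> nat) : (exists x, P x) ->
  exists x, P x /\ forall y, P y -> (f x <= f y)%N.
Proof.
case=> x Px; have [n] := ubnP (f x); elim: n x Px => // n IH x Px xn.
have [[y Py yx]|h] := pselect (exists2 y, P y & (f y < f x)%N).
  by apply: (IH y Py); apply: leq_trans yx _.
by exists x; split=> // y Py; rewrite leqNgt; apply/negP => yx; apply: h; exists y.
Qed.

(** * Crossing sets and their corners *)

Definition crosses (V : Type) (F S : set V) : Prop :=
  [/\ exists x, F x /\ S x, exists x, F x /\ ~ S x,
      exists x, ~ F x /\ S x & exists x, ~ F x /\ ~ S x].

Section Crossing.
Variable V : Type.
Implicit Types C D F S : set V.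

Lemma crosses_sym F S : crosses F S -> crosses S F.
Proof. by move=> [[a ?] [b ?] [c ?] [d ?]]; split; [exists a|exists c|exists b|exists d]; tauto. Qed.

Lemma crossesCr F S : crosses F S -> crosses F (~` S).
Proof.
move=> [[a ?] [b ?] [c ?] [d ?]]; split; [exists b|exists a|exists d|exists c] => /=; tauto.
Qed.

(** Both [F] and its complement have a point outside the corner, [x] and [y]. If both points miss
    the same one of [C] and [D], then [F] crosses that one. Otherwise the point [z] outside [C] and
    [D], on whichever side of [F] it lies, supplies the missing quadrant. *)
Lemma crosses_corner C D F : crosses C D -> crosses F (C `&` D) ->
  crosses F C \/ crosses F D.
Proof.
move=> [_ _ _ [z [zC zD]]] [[a [aF [aC aD]]] [x [xF xE]] [b [bF [bC bD]]] [y [yF yE]]].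
have [Cx|Cx] := pselect (C x); have [Cy|Cy] := pselect (C y).
- right; split; [by exists a|exists x|by exists b|exists y]; split=> //.
    by move=> h; apply: xE.
  by move=> h; apply: yE.
- have Dx : ~ D x by move=> h; apply: xE.
  have [Fz|Fz] := pselect (F z).
    by left; split; [exists a|exists z|exists b|exists y].
  by right; split; [exists a|exists x|exists b|exists z].
- have Dy : ~ D y by move=> h; apply: yE.
  have [Fz|Fz] := pselect (F z).
    by right; split; [exists a|exists z|exists b|exists y].
  by left; split; [exists a|exists x|exists b|exists z].
- by left; split; [exists a|exists x|exists b|exists y].
Qed.

Lemma crosses_corners C D F : crosses F (C `&` D) -> crosses F (~` C `&` ~` D) ->
  crosses F C /\ crosses F D.
Proof.
move=> [[a [? [? ?]]] _ [b [? [? ?]]] _] [[c [? [? ?]]] _ [d [? [? ?]]] _].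
by split; split; [exists a|exists c|exists b|exists d|exists a|exists c|exists b|exists d].
Qed.

End Crossing.

(** * Minimal and optimal cuts separating two points at infinity *)

Section OptimalCuts.
Variables (V : choiceType) (adj : V -> V -> Prop) (B : Type) (dd : set V -> set B).
Variable k0 : nat.
Implicit Types (C D F S X : set V) (a b : B).

Definition fin_cob S : Prop := finite_set (coboundary adj S).
Definition cut_size S : nat := csize (coboundary adj S).
(** [dd S] stands for the points at infinity towards which [S] extends. It is known only through
    [ddC] and [ddI], which concern finite coboundaries; hence the first conjunct. *)
Definition separates a b S : Prop := fin_cob S /\ ~ (dd S a <-> dd S b).
Definition min_cut a b S : Prop := separates a b S /\
  forall S', separates a b S' -> (cut_size S <= cut_size S')%N.
Definition is_min_cut S : Prop := exists a b, min_cut a b S.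
(** [csize] vanishes on infinite sets; that this is a true count for cuts with finite coboundary is
    the content of [finite_crossing]. *)
Definition cross_number S : nat := csize [set F | is_min_cut F /\ crosses F S].
Definition opt_cut a b S : Prop := min_cut a b S /\
  forall S', min_cut a b S' -> (cross_number S <= cross_number S')%N.

Hypothesis adj_sym : forall u w, adj u w -> adj w u.
Hypothesis adj_linked : linked adj setT.
Hypothesis ddC : forall S a, fin_cob S -> (dd (~` S) a <-> ~ dd S a).
Hypothesis ddI : forall S S' a, fin_cob S -> fin_cob S' ->
  (dd (S `&` S') a <-> dd S a /\ dd S' a).
Hypothesis bounded_cuts : forall a b, a <> b ->
  exists S, separates a b S /\ (cut_size S <= k0)%N.

Lemma fin_cobC S : fin_cob S -> fin_cob (~` S).
Proof. by rewrite /fin_cob coboundaryC. Qed.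

Lemma cut_sizeC S : cut_size (~` S) = cut_size S.
Proof. by rewrite /cut_size coboundaryC. Qed.

Lemma fin_cobI S S' : fin_cob S -> fin_cob S' -> fin_cob (S `&` S').
Proof.
move=> fS fS'; apply: (@sub_finite_set _ _ (coboundary adj S `|` coboundary adj S')).
  move=> [u w] [/= uw h]; apply: contrapT => /not_orP[h1 h2]; apply: h.
  have {}h1 : S u <-> S w by apply: contrapT => ?; exact: h1.
  have {}h2 : S' u <-> S' w by apply: contrapT => ?; exact: h2.
  by split=> -[/h1 ? /h2].
by rewrite finite_setU.
Qed.

Lemma mem_coboundary S e : (e \in coboundary adj S) =
  `[< adj e.1 e.2 >] && (`[< S e.1 >] (+) `[< S e.2 >]).
Proof.
rewrite /coboundary; apply/idP/idP; rewrite inE /=.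
  move=> [h1 h2]; rewrite asboolT//=; apply/negPn/negP => h; apply: h2.
  have {}h : `[< S e.1 >] = `[< S e.2 >] by move: h; case: `[< _ >]; case: `[< _ >].
  by split=> /asboolP; [rewrite h|rewrite -h] => /asboolP.
move=> /andP[/asboolP h1 h2]; split=> // h; move: h2.
by rewrite (asbool_equiv_eq h) addbb.
Qed.

(** Holds edge by edge: the truth values of [S] and [S'] at the two ends of an edge leave sixteen
    cases. *)
Lemma cut_size_submod S S' : fin_cob S -> fin_cob S' ->
  (cut_size (S `&` S') + cut_size (~` S `&` ~` S') <= cut_size S + cut_size S')%N.
Proof.
move=> fS fS'; rewrite /cut_size.
have fU : finite_set (coboundary adj S `|` coboundary adj S') by rewrite finite_setU.
have key (e : V * V) : ((e \in coboundary adj (S `&` S')) + (e \in coboundary adj (~` S `&` ~` S')) <=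
    (e \in coboundary adj S) + (e \in coboundary adj S'))%N.
  rewrite !mem_coboundary.
  have I x : `[< (S `&` S') x >] = `[< S x >] && `[< S' x >] by rewrite -asbool_and.
  have U x : `[< (~` S `&` ~` S') x >] = ~~ `[< S x >] && ~~ `[< S' x >].
    by rewrite -!asbool_neg -asbool_and.
  rewrite !I !U.
  by case: `[< adj _ _ >]; case: `[< S _ >]; case: `[< S _ >]; case: `[< S' _ >]; case: `[< S' _ >].
have sub X : (forall e, (e \in coboundary adj X <= (e \in coboundary adj S) + (e \in coboundary adj S'))%N) ->
    coboundary adj X `<=` coboundary adj S `|` coboundary adj S'.
  move=> h e /mem_set Xe; move: (h e); rewrite Xe.
  case: (boolP (e \in coboundary adj S)) => [/set_mem|_]; first by left.
  by case: (boolP (e \in coboundary adj S')) => [/set_mem|_]; first by right.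
rewrite !(csize_sum fU); [|exact: subsetUr|exact: subsetUl| |].
- by rewrite -!big_split /=; apply: leq_sum => e _; exact: key.
- by apply: sub => e; apply: leq_trans (key e); exact: leq_addl.
- by apply: sub => e; apply: leq_trans (key e); exact: leq_addr.
Qed.

Lemma separatesC a b S : separates a b S -> separates a b (~` S).
Proof.
move=> [fS h]; split; first exact: fin_cobC.
by rewrite !ddC// => h'; apply: h; split=> h1; apply: contrapT => /h'; apply.
Qed.

Lemma min_cutC a b S : min_cut a b S -> min_cut a b (~` S).
Proof.
by move=> [s h]; split; [exact: separatesC|move=> S' /h; rewrite cut_sizeC].
Qed.

Lemma cross_numberC S : cross_number (~` S) = cross_number S.
Proof.
congr csize; apply/seteqP; split=> F [mF cF]; split=> //; last exact: crossesCr.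
by rewrite -[S]setCK; exact: crossesCr.
Qed.

Lemma opt_cutC a b S : opt_cut a b S -> opt_cut a b (~` S).
Proof.
by move=> [s h]; split; [exact: min_cutC|move=> S' /h; rewrite cross_numberC].
Qed.

Lemma fin_cob_isolated X : (exists x, X x) -> coboundary adj X = set0 -> X = setT.
Proof.
move=> [x Xx] X0; apply/seteqP; split=> //; apply: adj_linked; first by exists x.
move=> u w _ _ uw Xu; apply: contrapT => Xw.
by have : coboundary adj X (u, w) by [split=> //= -[/(_ Xu)]]; rewrite X0.
Qed.

(** A union [X] of components of [S] splits [S] into two pieces whose coboundaries are disjoint
    parts of that of [S]. One piece still separates [a] from [b], so by minimality the other has
    empty coboundary, and connectedness of the graph makes it empty. *)
Lemma min_cut_linked a b S : min_cut a b S -> linked adj S.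
Proof.
move=> [[fS sS] minS] X [x [Sx Xx]] Xc.
pose S1 := S `&` X; pose S2 := S `&` ~` X.
have Xc' u w : S u -> S w -> adj u w -> X w -> X u.
  by move=> Su Sw uw; apply: Xc => //; exact: adj_sym.
(* The end of the edge that lies in [S] decides which piece has the edge in its coboundary. *)
have e1 e : coboundary adj S1 e -> [/\ coboundary adj S e & X (if `[< S e.1 >] then e.1 else e.2)].
  case: e => u w [/= uw h]; case: asboolP => Su.
    have [Sw|Sw] := pselect (S w).
      by exfalso; apply: h; split=> -[_ ?]; split=> //; [exact: Xc uw _|exact: Xc' uw _].
    split; first by split=> //= -[/(_ Su)].
    by apply: contrapT => nX; apply: h; split=> -[].
  have [Sw|Sw] := pselect (S w); last by exfalso; apply: h; split=> -[].
  split; first by split=> //= -[_ /(_ Sw)].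
  by apply: contrapT => nX; apply: h; split=> -[].
have e2 e : coboundary adj S2 e -> [/\ coboundary adj S e & ~ X (if `[< S e.1 >] then e.1 else e.2)].
  case: e => u w [/= uw h]; case: asboolP => Su.
    have [Sw|Sw] := pselect (S w).
      exfalso; apply: h; split=> -[_ nX]; split=> // h'; apply: nX; [exact: Xc' uw h'|exact: Xc uw h'].
    split; first by split=> //= -[/(_ Su)].
    by move=> nX; apply: h; split=> -[].
  have [Sw|Sw] := pselect (S w); last by exfalso; apply: h; split=> -[].
  split; first by split=> //= -[_ /(_ Sw)].
  by move=> nX; apply: h; split=> -[].
have s1 : coboundary adj S1 `<=` coboundary adj S by move=> e /e1[].
have s2 : coboundary adj S2 `<=` coboundary adj S by move=> e /e2[].
have f1 : fin_cob S1 := sub_finite_set s1 fS.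
have f2 : fin_cob S2 := sub_finite_set s2 fS.
have sz : (cut_size S1 + cut_size S2 <= cut_size S)%N.
  rewrite /cut_size !(csize_sum fS)// -big_split /=; apply: leq_sum => e _.
  case: (boolP (e \in coboundary adj S1)) => [/set_mem/e1[h1 h2]|_].
    case: (boolP (e \in coboundary adj S2)) => [/set_mem/e2[]//|_].
    by rewrite mem_set.
  by case: (boolP (e \in coboundary adj S2)) => [/set_mem/e2[h1 _]|//]; rewrite mem_set.
have d1 c : dd S1 c <-> dd S c /\ ~ dd S2 c.
  have -> : S1 = S `&` ~` S2.
    apply/seteqP; split=> v [Sv h]; split=> //; first by case.
    by apply: contrapT => ?; apply: h.
  by rewrite ddI ?ddC//; exact: fin_cobC.
have d2 c : dd S2 c <-> dd S c /\ ~ dd S1 c.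
  have -> : S2 = S `&` ~` S1.
    by apply/seteqP; split=> v [Sv h]; split=> //; [case|move=> ?; apply: h].
  by rewrite ddI ?ddC//; exact: fin_cobC.
have [s|ns] := pselect (separates a b S1).
  have /minS := s => le; have /(csize0 f2) c2 : csize (coboundary adj S2) = 0%N.
    by move: sz le; rewrite /cut_size; lia.
  move=> v Sv; apply: contrapT => Xv.
  have : S2 = setT by apply: fin_cob_isolated c2; exists v.
  by move/seteqP => [_ /(_ x I)[]].
have [s|ns'] := pselect (separates a b S2).
  have /minS := s => le; have /(csize0 f1) c1 : csize (coboundary adj S1) = 0%N.
    by move: sz le; rewrite /cut_size; lia.
  have S1T : S1 = setT by apply: fin_cob_isolated c1; exists x.
  by move=> v _; move/seteqP: S1T => [_ /(_ v I)[]].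
exfalso.
have {}ns : dd S1 a <-> dd S1 b by apply: contrapT => ?; apply: ns.
have {}ns' : dd S2 a <-> dd S2 b by apply: contrapT => ?; apply: ns'.
apply: sS; have := d1 a; have := d1 b; have := d2 a; have := d2 b.
have [|] := pselect (dd S1 a); have [|] := pselect (dd S2 a); tauto.
Qed.

Lemma min_cut_size a b S : min_cut a b S -> (cut_size S <= k0)%N.
Proof.
move=> [[fS sS] minS]; have ab : a <> b by move=> ab; apply: sS; rewrite ab.
have [S' [s' le]] := bounded_cuts ab.
exact: leq_trans (minS _ s') le.
Qed.

(** Such a cut uses an edge of a fixed path from [x] to [y], has at most [k0] edges, and is
    connected on both sides, so [finite_linked_cuts] applies at each edge of the path. *)
Lemma finite_min_cuts_sep x y : finite_set [set F | is_min_cut F /\ (F x /\ ~ F y)].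
Proof.
have [l [la lF]] := crossing_edges adj_linked (I : setT x) (I : setT y).
pose G (e : V * V) := [set S | [/\ S e.1 /\ ~ S e.2, fin_cob S,
     (cut_size S <= k0)%N, linked adj S & linked adj (~` S)]].
apply: (@sub_finite_set _ _ (\bigcup_(e in [set` l]) G e)).
  move=> F [[a [b mF]] [Fx Fy]]; have [e el Fe] := lF F Fx Fy.
  exists e => //; split=> //; first by case: mF => -[].
  - exact: min_cut_size mF.
  - exact: min_cut_linked mF.
  - exact: min_cut_linked (min_cutC mF).
apply: bigcup_finite => [|e el]; first exact: finite_seq.
by apply: finite_linked_cuts => //; exact: la.
Qed.

(** Both sides of a crossing minimal cut are connected and meet [S] and its complement, so each side
    contains an end of an edge leaving [S]. The cut therefore separates two of finitely many
    vertices. *)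
Lemma finite_crossing S : fin_cob S -> finite_set [set F | is_min_cut F /\ crosses F S].
Proof.
move=> fS.
pose G (e : (V * V) * (V * V)) := [set F | is_min_cut F /\ (F e.1.1 /\ ~ F e.2.1)].
apply: (@sub_finite_set _ _ (\bigcup_(e in coboundary adj S `*` coboundary adj S) G e)).
  move=> F [[a [b mF]] [[x [Fx Sx]] [y [Fy Sy]] [z [Fz Sz]] [w [Fw Sw]]]].
  have h X : linked adj X -> (exists x, X x /\ S x) -> (exists x, X x /\ ~ S x) ->
      exists e, X e.1 /\ coboundary adj S e.
    move=> lX XS [v [Xv nSv]]; apply: contrapT => ne; apply: nSv; apply: lX XS _ v Xv.
    move=> u u' Xu Xu' uu' Su; apply: contrapT => nS; apply: ne; exists (u, u'); split=> //.
    by split=> //= -[/(_ Su)].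
  have [e [Fe Se]] : exists e, F e.1 /\ coboundary adj S e.
    by apply: h; [exact: min_cut_linked mF|exists x|exists y].
  have [e' [Fe' Se']] : exists e, (~` F) e.1 /\ coboundary adj S e.
    by apply: h; [exact: min_cut_linked (min_cutC mF)|exists z|exists w].
  by exists (e, e') => //; split=> //; exists a, b.
by apply: bigcup_finite => [|e _]; [exact: finite_setX|exact: finite_min_cuts_sep].
Qed.

(** A cut crossing one corner crosses [C] or [D], and a cut crossing both corners crosses both. The
    inequality is strict because [C] itself is counted for [D] on the right and crosses neither
    corner. *)
Lemma cross_number_submod C D : is_min_cut C -> fin_cob D -> fin_cob C -> crosses C D ->
  (cross_number (C `&` D) + cross_number (~` C `&` ~` D) < cross_number C + cross_number D)%N.
Proof.
move=> mC fD fC cCD; rewrite /cross_number.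
pose K S := [set F | is_min_cut F /\ crosses F S].
have fU : finite_set (K C `|` K D) by rewrite finite_setU; split; exact: finite_crossing.
have cC'D' : crosses (~` C) (~` D).
  by apply: crossesCr; apply: crosses_sym; apply: crossesCr; exact: crosses_sym.
have subE : K (C `&` D) `<=` K C `|` K D.
  by move=> F [mF /(crosses_corner cCD)[?|?]]; [left|right].
have subE' : K (~` C `&` ~` D) `<=` K C `|` K D.
  move=> F [mF /(crosses_corner cC'D')[/crossesCr|/crossesCr]]; rewrite setCK => ?; [left|right] => //.
have UC : (K C `|` K D) C by right.
rewrite -/(K (C `&` D)) -/(K (~` C `&` ~` D)) -/(K C) -/(K D) (csize_sum fU subE) (csize_sum fU subE').
rewrite (csize_sum fU (@subsetUl _ (K C) (K D))) (csize_sum fU (@subsetUr _ (K C) (K D))).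
have CU : C \in fset_set (K C `|` K D) by rewrite in_fset_set// mem_set.
rewrite -!big_split /= !(big_fsetD1 C CU) /=.
have -> : (C \in K D) = true by rewrite mem_set.
have nself : ~ crosses C C by case=> _ [x []].
have -> : (C \in K C) = false by apply/negP => /set_mem[].
have -> : (C \in K (C `&` D)) = false by apply/negP => /set_mem[_ [_ _ [x [nC []]]]].
have -> : (C \in K (~` C `&` ~` D)) = false by apply/negP => /set_mem[_ [[x [h []]]]].
rewrite !add0n add1n ltnS; apply: leq_sum => F _.
case: (boolP (F \in K (C `&` D))) => [/set_mem[mF h1]|_].
  case: (boolP (F \in K (~` C `&` ~` D))) => [/set_mem[_ h2]|_].
    by have [h3 h4] := crosses_corners h1 h2; rewrite !mem_set//; split.
  by case: (crosses_corner cCD h1) => h; rewrite (@mem_set _ _ F (conj mF h)) ?leq_addl.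
case: (boolP (F \in K (~` C `&` ~` D))) => [/set_mem[mF h2]|//].
have [|] := crosses_corner cC'D' h2 => /crossesCr; rewrite setCK => h.
  by rewrite (@mem_set _ (K C) F) ?leq_addr//; split.
by rewrite (@mem_set _ (K D) F) ?leq_addl//; split.
Qed.

Lemma opt_cut_ex a b : a <> b -> exists S, opt_cut a b S.
Proof.
move=> ab; have [S [s _]] := bounded_cuts ab.
have [S1 mS1] : exists S, min_cut a b S by apply: nat_argmin; exists S.
by apply: nat_argmin; exists S1.
Qed.

(** Submodularity forces the two corners to have the sizes of [C] and [D], so they are minimal cuts
    for the same pairs; their crossing numbers have a smaller sum, against optimality of one of the
    two. *)
Lemma opposite_corners_absurd a b a' b' C D : opt_cut a b C -> opt_cut a' b' D ->
  crosses C D -> ~ (separates a b (C `&` D) /\ separates a' b' (~` C `&` ~` D)).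
Proof.
move=> [[[fC sC] mC] oC] [[[fD sD] mD] oD] cCD [s s'].
have isC : is_min_cut C by exists a, b.
have := cut_size_submod fC fD; have := mC _ s; have := mD _ s' => le1 le2 le3.
have e1 : cut_size (C `&` D) = cut_size C by lia.
have e2 : cut_size (~` C `&` ~` D) = cut_size D by lia.
have /oC o1 : min_cut a b (C `&` D) by split=> // S'; rewrite e1; exact: mC.
have /oD o2 : min_cut a' b' (~` C `&` ~` D) by split=> // S'; rewrite e2; exact: mD.
have := cross_number_submod isC fD fC cCD; lia.
Qed.

(** Each of [C] and [D] separates the pair of the other, so they have equal size, and both corners
    are minimal cuts for [a] and [b]. Optimality of [C] then bounds twice its crossing number by
    that of the corners. *)
Lemma opposite_corners_lt a b a' b' C D : opt_cut a b C -> opt_cut a' b' D ->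
  crosses C D -> separates a b D -> separates a' b' C ->
  separates a b (C `&` D) -> separates a b (~` C `&` ~` D) ->
  (cross_number C < cross_number D)%N.
Proof.
move=> [[[fC sC] mC] oC] [[[fD sD] mD] oD] cCD s1 s2 s s'.
have isC : is_min_cut C by exists a, b.
have := cut_size_submod fC fD; have := mC _ s; have := mC _ s'.
have := mD _ s2; have := mC _ s1 => le1 le2 le3 le4 le5.
have e1 : cut_size (C `&` D) = cut_size C by lia.
have e2 : cut_size (~` C `&` ~` D) = cut_size C by lia.
have /oC o1 : min_cut a b (C `&` D) by split=> // S'; rewrite e1; exact: mC.
have /oC o2 : min_cut a b (~` C `&` ~` D) by split=> // S'; rewrite e2; exact: mC.
have := cross_number_submod isC fD fC cCD; lia.
Qed.

Definition side (s : bool) S : set V := if s then S else ~` S.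

Lemma sideC s S : ~` side s S = side (~~ s) S.
Proof. by case: s => //=; rewrite setCK. Qed.

Lemma fin_cob_side s S : fin_cob S -> fin_cob (side s S).
Proof. by case: s => // /fin_cobC. Qed.

Lemma separates_corner a b C D s t : fin_cob C -> fin_cob D ->
  ((`[< dd C a >] == s) && (`[< dd D a >] == t)) !=
  ((`[< dd C b >] == s) && (`[< dd D b >] == t)) ->
  separates a b (side s C `&` side t D).
Proof.
move=> fC fD.
have e c : dd (side s C `&` side t D) c <->
    ((`[< dd C c >] == s) && (`[< dd D c >] == t)).
  have h r S : fin_cob S -> dd (side r S) c <-> `[< dd S c >] == r.
    move=> fS; case: r => /=; first by rewrite eqb_id; split=> /asboolP.
    by rewrite ddC// eqbF_neg; split=> /asboolPn.
  rewrite ddI; [|exact: fin_cob_side|exact: fin_cob_side].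
  by rewrite !h//; split=> [[-> ->]|/andP].
move=> ne; split; first by apply: fin_cobI; exact: fin_cob_side.
rewrite !e => h; move/negP: ne; apply; apply/eqP.
by apply/idP/idP => /h.
Qed.

(** The bits record on which side of [C] and of [D] the points [a], [b], [a'], [b'] lie, in this
    order. [sa s t] says that the corner of sides [s] and [t] separates [a] from [b], and [sb] says
    it for [a'] and [b']. *)
Lemma corner_choice (c1 c2 c3 c4 d1 d2 d3 d4 : bool) : c1 != c2 -> d3 != d4 ->
  let sa s t := ((c1 == s) && (d1 == t)) != ((c2 == s) && (d2 == t)) in
  let sb s t := ((c3 == s) && (d3 == t)) != ((c4 == s) && (d4 == t)) in
  (exists s t, sa s t /\ sb (~~ s) (~~ t)) \/
  (exists s t, [/\ d1 != d2, c3 != c4, sa s t && sa (~~ s) (~~ t) &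
                   sb s (~~ t) && sb (~~ s) t]).
Proof.
case: c1; case: c2; case: c3; case: c4; case: d1; case: d2; case: d3; case: d4 => //= _ _;
  first [by left; exists true, true | by left; exists true, false
        | by left; exists false, true | by left; exists false, false
        | by right; exists true, true | by right; exists true, false
        | by right; exists false, true | by right; exists false, false].
Qed.

Lemma opt_cut_side a b S s : opt_cut a b S -> opt_cut a b (side s S).
Proof. by case: s => // /opt_cutC. Qed.

Lemma crosses_side C D s t : crosses C D -> crosses (side s C) (side t D).
Proof.
move=> h; have {}h : crosses (side s C) D.
  by case: s => //; apply: crosses_sym; apply: crossesCr; exact: crosses_sym.
by case: t => //; exact: crossesCr.
Qed.

Lemma separates_side a b S s : separates a b S -> separates a b (side s S).
Proof. by case: s => // /separatesC. Qed.

Lemma separates_asbool a b S : separates a b S -> `[< dd S a >] != `[< dd S b >].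
Proof. move=> [_ h]; apply/eqP => e; apply: h.
by split=> /asboolP h1; apply/asboolP; [rewrite -e|rewrite e]. Qed.

Lemma asbool_separates a b S : fin_cob S -> `[< dd S a >] != `[< dd S b >] -> separates a b S.
Proof. by move=> fS h; split=> // /asbool_equiv_eq e; rewrite e eqxx in h. Qed.

(* The ends of the pairs distribute over the four corners so that either two
   opposite corners separate one pair each, or each pair is separated by both
   corners of one diagonal. *)
Theorem opt_cuts_nested a b a' b' C D : opt_cut a b C -> opt_cut a' b' D -> ~ crosses C D.
Proof.
move=> oC oD cCD; have [[sC _] _] := oC; have [[sD _] _] := oD.
have fC := sC.1; have fD := sD.1.
have [[s [t [h1 h2]]]|[s [t [h1 h2 /andP[h3 h4] /andP[h5 h6]]]]] :=
  corner_choice `[< dd C a' >] `[< dd C b' >] `[< dd D a >] `[< dd D b >]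
    (separates_asbool sC) (separates_asbool sD).
  apply: (opposite_corners_absurd (opt_cut_side s oC) (opt_cut_side t oD)).
    exact: crosses_side.
  by rewrite !sideC; split; exact: separates_corner.
have sCD : separates a b (side t D) by apply/separates_side/asbool_separates.
have sDC r : separates a' b' (side r C) by apply/separates_side/asbool_separates.
(* The two diagonals give opposite strict inequalities between the crossing numbers of [C] and [D],
   which do not change under complements. *)
have lt1 : (cross_number (side s C) < cross_number (side t D))%N.
  apply: (opposite_corners_lt (opt_cut_side s oC) (opt_cut_side t oD)) => //.
  - exact: crosses_side.
  - exact: separates_corner.
  - by rewrite !sideC; exact: separates_corner.
have lt2 : (cross_number (side (~~ t) D) < cross_number (side s C))%N.
  apply: (opposite_corners_lt (opt_cut_side (~~ t) oD) (opt_cut_side s oC)) => //.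
  - by apply: crosses_sym; exact: crosses_side.
  - by apply/separates_side/asbool_separates.
  - by rewrite setIC; exact: separates_corner.
  - by rewrite !sideC negbK setIC; exact: separates_corner.
by have := ltn_trans lt2 lt1; rewrite -sideC cross_numberC ltnn.
Qed.

End OptimalCuts.

(** * Invariance of optimal cuts under automorphisms *)

Section CutAutomorphism.
Variables (V : choiceType) (adj : V -> V -> Prop) (B : Type) (dd : set V -> set B).
Implicit Types (S F : set V) (f : V -> V) (h : B -> B).

(** The preimage under [fi] is the image under [f], in a form where membership computes; [h] is the
    map that [f] induces at infinity. *)
Definition cut_automorphism f fi h : Prop :=
  [/\ cancel f fi, cancel fi f, forall u w, adj u w -> adj (f u) (f w) &
      forall S x, fin_cob adj S -> (dd (fi @^-1` S) (h x) <-> dd S x)].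

Lemma coboundary_aut f fi S : cancel f fi -> cancel fi f ->
  (forall u w, adj u w -> adj (f u) (f w)) -> (forall u w, adj u w -> adj (fi u) (fi w)) ->
  coboundary adj (fi @^-1` S) = (fun e => (f e.1, f e.2)) @` coboundary adj S.
Proof.
move=> K Ki af afi; apply/seteqP; split=> [[u w] [/= uw ne]|_ [[u w] [/= uw ne] <-]].
  by exists (fi u, fi w); rewrite /= ?Ki//; split=> //; exact: afi.
by split=> /=; [exact: af|rewrite !K].
Qed.

Variables (f fi : V -> V) (h hi : B -> B).
Hypotheses (hK : cancel h hi) (hiK : cancel hi h).
Hypotheses (af : cut_automorphism f fi h) (afi : cut_automorphism fi f hi).

Let cobE S : coboundary adj (fi @^-1` S) = (fun e => (f e.1, f e.2)) @` coboundary adj S.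
Proof. by case: af afi => ? ? ? _ [_ _ ? _]; exact: coboundary_aut. Qed.

Lemma fin_cob_aut S : fin_cob adj S -> fin_cob adj (fi @^-1` S).
Proof. by move=> fS; rewrite /fin_cob cobE; exact: finite_image. Qed.

Lemma cut_size_aut S : fin_cob adj S -> cut_size adj (fi @^-1` S) = cut_size adj S.
Proof.
move=> fS; rewrite /cut_size cobE csize_image// => -[u w] [u' w'] /= [e1 e2].
by case: af => K _ _ _; rewrite -(K u) -(K w) e1 e2 !K.
Qed.

Lemma separates_aut a b S : separates adj dd a b S -> separates adj dd (h a) (h b) (fi @^-1` S).
Proof.
move=> [fS s]; split; first exact: fin_cob_aut.
by case: af => _ _ _ e; rewrite !e.
Qed.

End CutAutomorphism.

Section CutTransport.
Variables (V : choiceType) (adj : V -> V -> Prop) (B : Type) (dd : set V -> set B).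
Implicit Types (S F : set V).

Lemma min_cut_aut f fi (h hi : B -> B) a b S : cancel h hi -> cancel hi h ->
  cut_automorphism adj dd f fi h -> cut_automorphism adj dd fi f hi ->
  min_cut adj dd a b S -> min_cut adj dd (h a) (h b) (fi @^-1` S).
Proof.
move=> hK hiK af afi [s m]; split; first exact: (separates_aut af afi s).
move=> S' s'; rewrite (cut_size_aut af afi); last by case: s.
rewrite -(cut_size_aut afi af (S := S')); last by case: s'.
by apply: m; rewrite -(hK a) -(hK b); exact: (separates_aut afi af s').
Qed.

Lemma crosses_preimage (f fi : V -> V) F S : cancel f fi -> crosses F S ->
  crosses (fi @^-1` F) (fi @^-1` S).
Proof.
move=> K [[a ?] [b ?] [c ?] [d ?]].
by split; [exists (f a)|exists (f b)|exists (f c)|exists (f d)]; rewrite /= K.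
Qed.

Lemma cross_number_aut f fi (h hi : B -> B) S : cancel h hi -> cancel hi h ->
  cut_automorphism adj dd f fi h -> cut_automorphism adj dd fi f hi ->
  finite_set [set F | is_min_cut adj dd F /\ crosses F S] ->
  cross_number adj dd (fi @^-1` S) = cross_number adj dd S.
Proof.
move=> hK hiK af afi fS; rewrite /cross_number.
case: (af) => K Ki _ _.
rewrite -(csize_image (f := fun F => fi @^-1` F) _ fS); last first.
  move=> F F' /seteqP e; apply/seteqP; split=> v Fv.
    by have := e.1 (f v); rewrite /= K; exact.
  by have := e.2 (f v); rewrite /= K; exact.
congr csize; apply/seteqP; split=> [F [[a [b mF]] cF]|_ [F [[a [b mF]] cF] <-]]; last first.
  split; last exact: crosses_preimage K cF.
  by exists (h a), (h b); exact: (min_cut_aut hK hiK af afi mF).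
exists (f @^-1` F); last by apply/seteqP; split=> v; rewrite /= Ki.
split; first by exists (hi a), (hi b); exact: (min_cut_aut hiK hK afi af mF).
have := crosses_preimage Ki cF; congr crosses.
by apply/seteqP; split=> v; rewrite /= K.
Qed.

Lemma opt_cut_aut f fi (h hi : B -> B) a b S : cancel h hi -> cancel hi h ->
  cut_automorphism adj dd f fi h -> cut_automorphism adj dd fi f hi ->
  (forall S, fin_cob adj S -> finite_set [set F | is_min_cut adj dd F /\ crosses F S]) ->
  opt_cut adj dd a b S -> opt_cut adj dd (h a) (h b) (fi @^-1` S).
Proof.
move=> hK hiK af afi fX [mS oS]; split; first exact: (min_cut_aut hK hiK af afi mS).
have finm c d X : min_cut adj dd c d X -> fin_cob adj X by case=> -[].
move=> S' mS'.
rewrite (cross_number_aut hK hiK af afi); last exact: fX (finm _ _ _ mS).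
rewrite -(cross_number_aut hiK hK afi af (S := S')); last exact: fX (finm _ _ _ mS').
by apply: oS; rewrite -(hK a) -(hK b); exact: (min_cut_aut hiK hK afi af mS').
Qed.

End CutTransport.

(** * Cut systems of actions on ultrametric spaces *)

Section Ultrametric.
Variables (B : choiceType) (p : B -> B -> nat).

(** [p] is a Gromov product that should be infinite on the diagonal. There it takes the default
    value 0 ([um_diag]), so equality is a separate case. *)
Definition sim (n : nat) (x y : B) : Prop := x = y \/ (n <= p x y)%N.
Definition level_ball (n : nat) (x : B) : set B := [set y | sim n y x].

(** Compactness enters as finiteness of the set of balls of each level and as existence of cluster
    points. [um_branch] is what bushiness becomes on the boundary: every annulus of width [D] around
    every point is inhabited. *)
Record branching_ultrametric (D : nat) : Prop := BranchingUltrametric {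
  um_diag : forall x, p x x = 0%N;
  um_sym : forall x y, p x y = p y x;
  um_min : forall x y z, x <> z -> (minn (p x y) (p y z) <= p x z)%N;
  um_classes : forall n, exists N (f : B -> 'I_N), forall x y, f x = f y -> sim n x y;
  um_cluster : forall u : nat -> B, exists x (s : nat -> nat),
    (forall n, n <= s n)%N /\ forall n, sim n (u (s n)) x;
  um_branch : forall x n, exists y, y <> x /\ (n <= p x y <= n + D)%N }.

Variable D : nat.
Hypothesis um : branching_ultrametric D.

Lemma simxx n x : sim n x x. Proof. by left. Qed.

Lemma sim_sym n x y : sim n x y -> sim n y x.
Proof. by case=> [->|]; [left|right; rewrite (um_sym um)]. Qed.

Lemma sim_trans n y x z : sim n x y -> sim n y z -> sim n x z.
Proof.
move=> [->//|xy] [<-|yz]; first by right.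
have [->|xz] := pselect (x = z); first by left.
by right; apply: leq_trans (um_min um y xz); rewrite leq_min xy.
Qed.

Lemma sim_le m n x y : (m <= n)%N -> sim n x y -> sim m x y.
Proof. by move=> mn [->|h]; [left|right; exact: leq_trans h]. Qed.

Lemma simN n x y : ~ sim n x y -> x <> y /\ (p x y < n)%N.
Proof. by move=> h; split=> [e|]; [apply: h; left|rewrite ltnNge; apply/negP => h'; apply: h; right]. Qed.

Lemma simNI n x y : x <> y -> (p x y < n)%N -> ~ sim n x y.
Proof. by move=> xy h [//|h']; move: h; rewrite ltnNge h'. Qed.

Lemma um3 x y z : x <> y -> y <> z -> x <> z ->
  [/\ minn (p x y) (p y z) <= p x z, minn (p x y) (p x z) <= p y z &
      minn (p x z) (p y z) <= p x y]%N.
Proof.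
move=> xy yz xz; split; first exact: (um_min um).
  by rewrite (um_sym um x y); exact: (um_min um).
by rewrite (um_sym um y z); exact: (um_min um).
Qed.

Lemma third_point (x y : B) : x <> y -> exists z, z <> x /\ z <> y.
Proof.
move=> xy; have [z [zx /andP[h _]]] := um_branch um x (p x y).+1.
by exists z; split=> // zy; subst; rewrite ltnn in h.
Qed.

Lemma uniq4 (a b c d : B) : a <> b -> a <> c -> a <> d -> b <> c -> b <> d -> c <> d ->
  uniq [:: a; b; c; d].
Proof.
by move=> ? ? ? ? ? ?; rewrite /= !inE !negb_or; repeat (apply/andP; split); try apply/eqP.
Qed.

End Ultrametric.

(** * Uniformly Mobius actions *)

Section UniformAction.
Variables (B : choiceType) (p : B -> B -> nat) (G : groupType) (act : G -> B -> B).
Local Notation sim := (sim p).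

(** A one-sided bound on the logarithm of the cross-ratio; the bounds for the other cross-ratios of
    the four points follow by permuting them. *)
Definition uniformly_mobius : Prop := forall L, exists M, forall g a b c d,
  uniq [:: a; b; c; d] -> (p a b + p c d <= p a d + p b c + L)%N ->
  (p (act g a) (act g b) + p (act g c) (act g d) <=
   p (act g a) (act g d) + p (act g b) (act g c) + M)%N.

Definition triple_bounded (n0 : nat) : Prop := forall a b c, a <> b -> a <> c -> b <> c ->
  exists g, [/\ p (act g a) (act g b) < n0, p (act g a) (act g c) < n0 &
                p (act g b) (act g c) < n0]%N.

(** All that the tree remembers of the graph. [cf_finite] gives finite intervals and finite valence,
    [cf_open] and [cf_basis] identify the ends of the tree with [B], and [cf_orbits] gives
    cocompactness. *)
Record cut_family (EE : set (set B)) : Prop := CutFamily {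
  cf_compl : forall E, EE E -> EE (~` E);
  cf_act : forall g E, EE E -> EE (act g @^-1` E);
  cf_nonempty : forall E, EE E -> exists x, E x;
  cf_nested : forall E F, EE E -> EE F -> ~ crosses E F;
  cf_open : forall E x, EE E -> E x -> exists j, level_ball p j x `<=` E;
  cf_finite : forall x j, finite_set [set E | EE E /\ crosses E (level_ball p j x)];
  cf_basis : forall x j, exists E, [/\ EE E, E x & E `<=` level_ball p j x];
  cf_orbits : exists2 FF : set (set B), finite_set FF &
     FF `<=` EE /\ forall E, EE E -> exists g, FF (act g @^-1` E) }.

Variables (D n0 : nat) (x0 : B).
Hypotheses (um : branching_ultrametric p D) (actP : is_action act).
Hypotheses (qm : uniformly_mobius) (cc : triple_bounded n0).

Let act1 x : act 1%g x = x. Proof. exact: actP.1. Qed.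
Let actM g h x : act (g * h)%g x = act g (act h x). Proof. exact: actP.2. Qed.

Lemma actK g : cancel (act g) (act g^-1%g).
Proof. by move=> x; rewrite -actM mulVg act1. Qed.

Lemma actVK g : cancel (act g^-1%g) (act g).
Proof. by move=> x; rewrite -actM mulgV act1. Qed.

Lemma act_inj g : injective (act g). Proof. exact: can_inj (actK g). Qed.

Lemma act_neq g x y : x <> y -> act g x <> act g y.
Proof. by move=> xy /act_inj. Qed.

Lemma act_uniq4 g a b c d : uniq [:: a; b; c; d] ->
  uniq [:: act g a; act g b; act g c; act g d].
Proof. by move=> u; rewrite -[X in uniq X]/(map (act g) [:: a; b; c; d]) map_inj_uniq//; exact: act_inj. Qed.

Lemma mobius_contra L : exists M, forall g a b c d, uniq [:: a; b; c; d] ->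
  (p (act g a) (act g b) + p (act g c) (act g d) <=
   p (act g a) (act g d) + p (act g b) (act g c) + L)%N ->
  (p a b + p c d <= p a d + p b c + M)%N.
Proof.
have [M hM] := qm L; exists M => g a b c d u h.
by have := hM g^-1%g _ _ _ _ (act_uniq4 g u) h; rewrite !actK.
Qed.

(** At most one of three points far from each other is close to [x]. The other two, [s] and [t], are
    far from [x] and [y], so [p x y] is the logarithm of a cross-ratio of [x], [y], [s], [t] up to a
    bounded error, and [g] distorts it in a controlled way. *)
Lemma act_equicontinuous m j : exists l, forall g a b c,
  ~ sim m a b -> ~ sim m a c -> ~ sim m b c ->
  ~ sim m (act g a) (act g b) -> ~ sim m (act g a) (act g c) -> ~ sim m (act g b) (act g c) ->
  forall x y, sim l x y -> sim j (act g x) (act g y).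
Proof.
(* If the images of [x] and [y] were not [j]-close, the cross-ratio bound would give
   [p x y <= p x t + p y s + M], where [p x t] and [p y s] are below [m]. *)
have [M hM] := mobius_contra (m + j); exists (m + m + M + 1)%N => g a b c ab ac bc gab gac gbc x y.
have key s t : ~ sim m s t -> ~ sim m (act g s) (act g t) -> ~ sim m x s -> ~ sim m x t ->
    sim (m + m + M + 1)%N x y -> sim j (act g x) (act g y).
  move=> st gst xs xt xy; apply: contrapT => /(@simN _ p)[gxy /ltnW lt].
  have {}gxy : x <> y by move=> e; rewrite e in gxy.
  have ys : ~ sim m y s.
    by move=> ys; apply: xs; apply: (sim_trans um _ ys); apply: sim_le xy; lia.
  have yt : ~ sim m y t.
    by move=> yt; apply: xt; apply: (sim_trans um _ yt); apply: sim_le xy; lia.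
  have [? ?] := @simN _ p _ _ _ st; have [? ?] := @simN _ p _ _ _ gst; have [? ?] := @simN _ p _ _ _ xs.
  have [? ?] := @simN _ p _ _ _ xt; have [? ?] := @simN _ p _ _ _ ys; have [? ?] := @simN _ p _ _ _ yt.
  have u : uniq [:: x; y; s; t] by apply: uniq4.
  have := hM g _ _ _ _ u; case: xy => [//|xy] h.
  suff : (p x y + p s t <= p x t + p y s + M)%N by lia.
  by apply: h; lia.
have tr s t : sim m x s -> ~ sim m s t -> ~ sim m x t.
  by move=> xs st xt; apply: st; apply: (sim_trans um _ xt); exact: (sim_sym um).
have [xa|xa] := pselect (sim m x a).
  by apply: (key b c) => //; [exact: tr xa ab|exact: tr xa ac].
have [xb|xb] := pselect (sim m x b); last exact: (key a b).
by apply: (key a c) => //; exact: tr xb bc.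
Qed.

Lemma exists_triple (x : B) : exists b c, [/\ x <> b, x <> c & b <> c].
Proof.
have [b [bx _]] := um_branch um x 0.
have [c [cx cb]] := third_point um (nesym bx).
by exists b, c; split=> // e; [apply: bx|apply: cx|apply: cb].
Qed.

Lemma act_continuous g j : exists l, forall x y, sim l x y -> sim j (act g x) (act g y).
Proof.
have [b [c [xb xc bc]]] := exists_triple x0.
(* Large enough that the triple and its image under this particular [g] are both [m]-apart. *)
pose m := (p x0 b + p x0 c + p b c + p (act g x0) (act g b) + p (act g x0) (act g c) +
  p (act g b) (act g c)).+1.
have [l hl] := act_equicontinuous m j; exists l => x y.
by apply: (hl g x0 b c); apply: simNI; rewrite ?/m; try (exact: act_neq); try lia.
Qed.

End UniformAction.

(** * The graph of translates of a partition *)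

Section CutGraph.
Variables (B : choiceType) (p : B -> B -> nat) (G : groupType) (act : G -> B -> B).
Variables (D n0 : nat) (x0 : B).
Hypotheses (um : branching_ultrametric p D) (actP : is_action act).
Hypotheses (qm : uniformly_mobius p act) (cc : triple_bounded p act n0).
Local Notation sim := (sim p).
Local Notation level_ball := (level_ball p).

Let actK := actK actP.
Let actVK := actVK actP.
Let act_neq := act_neq actP.
Let act_uniq4 := act_uniq4 actP.
Let psym := um_sym um.

(* Sliding the third point of a triple along the line joining the other two, by
   a bounded amount. *)
Definition slide L (a b c c' : B) : Prop :=
  (p a c + p b c' <= p a c' + p b c + L)%N /\ (p a c' + p b c <= p a c + p b c' + L)%N.

(** The element that brings [a], [b], [c] into bounded position also keeps [c'] away from [a] and
    [b], by control of two cross-ratios of the four points. Thus one partition separates the triples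
    before and after a slide. *)
Lemma slide_bounded L : exists2 n, (n0 <= n)%N & forall a b c c',
  a <> b -> a <> c -> b <> c -> a <> c' -> b <> c' -> slide L a b c c' ->
  exists g, [/\ ~ sim n (act g a) (act g b), ~ sim n (act g a) (act g c),
   ~ sim n (act g b) (act g c), ~ sim n (act g a) (act g c') & ~ sim n (act g b) (act g c')].
Proof.
have [M hM] := qm L; exists (M + n0 + n0)%N; first by lia.
move=> a b c c' ab ac bc ac' bc' [s1 s2].
have [g [h1 h2 h3]] := cc ab ac bc; exists g.
have gab := act_neq (g := g) ab; have gac := act_neq (g := g) ac; have gbc := act_neq (g := g) bc.
have gac' := act_neq (g := g) ac'; have gbc' := act_neq (g := g) bc'.
suff [k1 k2] : (p (act g a) (act g c') < M + n0 + n0)%N /\ (p (act g b) (act g c') < M + n0 + n0)%N.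
  by split; apply: simNI => //; lia.
have [<-|cc'] := pselect (c = c'); first by split; lia.
have := hM g _ _ _ _ (uniq4 ac' ab ac (nesym bc') (nesym cc') bc).
have := hM g _ _ _ _ (uniq4 bc' (nesym ab) bc (nesym ac') (nesym cc') ac).
rewrite !(psym c') !(psym (act g c')) => H1 H2.
have {}H1 := H1 ltac:(lia); have {}H2 := H2 ltac:(lia).
have [u1 u2 u3] := um3 um gab gbc' gac'.
lia.
Qed.

Lemma slide_sym L a b c c' : slide L a b c c' -> slide L b a c c'.
Proof. by move=> [h1 h2]; split; lia. Qed.

Lemma slide_symr L a b c c' : slide L a b c c' -> slide L a b c' c.
Proof. by move=> [h1 h2]; split; lia. Qed.

Section Line.
Variables (a b : B).
Hypothesis ab : a <> b.
Let closed (P : B -> Prop) := forall c c', a <> c -> b <> c -> a <> c' -> b <> c' ->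
  slide (D + D + 2) a b c c' -> P c -> P c'.

(** The position of [c] along the line from [a] to [b] is [p a c - p b c]. Away from the middle,
    [um_branch] provides a point whose position is smaller by at least 1 and at most [D + 1]. *)
Lemma slide_to_middle c : a <> c -> b <> c -> (p b c <= p a c)%N ->
  exists c1, [/\ a <> c1, b <> c1, p b c1 <= p a c1 <= p b c1 + D + 1 &
    forall P, closed P -> (P c <-> P c1)]%N.
Proof.
move=> ac bc.
have [k] := ubnP (p a c - p b c)%N; elim: k c ac bc => // k IH c ac bc lk le.
have [small|big] := leqP (p a c) (p b c + D + 1).
  by exists c; rewrite small le.
have [c' [c'a h]] := um_branch um a (p a c - 1 - D).
have [u1 u2 u3] := um3 um ab bc ac.
have bc' : b <> c' by move=> e; rewrite -e in h; lia.
have [v1 v2 v3] := um3 um ab bc' (nesym c'a).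
have sl : slide (D + D + 2) a b c c' by split; lia.
have [c1 [h1 h2 h3 h4]] := IH c' (nesym c'a) bc' ltac:(lia) ltac:(lia).
exists c1; split=> // P cP; rewrite -(h4 P cP); split; first exact: cP (nesym c'a) bc' sl.
by apply: cP => //; [exact: nesym|exact: slide_symr].
Qed.

End Line.

(** Both points slide to the middle of the line. Two middle points have positions of size at most
    [D + 1], so they differ by one slide of length [D + D + 2]; this is the origin of that
    constant. *)
Lemma slide_line a b c c' (P : B -> Prop) : a <> b -> a <> c -> b <> c -> a <> c' -> b <> c' ->
  (forall c c', a <> c -> b <> c -> a <> c' -> b <> c' ->
     slide (D + D + 2) a b c c' -> P c -> P c') -> P c -> P c'.
Proof.
move=> ab ac bc ac' bc' cP.
have mid d : a <> d -> b <> d -> exists d1, [/\ a <> d1, b <> d1,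
    (p b d1 <= p a d1 + D + 1)%N, (p a d1 <= p b d1 + D + 1)%N & P d <-> P d1].
  move=> ad bd; case: (leqP (p b d) (p a d)) => [le|/ltnW le].
    have [d1 [h1 h2 h3 h4]] := slide_to_middle ab ad bd le.
    by exists d1; split=> //; [lia|lia|exact: h4].
  have [d1 [h1 h2 h3 h4]] := slide_to_middle (nesym ab) bd ad le.
  exists d1; split=> //; [lia|lia|apply: h4] => e e' ? ? ? ? s.
  by apply: cP => //; exact: slide_sym.
have [d [h1 h2 h3 h4 ->]] := mid c ac bc; have [d' [k1 k2 k3 k4 ->]] := mid c' ac' bc'.
by apply: cP => //; split; lia.
Qed.

Variable n : nat.
Hypothesis n0n : (n0 <= n)%N.
Hypothesis slide_n : forall a b c c',
  a <> b -> a <> c -> b <> c -> a <> c' -> b <> c' -> slide (D + D + 2) a b c c' ->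
  exists g, [/\ ~ sim n (act g a) (act g b), ~ sim n (act g a) (act g c),
   ~ sim n (act g b) (act g c), ~ sim n (act g a) (act g c') & ~ sim n (act g b) (act g c')].

(* The translate by [g] of the partition of [B] into balls of level [n], encoded
   by the set of the pairs of points that it separates. *)
Definition partition_at g : set (B * B) :=
  [set e | ~ sim n (act g^-1%g e.1) (act g^-1%g e.2)].
(** Vertices are the partitions and not the elements of [G]: the stabilizer of a partition may be
    infinite, and the graph must be locally finite. *)
Definition part : choiceType := {v : set (B * B) | `[< exists g, v = partition_at g >]}.
Implicit Types v w : part.

Definition mkpart g : part :=
  exist _ (partition_at g) (asboolT (ex_intro _ g (erefl (partition_at g)))).

Lemma partP v : exists g, v = mkpart g.
Proof. by have /asboolP[g e] := valP v; exists g; apply: val_inj. Qed.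

Definition splits v (a b : B) : Prop := val v (a, b).
Definition splits3 v a b c : Prop := [/\ splits v a b, splits v a c & splits v b c].

Lemma splits_neq v a b : splits v a b -> a <> b.
Proof. by have [g ->] := partP v; move=> h e; apply: h => /=; rewrite e; left. Qed.

Lemma splits_sym v a b : splits v a b -> splits v b a.
Proof. by have [g ->] := partP v; move=> h /(sim_sym um) h'; apply: h. Qed.

Lemma splits_mkpart g a b : splits (mkpart g) a b = ~ sim n (act g^-1%g a) (act g^-1%g b).
Proof. by []. Qed.

Definition touch v w : Prop := exists a b c, splits3 v a b c /\ splits3 w a b c.

Lemma touch_sym v w : touch v w -> touch w v.
Proof. by move=> [a [b [c [? ?]]]]; exists a, b, c. Qed.

Lemma triple_split a b c : a <> b -> a <> c -> b <> c -> exists v, splits3 v a b c.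
Proof.
move=> ab ac bc; have [g [h1 h2 h3]] := cc ab ac bc; exists (mkpart g^-1%g).
by split; rewrite splits_mkpart invgK; apply: simNI; try exact: act_neq; apply: leq_trans n0n.
Qed.

(** Two ways to say that the vertex [v] lies towards [U]. [meets] is suited to connectedness, since
    triples can be changed while two of their points stay in [U]. [within] says that the complement
    of [U] lies in one class of [v], and is suited to bounding coboundaries. *)
Definition meets (U : set B) v : Prop := exists a b c, [/\ splits3 v a b c, U a & U b].
Definition within (U : set B) v : Prop := forall x y, splits v x y -> U x \/ U y.

Lemma meetsS U U' v : U `<=` U' -> meets U v -> meets U' v.
Proof. by move=> UU' [a [b [c [? ? ?]]]]; exists a, b, c; split=> //; exact: UU'. Qed.

Lemma meets_setT v : meets setT v.
Proof.
have [g ->] := partP v; have [b [c [xb xc bc]]] := exists_triple um x0.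
have [h [h1 h2 h3]] := cc xb xc bc.
exists (act (g * h)%g x0), (act (g * h)%g b), (act (g * h)%g c).
split=> //; split; rewrite splits_mkpart !actP.2 !actK.
- by apply: simNI; [exact: act_neq|exact: leq_trans n0n].
- by apply: simNI; [exact: act_neq|exact: leq_trans n0n].
- by apply: simNI; [exact: act_neq|exact: leq_trans n0n].
Qed.

(** Triples with two points in [U] are joined by sliding the third point and by exchanging one point
    at a time. For [U] the whole space this is connectedness of the graph; for [U] a ball it shows
    that the graph has a single end there. *)
Lemma part_chain (U : set B) (S : set part) :
  (forall v w a b c, splits3 v a b c -> splits3 w a b c -> U a -> U b -> S v -> S w) ->
  forall v w, meets U v -> meets U w -> S v -> S w.
Proof.
move=> cS v w [a [b [c [tv Ua Ub]]]] [a' [b' [c' [tw Ua' Ub']]]] Sv.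
pose good a b c := exists v, splits3 v a b c /\ S v.
have slid s t c1 c2 : U s -> U t -> s <> t -> s <> c1 -> t <> c1 -> s <> c2 -> t <> c2 ->
    good s t c1 -> good s t c2.
  move=> Us Ut st sc1 tc1 sc2 tc2; apply: (slide_line (a := s) (b := t) (P := good s t) (c := c1)) => //.
  move=> d d' h1 h2 h3 h4 sl [u [tu Su]].
  have [g [g1 g2 g3 g4 g5]] := slide_n st h1 h2 h3 h4 sl.
  exists (mkpart g^-1%g); split; first by split; rewrite splits_mkpart invgK.
  by apply: (cS u _ s t d) => //; split; rewrite splits_mkpart invgK.
have dist u s t r : splits3 u s t r -> [/\ s <> t, s <> r & t <> r].
  by move=> [h1 h2 h3]; split; [exact: splits_neq h1|exact: splits_neq h2|exact: splits_neq h3].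
have [ab ac bc] := dist _ _ _ _ tv; have [ab' ac' bc'] := dist _ _ _ _ tw.
have swap s t r : good s t r -> good t s r.
  by move=> [u [[h1 h2 h3] Su]]; exists u; split=> //; split=> //; exact: splits_sym.
have rot s t r : good s t r -> good s r t.
  by move=> [u [[h1 h2 h3] Su]]; exists u; split=> //; split=> //; exact: splits_sym.
have turn s t r t' r' : U s -> U t -> U t' -> s <> t -> s <> r -> t <> r ->
    s <> t' -> s <> r' -> t' <> r' -> good s t r -> good s t' r'.
  move=> Us Ut Ut' st sr tr st' sr' tr' g.
  have [e|tt'] := pselect (t = t').
    by subst t'; apply: slid g.
  have g1 : good s t t' by apply: slid g.
  by apply: (slid s t' t r') => //; [exact: nesym|exact: rot].
have ga : good a b c by exists v.
(* When [a] and [a'] differ, the passage goes through the triple [a], [a'], [r] for an auxiliary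
   point [r]. *)
have gw : good a' b' c'.
  have [e|aa'] := pselect (a = a'); first by subst a'; apply: turn ga.
  have [r [ra ra']] := third_point um aa'.
  have ga' : good a a' r by apply: turn ga => //; exact: nesym.
  by apply: (turn a' a r) => //; [exact: nesym|exact: nesym|exact: nesym|exact: swap].
case: gw => u [tu Su]; exact: cS tu tw Ua' Ub' Su.
Qed.

Lemma touch_linked : linked touch setT.
Proof.
move=> X [v [_ Xv]] cX w _.
apply: (part_chain (U := setT) (S := X)) Xv; try exact: meets_setT.
by move=> u u' a b c h1 h2 _ _; apply: cX => //; exists a, b, c.
Qed.

Lemma splits_classes l N (f : B -> 'I_N) g : (forall x y, f x = f y -> sim l x y) ->
  (forall x y, sim l x y -> sim n (act g^-1%g x) (act g^-1%g y)) ->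
  forall x y x' y', f x = f x' -> f y = f y' -> splits (mkpart g) x y -> splits (mkpart g) x' y'.
Proof.
move=> fl lg x y x' y' /fl /lg xx' /fl /lg yy' h h'; apply: h.
apply: (sim_trans um xx'); apply: (sim_trans um h'); exact: (sim_sym um).
Qed.

Lemma sim_or_bound m a b : ~ sim n a b -> ~ sim (maxn n m) a b.
Proof. by move=> h h'; apply: h; apply: sim_le h'; exact: leq_maxl. Qed.

Definition parts_below m : set part := [set v | exists a b c, splits3 v a b c /\
  [/\ p a b < m, p a c < m & p b c < m]%N].

(** The inverse of [g] takes a bounded triple to a bounded triple, so it is equicontinuous with a
    modulus independent of [g]. The partition is then determined by a relation on the finite set of
    balls of one level. *)
Lemma finite_parts_below m : finite_set (parts_below m).
Proof.
have [l hl] := act_equicontinuous um actP qm (maxn n m) n.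
have [N [f fl]] := um_classes um l.
pose code v : {set 'I_N * 'I_N} :=
  [set q | `[< exists x y, splits v x y /\ q = (f x, f y) >]]%SET.
apply: (@finite_by_code _ _ _ code); last exact: finite_finset.
have inv v : parts_below m v -> forall x y x' y', f x = f x' -> f y = f y' ->
    splits v x y -> splits v x' y'.
  have [g ->] := partP v; move=> [a [b [c [[h1 h2 h3] [k1 k2 k3]]]]].
  apply: (splits_classes fl); apply: (hl _ a b c); try exact: sim_or_bound.
  - by apply: simNI; [exact: splits_neq h1|apply: leq_trans k1 (leq_maxr _ _)].
  - by apply: simNI; [exact: splits_neq h2|apply: leq_trans k2 (leq_maxr _ _)].
  - by apply: simNI; [exact: splits_neq h3|apply: leq_trans k3 (leq_maxr _ _)].
have sub v w : parts_below m v -> parts_below m w -> code v = code w -> val v `<=` val w.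
  move=> pv pw e [x y] vxy.
  have : (f x, f y) \in code v by rewrite inE; apply/asboolP; exists x, y.
  rewrite e inE => /asboolP[x' [y' [wxy [e1 e2]]]].
  exact: (inv w pw x' y').
by move=> v w pv pw e; apply: val_inj; apply/seteqP; split; apply: sub.
Qed.

(** A pair split by [v] spans a line passing near [v]. After translating [v] to the standard
    partition, [w] differs from it by an element controlled by the common triple, so both pairs have
    bounded products there; translating back controls the cross-ratio. *)
Lemma touch_mobius : exists M, forall v w, touch v w -> forall x y x' y',
  splits v x y -> splits w x' y' -> x <> x' -> x <> y' -> y <> x' -> y <> y' ->
  (p x y + p x' y' <= p x y' + p y x' + M)%N.
Proof.
have [l hl] := act_equicontinuous um actP qm n n.
have [M hM] := qm (n + l); exists M => v w.
have [g ->] := partP v; have [h ->] := partP w.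
move=> [a [b [c [[h1 h2 h3] [k1 k2 k3]]]]] x y x' y' vxy wxy n1 n2 n3 n4.
have xy := splits_neq vxy; have xy' := splits_neq wxy.
have back z : act (h^-1 * g)%g (act g^-1%g z) = act h^-1%g z.
  by rewrite actP.2 actVK.
have /(@simN _ p)[_ vb] := vxy.
have : ~ sim l (act g^-1%g x') (act g^-1%g y').
  move=> /(hl (h^-1 * g)%g (act g^-1%g a) (act g^-1%g b) (act g^-1%g c)).
  by rewrite !back => H; apply: wxy; apply: H.
move=> /(@simN _ p)[_ wb].
have u : uniq [:: act g^-1%g x; act g^-1%g y; act g^-1%g x'; act g^-1%g y'].
  by apply: act_uniq4; apply: uniq4.
move: vb => /= vb; have := hM g _ _ _ _ u; rewrite !actVK; apply; lia.
Qed.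

Lemma touch_refl v : touch v v.
Proof. by have [a [b [c [h _ _]]]] := meets_setT v; exists a, b, c. Qed.

(** A vertex cannot separate both two points deep in a ball and two points outside a larger ball:
    the lines joining them would be far apart, against [touch_mobius] with both vertices equal to
    [v]. *)
Lemma meets_within j : exists m, forall v x, meets (level_ball m x) v -> within (level_ball j x) v.
Proof.
have [M hM] := touch_mobius; exists (j + M).+1 => v z [a [b [c [[vab _ _] za zb]]]] x y vxy.
apply: contrapT => /not_orP[nx ny].
have zab := sim_trans um za (sim_sym um zb).
have ab := splits_neq vab; have xy := splits_neq vxy.
have zaj : sim j a z by apply: sim_le za; lia.
have zbj : sim j b z by apply: sim_le zb; lia.
have /(@simN _ p)[ax lax] : ~ sim j a x by move=> h; apply: nx; exact: (sim_trans um (sim_sym um h)).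
have /(@simN _ p)[ay lay] : ~ sim j a y by move=> h; apply: ny; exact: (sim_trans um (sim_sym um h)).
have /(@simN _ p)[bx lbx] : ~ sim j b x by move=> h; apply: nx; exact: (sim_trans um (sim_sym um h)).
have /(@simN _ p)[by_ lby] : ~ sim j b y by move=> h; apply: ny; exact: (sim_trans um (sim_sym um h)).
have := hM v v (touch_refl v) a b x y vab vxy ax ay bx by_.
case: zab => [//|zab].
have [u1 u2 u3] := um3 um ab bx ax; have [v1 v2 v3] := um3 um ax xy ay.
rewrite (psym x) in v2 *; lia.
Qed.

(** Of a triple split by [v], at least two points differ from [x], hence lie outside a small ball
    around [x]; now [meets_within] excludes smaller balls. *)
Lemma not_meets v x : exists j, ~ meets (level_ball j x) v.
Proof.
have [a [b [c [[ab ac bc] _ _]]]] := meets_setT v.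
have [m hm] := meets_within (p a x + p b x + p c x).+1; exists m => /hm wv.
have nb z : z <> x -> (p z x <= p a x + p b x + p c x)%N ->
    ~ level_ball (p a x + p b x + p c x).+1 x z.
  by move=> zx h; apply: simNI.
have [ax|ax] := pselect (a = x).
  have bx : b <> x by move=> e; apply: (splits_neq ab); rewrite e.
  have cx : c <> x by move=> e; apply: (splits_neq ac); rewrite e.
  by case: (wv _ _ bc); apply: nb => //; lia.
have [bx|bx] := pselect (b = x).
  have cx : c <> x by move=> e; apply: (splits_neq bc); rewrite e.
  by case: (wv _ _ ac); apply: nb => //; lia.
by case: (wv _ _ ab); apply: nb => //; lia.
Qed.

Lemma meets_ball j x : exists v, meets (level_ball j x) v.
Proof.
have [b [bx /andP[jb _]]] := um_branch um x j.
have [c [cx cb]] := third_point um (nesym bx).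
have [v hv] := triple_split (nesym bx) (nesym cx) (nesym cb).
exists v, x, b, c; split=> //; first exact: simxx.
by right; rewrite psym.
Qed.

Lemma level_ball_sub i j x : (i <= j)%N -> level_ball j x `<=` level_ball i x.
Proof. by move=> ij y; exact: sim_le. Qed.

Lemma meets_le i j x v : (i <= j)%N -> meets (level_ball j x) v -> meets (level_ball i x) v.
Proof. by move=> ij; apply: meetsS; exact: level_ball_sub. Qed.

(** [w] splits a pair outside the ball. Every pair split by [v] has a point in the ball, so its
    product is bounded, by the ultrametric inequality or by comparison with the pair of [w]. The
    bound does not depend on [x], whence the uniform size of cuts. *)
Lemma touch_within_below j : exists m, forall x v w, touch v w ->
  within (level_ball j x) v -> ~ within (level_ball j x) w -> parts_below m v /\ parts_below m w.
Proof.
have [M hM] := touch_mobius; exists (M + j + j).+1 => z v w vw.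
move=> wv /existsNP[x /existsNP[y /not_implyP[wxy /not_orP[nx ny]]]].
have xy := splits_neq wxy.
have neq s t : level_ball j z s -> ~ level_ball j z t -> ~ sim j s t.
  by move=> zs zt st; apply: zt; exact: (sim_trans um (sim_sym um st)).
have bound s t : splits v s t -> (p s t < (M + j + j).+1)%N.
  move=> vst; have st := splits_neq vst; rewrite ltnS.
  have [zs|zs] := pselect (level_ball j z s); have [zt|zt] := pselect (level_ball j z t).
  - have [sx lsx] := simN (neq _ _ zs nx); have [sy lsy] := simN (neq _ _ zs ny).
    have [tx ltx] := simN (neq _ _ zt nx); have [ty lty] := simN (neq _ _ zt ny).
    have := hM v w vw s t x y vst wxy sx sy tx ty; lia.
  - by have [_ ?] := simN (neq _ _ zs zt); lia.
  - by have [_ ?] := simN (neq _ _ zt zs); rewrite psym; lia.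
  - by case: (wv _ _ vst).
have [a [b [c [tv tw]]]] := vw; case: (tv) => h1 h2 h3.
by split; exists a, b, c; split=> //; split; exact: bound.
Qed.

Definition end_set (S : set part) : set B :=
  [set x | exists j, forall v, meets (level_ball j x) v -> S v].
Definition ball_cut j x : set part := [set v | within (level_ball j x) v].

Lemma ball_cut_bound j : exists m, forall x,
  coboundary touch (ball_cut j x) `<=` parts_below m `*` parts_below m.
Proof.
have [m hm] := touch_within_below j; exists m => x [v w] [/= vw ne].
have [wv|wv] := pselect (within (level_ball j x) v).
  by have [] := hm _ _ _ vw wv (fun h => ne (conj (fun=> h) (fun=> wv))).
have [ww|ww] := pselect (within (level_ball j x) w).
  by have [? ?] := hm _ _ _ (touch_sym vw) ww wv.
by exfalso; apply: ne; split.
Qed.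

Lemma fin_ball_cut j x : fin_cob touch (ball_cut j x).
Proof.
have [m hm] := ball_cut_bound j; apply: sub_finite_set (hm x) _.
by apply: finite_setX; exact: finite_parts_below.
Qed.

(** By [not_meets] and finiteness, no edge leaving [S] starts at a vertex meeting a small enough
    ball around [x]. The vertices meeting that ball are connected by [part_chain], so they lie all
    in [S] or all outside. *)
Lemma end_setC S x : fin_cob touch S -> (end_set (~` S) x <-> ~ end_set S x).
Proof.
move=> fS; split=> [[j hj] [i hi]|nS].
  have [v hv] := meets_ball (maxn i j) x.
  by apply: (hj v (meets_le (leq_maxr i j) hv)); exact: (hi v (meets_le (leq_maxl i j) hv)).
have [j hj] : exists j, forall e, coboundary touch S e -> ~ meets (level_ball j x) e.1.
  have [s hs] := choice (fun v => not_meets v x).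
  exists (\max_(e <- fset_set (coboundary touch S)) s e.1) => e Se h.
  apply: (hs e.1); apply: meets_le h.
  by rewrite (bigD1_seq e) ?fset_uniq ?in_fset_set ?mem_set//= leq_maxl.
have cS v w a b c : splits3 v a b c -> splits3 w a b c ->
    level_ball j x a -> level_ball j x b -> (~` S) v -> (~` S) w.
  move=> tv tw ja jb nSv Sw; apply: (hj (v, w)) => /=; last by exists a, b, c.
  by split=> /=; [exists a, b, c|move=> [_ /(_ Sw)]].
have [v [mv Sv]] : exists v, meets (level_ball j x) v /\ ~ S v.
  apply: contrapT => h; apply: nS; exists j => v mv; apply: contrapT => Sv.
  by apply: h; exists v.
by exists j => w mw; exact: (part_chain cS mv mw).
Qed.

Lemma end_setI S S' x : end_set (S `&` S') x <-> end_set S x /\ end_set S' x.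
Proof.
split=> [[j h]|[[i hi] [j hj]]].
  by split; exists j => v /h[].
exists (maxn i j) => v hv.
by split; [exact: (hi v (meets_le (leq_maxl i j) hv))|exact: (hj v (meets_le (leq_maxr i j) hv))].
Qed.

Lemma end_set_ball j x : end_set (ball_cut j x) = level_ball j x.
Proof.
have [m hm] := meets_within j.
have in_ball y : level_ball j x y -> end_set (ball_cut j x) y.
  move=> xy; exists m => v /hm wv s t /wv[h|h]; [left|right]; exact: (sim_trans um h xy).
apply/seteqP; split=> y; last exact: in_ball.
apply: contraPP => nxy; apply/(end_setC y (fin_ball_cut j x)).
exists (maxn m j) => v mv wv.
have [a [b [c [[vab _ _] ya yb]]]] := mv.
have yj z : level_ball (maxn m j) y z -> sim j z y by apply: sim_le; exact: leq_maxr.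
case: (wv _ _ vab) => h; apply: nxy.
  exact: (sim_trans um (sim_sym um (yj _ ya)) h).
exact: (sim_trans um (sim_sym um (yj _ yb)) h).
Qed.

Lemma end_set_open S x : end_set S x -> exists j, level_ball j x `<=` end_set S.
Proof.
move=> [j h]; exists j => y xy; exists j => v mv; apply: h; apply: meetsS mv => z zy.
exact: (sim_trans um zy xy).
Qed.

Lemma actp_subproof g v :
  `[< exists h, [set e | val v (act g^-1%g e.1, act g^-1%g e.2)] = partition_at h >].
Proof.
apply/asboolP; have [h ->] := partP v; exists (g * h)%g.
by apply/seteqP; split=> e; rewrite /= /partition_at /= invgM !actP.2.
Qed.

Definition actp g v : part :=
  exist (fun u : set (B * B) => `[< exists h, u = partition_at h >]) _ (actp_subproof g v).

Lemma splits_actp g v a b : splits (actp g v) a b = splits v (act g^-1%g a) (act g^-1%g b).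
Proof. by []. Qed.

Lemma actpK g : cancel (actp g) (actp g^-1%g).
Proof.
move=> v; apply: val_inj; apply/seteqP; split=> -[a b] /=; by rewrite invgK !actK.
Qed.

Lemma actpVK g : cancel (actp g^-1%g) (actp g).
Proof. by move=> v; rewrite -{2}(actpK g^-1%g v) invgK. Qed.

Lemma actp_mkpart g : actp g^-1%g (mkpart g) = mkpart 1%g.
Proof.
apply: val_inj; apply/seteqP; split=> -[a b] /=; rewrite /partition_at /= invgK !actK.
  by rewrite invg1 !actP.1.
by rewrite invg1 !actP.1.
Qed.

Lemma touch_actp g v w : touch v w -> touch (actp g v) (actp g w).
Proof.
move=> [a [b [c [[h1 h2 h3] [k1 k2 k3]]]]]; exists (act g a), (act g b), (act g c).
by split; split; rewrite splits_actp !actK.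
Qed.

Lemma end_set_actp g S x : end_set (actp g^-1%g @^-1` S) (act g x) <-> end_set S x.
Proof.
have fwd h S' y : end_set S' y -> end_set (actp h^-1%g @^-1` S') (act h y).
  move=> [j hj]; have [l hl] := act_continuous x0 um actP qm h^-1%g j.
  exists l => v [a [b [c [[h1 h2 h3] ha hb]]]]; apply: hj.
  exists (act h^-1%g a), (act h^-1%g b), (act h^-1%g c); split.
  - by split; rewrite splits_actp invgK !actVK.
  - by have := hl _ _ ha; rewrite actK.
  - by have := hl _ _ hb; rewrite actK.
split=> [/(fwd g^-1%g)|]; last exact: fwd.
rewrite actK invgK; congr (end_set _ x).
by apply/seteqP; split=> v; rewrite /= actpK.
Qed.

Lemma part_automorphism g : cut_automorphism touch end_set (actp g) (actp g^-1%g) (act g).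
Proof.
split; [exact: actpK|exact: actpVK|exact: touch_actp|].
by move=> S x _; exact: end_set_actp.
Qed.

Lemma part_automorphismV g : cut_automorphism touch end_set (actp g^-1%g) (actp g) (act g^-1%g).
Proof. by have := part_automorphism g^-1%g; rewrite invgK. Qed.

(** Any two points, completed to a triple, are moved into bounded position, where a ball of level
    [n0] separates them; the size of its cut is bounded independently of its centre and invariant
    under translation. *)
Lemma part_cuts_bounded : exists k0, forall a b, a <> b ->
  exists S, separates touch end_set a b S /\ (cut_size touch S <= k0)%N.
Proof.
have [m hm] := ball_cut_bound n0.
have fm : finite_set (parts_below m `*` parts_below m) by apply: finite_setX; exact: finite_parts_below.
exists (csize (parts_below m `*` parts_below m)) => a b ab.
have [c [ca cb]] := third_point um ab.
have [g [h1 _ _]] := cc ab (nesym ca) (nesym cb).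
pose S := ball_cut n0 (act g a).
have S0 : fin_cob touch S by exact: fin_ball_cut.
exists (actp g @^-1` S); split; last first.
  rewrite (cut_size_aut (part_automorphismV g) (part_automorphism g) S0).
  by apply: csize_le => //; exact: hm.
rewrite -(actK g a) -(actK g b).
apply: (separates_aut (part_automorphismV g) (part_automorphism g)); split=> //.
rewrite end_set_ball => -[/(_ (or_introl erefl)) h _].
have := simNI (act_neq (g := g) ab) h1; apply; exact: (sim_sym um).
Qed.

(** * The end sets of optimal cuts *)

Section Family.
Variable k0 : nat.
Hypothesis bounded_cuts : forall a b, a <> b ->
  exists S, separates touch end_set a b S /\ (cut_size touch S <= k0)%N.

Let ddC S x : fin_cob touch S -> (end_set (~` S) x <-> ~ end_set S x).
Proof. exact: end_setC. Qed.
Let ddI S S' x : fin_cob touch S -> fin_cob touch S' ->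
  (end_set (S `&` S') x <-> end_set S x /\ end_set S' x).
Proof. by move=> _ _; exact: end_setI. Qed.

Definition opt_family : set (set B) :=
  [set E | exists S a b, opt_cut touch end_set a b S /\ E = end_set S].

Lemma opt_family_compl E : opt_family E -> opt_family (~` E).
Proof.
move=> [S [a [b [oS ->]]]]; exists (~` S), a, b; split.
  exact: (opt_cutC ddC oS).
by case: oS => -[[fS _] _] _; apply/seteqP; split=> x; rewrite /= ddC.
Qed.

Let fX S : fin_cob touch S -> finite_set [set F | is_min_cut touch end_set F /\ crosses F S].
Proof. exact: (finite_crossing touch_sym touch_linked ddC ddI bounded_cuts). Qed.

Lemma opt_cut_actp g a b S : opt_cut touch end_set a b S ->
  opt_cut touch end_set (act g a) (act g b) (actp g^-1%g @^-1` S).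
Proof.
exact: (opt_cut_aut (actK g) (actVK g) (part_automorphism g) (part_automorphismV g) fX).
Qed.

Lemma opt_family_act g E : opt_family E -> opt_family (act g @^-1` E).
Proof.
move=> [S [a [b [oS ->]]]].
exists (actp g^-1%g^-1%g @^-1` S), (act g^-1%g a), (act g^-1%g b); split; first exact: opt_cut_actp.
apply/seteqP; split=> x; first by move/(end_set_actp g^-1%g); rewrite actK.
by rewrite -{1}(actK g x) => /end_set_actp.
Qed.

Lemma opt_family_nonempty E : opt_family E -> exists x, E x.
Proof.
move=> [S [a [b [[[[_ s] _] _] ->]]]]; apply: contrapT => h; apply: s.
by split=> ?; exfalso; apply: h; [exists a|exists b].
Qed.

Lemma crosses_end_set S S' : fin_cob touch S -> fin_cob touch S' ->
  crosses (end_set S) (end_set S') -> crosses S S'.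
Proof.
move=> fS fS'.
have pt X Y x : end_set X x -> end_set Y x -> exists v, X v /\ Y v.
  move=> Xx Yx; have [j hj] : end_set (X `&` Y) x by apply/end_setI.
  by have [v /hj] := meets_ball j x; exists v.
by move=> [[a [? ?]] [b [? ?]] [c [? ?]] [d [? ?]]]; split;
  [apply: (pt _ _ a)|apply: (pt _ _ b)|apply: (pt _ _ c)|apply: (pt _ _ d)] => //; apply/end_setC.
Qed.

Lemma opt_family_nested E F : opt_family E -> opt_family F -> ~ crosses E F.
Proof.
move=> [S [a [b [oS ->]]]] [S' [a' [b' [oS' ->]]]] /crosses_end_set.
have [[[fS _] _] _] := oS; have [[[fS' _] _] _] := oS'.
move=> /(_ fS fS'); exact: (opt_cuts_nested touch_sym touch_linked ddC ddI bounded_cuts oS oS').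
Qed.

Lemma opt_family_sep x y : x <> y -> exists E, [/\ opt_family E, E x & ~ E y].
Proof.
move=> xy; have [S oS] := opt_cut_ex bounded_cuts xy; have [[[fS s] _] _] := oS.
have [Sx|Sx] := pselect (end_set S x).
  exists (end_set S); split=> //; first by exists S, x, y.
  by move=> Sy; apply: s; split.
exists (end_set (~` S)); split.
- by exists (~` S), x, y; split=> //; exact: (opt_cutC ddC oS).
- exact/ddC.
- by move/(ddC y fS) => Sy; apply: s; split=> // ?; exfalso.
Qed.

Lemma opt_family_open E x : opt_family E -> E x -> exists j, level_ball j x `<=` E.
Proof. by move=> [S [a [b [_ ->]]]]; exact: end_set_open. Qed.

(** Counterexamples for all [l] would accumulate at two distinct points; since both sides of a
    member separating these are open, it also serves for nearby pairs. *)
Lemma opt_family_sep_uniform m : exists l, forall x y, ~ sim m x y ->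
  exists E, [/\ opt_family E, E x & forall z, sim l z y -> ~ E z].
Proof.
apply: contrapT => h.
have /choice[u hu] : forall l, exists e : B * B, ~ sim m e.1 e.2 /\
    ~ exists E, [/\ opt_family E, E e.1 & forall z, sim l z e.2 -> ~ E z].
  move=> l; apply: contrapT => h'; apply: h; exists l => x y xy.
  by apply: contrapT => h''; apply: h'; exists (x, y).
have [x [s [sle hs]]] := um_cluster um (fun i => (u i).1).
have [y [t [tle ht]]] := um_cluster um (fun i => (u (s i)).2).
have xy : ~ sim m x y.
  move=> xy; apply: (hu (s (t m))).1.
  apply: (sim_trans um (sim_le _ (hs (t m)))) => //.
  by apply: (sim_trans um xy); apply: (sim_sym um); exact: ht.
have [E [oE Ex Ey]] := opt_family_sep (simN xy).1.
have [j hj] := opt_family_open oE Ex.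
have [i hi] := opt_family_open (opt_family_compl oE) Ey.
pose k := maxn i j.
apply: (hu (s (t k))).2; exists E; split=> //.
  apply: hj; apply: sim_le (hs (t k)); apply: leq_trans (tle k); exact: leq_maxr.
move=> z zy; apply: hi.
apply: (sim_trans um (sim_le _ zy)).
  by apply: leq_trans (sle _); apply: leq_trans (tle _); exact: leq_maxl.
by apply: sim_le (ht k); exact: leq_maxl.
Qed.

(* Every point is a conical limit point: a translation taking a triple
   [(x, y, z)] with [z] close to [x] to bounded position contracts the
   complement of a small ball around [x] to a neighbourhood of one point. *)
Lemma opt_family_basis x j : exists E, [/\ opt_family E, E x & E `<=` level_ball j x].
Proof.
have [l hl] := opt_family_sep_uniform n0.
have [M hM] := mobius_contra actP qm (l + n0).
have [y [yx /andP[_ y0]]] := um_branch um x 0.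
(* For [t] outside the ball, [p t z < j], while [p x y <= D]; this lower bound on [p x z]
   contradicts the cross-ratio inequality obtained from [hM]. *)
have [z [zx /andP[z0 _]]] := um_branch um x (j + D + M).+1.
have zy : z <> y by move=> e; rewrite e in z0; lia.
have [g [h1 h2 h3]] := cc (nesym yx) (nesym zx) (nesym zy).
have gxy := simNI (act_neq (g := g) (nesym yx)) h1.
have [E [oE Ex Ey]] := hl _ _ gxy.
exists (act g @^-1` E); split=> //; first exact: opt_family_act.
move=> t /= Et; apply: contrapT => /(@simN _ p)[tx ltx].
have tz : t <> z by move=> e; rewrite e psym in ltx; lia.
have ty : t <> y by move=> e; apply: (Ey _ _ Et); rewrite e; left.
have /(@simN _ p)[_ lt] : ~ sim l (act g t) (act g y) by move=> h; exact: (Ey _ h Et).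
have u : uniq [:: t; y; x; z] by apply: uniq4 => //; exact: nesym.
have := hM g _ _ _ _ u.
have [u1 u2 u3] := um3 um tx (nesym zx) tz.
rewrite (psym y x); lia.
Qed.

Lemma opt_family_finite x j : finite_set [set E | opt_family E /\ crosses E (level_ball j x)].
Proof.
have fb := fin_ball_cut j x.
apply: sub_finite_set (finite_image end_set (fX fb)) => E [[S [a [b [oS ->]]]] cE].
exists S => //; split; first by exists a, b; case: oS.
apply: crosses_end_set => //; first by case: oS => -[[]].
by rewrite end_set_ball.
Qed.

(** As [G] is transitive on vertices, every cut has a translate with an edge leaving the base vertex
    [v0]. The other end of that edge lies in the finite set [parts_below n], and finitely many
    minimal cuts separate two given vertices. *)
Lemma opt_family_orbits : exists2 FF : set (set B), finite_set FF &
  FF `<=` opt_family /\ forall E, opt_family E -> exists g, FF (act g @^-1` E).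
Proof.
pose v0 := mkpart 1%g.
pose K := \bigcup_(w in parts_below n)
  [set S | is_min_cut touch end_set S /\ (S v0 /\ ~ S w)].
have fK : finite_set K.
  apply: bigcup_finite => [|w _]; first exact: finite_parts_below.
  exact: (finite_min_cuts_sep touch_sym touch_linked ddC ddI bounded_cuts).
exists ((end_set @` K) `&` opt_family); first by apply: finite_setIl; exact: finite_image.
split=> [E []//|E oE]; have [S [a [b [oS eE]]]] := oE.
have [[[fS s] _] _] := oS.
have [v [w [vw Sv Sw]]] : exists v w, [/\ touch v w, S v & ~ S w].
  apply: contrapT => h; apply: s.
  have cS u w : touch u w -> S u -> S w.
    by move=> uw Su; apply: contrapT => Sw; apply: h; exists u, w.
  have [[v Sv]|nS] := pselect (exists v, S v).
    have ST : S = setT.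
      apply/seteqP; split=> // u _; apply: (touch_linked (X := S)) => //; first by exists v.
      by move=> t w _ _; exact: cS.
    by rewrite ST; split=> _; exists 0%N.
  have S0 : S = set0 by apply/seteqP; split=> // u Su; apply: nS; exists u.
  by rewrite S0; split=> -[j hj]; [have [u /hj] := meets_ball j a|have [u /hj] := meets_ball j b].
have [g eg] := partP v; exists g; split; last exact: opt_family_act.
exists (actp g^-1%g^-1%g @^-1` S).
  exists (actp g^-1%g w).
    have : touch (actp g^-1%g v) (actp g^-1%g w) by exact: touch_actp.
    rewrite eg actp_mkpart => -[c [d [e [[h1 h2 h3] tw]]]]; exists c, d, e; split=> //.
    have lt q r : splits (mkpart 1%g) q r -> (p q r < n)%N.
      by move=> /(@simN _ p)[_] /=; rewrite invg1 !actP.1.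
    by split; exact: lt.
  split; first by exists (act g^-1%g a), (act g^-1%g b); case: (opt_cut_actp g^-1%g oS).
  rewrite /= /v0 -(actp_mkpart g) invgK !actpVK; split=> //.
  by rewrite -eg.
rewrite eE; apply/seteqP; split=> x /=; first by rewrite -{1}(actK g x) => /end_set_actp.
by move/(end_set_actp g^-1%g); rewrite actK.
Qed.

Lemma opt_family_cut_family : cut_family p act opt_family.
Proof.
split.
- exact: opt_family_compl.
- exact: opt_family_act.
- exact: opt_family_nonempty.
- exact: opt_family_nested.
- exact: opt_family_open.
- exact: opt_family_finite.
- exact: opt_family_basis.
- exact: opt_family_orbits.
Qed.

End Family.

End CutGraph.

Theorem cut_family_ex (B : choiceType) (p : B -> B -> nat) (G : groupType)
    (act : G -> B -> B) (D n0 : nat) (x0 : B) :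
  branching_ultrametric p D -> is_action act -> uniformly_mobius p act ->
  triple_bounded p act n0 -> exists EE, cut_family p act EE.
Proof.
move=> um actP qm cc.
have [n n0n slide_n] := slide_bounded um actP qm cc (D + D + 2).
have [k0 hk] := part_cuts_bounded x0 um actP qm cc n0n slide_n.
exact: (ex_intro _ _ (opt_family_cut_family x0 um actP qm cc n0n slide_n hk)).
Qed.

(** * Trees and their boundaries *)

Section TreeDistance.
Variable T : tree.
Local Notation V := (vertex T).
Implicit Types (o u v w x : V).

Lemma dist_subproof u v : exists n,
  `[< exists p, [/\ path (@adj T) u p, last u p = v & size p = n] >].
Proof. by have [p up pv] := tree_connected u v; exists (size p); apply/asboolP; exists p. Qed.

Definition dist u v : nat := ex_minn (dist_subproof u v).

Lemma dist_path u v : exists p, [/\ path (@adj T) u p, last u p = v & size p = dist u v].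
Proof. by rewrite /dist; case: ex_minnP => n /asboolP. Qed.

Lemma dist_le u p : path (@adj T) u p -> (dist u (last u p) <= size p)%N.
Proof.
by move=> up; rewrite /dist; case: ex_minnP => n _; apply; apply/asboolP; exists p.
Qed.

Lemma distxx u : dist u u = 0%N.
Proof. by apply/eqP; rewrite -leqn0; exact: (@dist_le u [::]). Qed.

Lemma dist_eq0 u v : dist u v = 0%N -> u = v.
Proof. by have [[|a p] [_ /= <- <-]] := dist_path u v. Qed.

Lemma rev_tree_path u p : path (@adj T) u p -> path (@adj T) (last u p) (rev (belast u p)).
Proof. by rewrite rev_path; apply: sub_path => a b; rewrite adj_sym. Qed.

Lemma last_rev_belast u (p : seq V) : last (last u p) (rev (belast u p)) = u.
Proof. by case: p => //= v p; rewrite rev_cons last_rcons. Qed.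

Lemma dist_sym u v : dist u v = dist v u.
Proof.
have le a b : (dist a b <= dist b a)%N.
  have [p [bp <- <-]] := dist_path b a.
  by have := dist_le (rev_tree_path bp); rewrite last_rev_belast size_rev size_belast.
by apply/eqP; rewrite eqn_leq !le.
Qed.

Lemma dist_triangle u v w : (dist u w <= dist u v + dist v w)%N.
Proof.
have [p [up pv <-]] := dist_path u v; have [q [vq qw <-]] := dist_path v w.
have := @dist_le u (p ++ q); rewrite cat_path up pv vq => /(_ isT).
by rewrite last_cat pv qw size_cat.
Qed.

Lemma dist_adj u v : adj u v -> (dist u v <= 1)%N.
Proof. by move=> uv; apply: (@dist_le u [:: v]); rewrite /= uv. Qed.

Lemma dist_pred u v : u <> v -> exists w, adj w v /\ dist u v = (dist u w).+1.
Proof.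
move=> uv; have [p [up pv sp]] := dist_path u v.
case/lastP: p up pv sp => [|p z]; first by move=> _ /=.
rewrite rcons_path last_rcons size_rcons => /andP[up pz] zv; subst z => sp.
exists (last u p); split=> //; have := dist_le up; have := dist_triangle u (last u p) v.
by have := dist_adj pz; lia.
Qed.

Lemma dist_mem u p v : path (@adj T) u p -> v \in u :: p ->
  v = last u p \/ (dist u v < size p)%N.
Proof.
move=> up; rewrite inE => /orP[/eqP->|vp].
  by case: p up => [|a p] up; [left|right; rewrite distxx].
case/splitPr: vp up => p1 p2; rewrite cat_path => /andP[up1 /= /andP[uv vp2]].
case: p2 vp2 => [|b p2] vp2; first by left; rewrite last_cat.
right; have := @dist_le u (rcons p1 v); rewrite rcons_path up1 uv last_rcons size_rcons.
by move=> /(_ isT); rewrite size_cat /=; lia.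
Qed.

(** Geodesics from [o] to [w] and to [w'] avoid [u], so two distinct such neighbours of [u] would
    close a cycle through [u]. *)
Lemma parent_uniq o u w w' : adj u w -> adj u w' ->
  (dist o w <= dist o u)%N -> (dist o w' <= dist o u)%N -> w = w'.
Proof.
move=> uw uw' lw lw'; apply/eqP/negPn/negP => ww'.
have avoid x : adj u x -> (dist o x <= dist o u)%N ->
    exists p, [/\ path (@adj T) o p, last o p = x & u \notin o :: p].
  move=> ux lx; have [p [op px sp]] := dist_path o x; exists p; split=> //.
  apply/negP => /(dist_mem op)[|]; last by rewrite sp; lia.
  by rewrite px => ue; move: ux; rewrite ue adj_irr.
have [p [op pw up]] := avoid _ uw lw; have [q [oq qw' uq]] := avoid _ uw' lw'.
pose r := rev (belast o p) ++ q.
have wr : path (@adj T) w r.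
  by rewrite /r cat_path -{1 2}pw rev_tree_path// last_rev_belast.
have rl : last w r = w' by rewrite /r last_cat -{1}pw last_rev_belast.
have ur : u \notin w :: r.
  apply/negP; rewrite inE mem_cat mem_rev => /orP[/eqP ue|/orP[ub|uq']].
  - by move: uw; rewrite ue adj_irr.
  - by move/negP: up; apply; rewrite lastI mem_rcons inE ub orbT.
  - by move/negP: uq; apply; rewrite inE uq' orbT.
case/shortenP: wr rl => r' wr' ur' sub rl'.
have /tree_acyclic : ucycle (@adj T) (u :: w :: r').
  rewrite /ucycle /= rcons_path rl' uw wr' (adj_sym w') uw' /=.
  move: ur'; rewrite /= => ->; rewrite andbT; apply/negP; rewrite inE => /orP[/eqP ue|/sub ue].
    by move: uw; rewrite ue adj_irr.
  by move/negP: ur; apply; rewrite inE ue orbT.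
case: r' {sub ur' wr'} rl' => [/= e|? ? _ //].
by move: ww'; rewrite e eqxx.
Qed.

Lemma adj_dist o u v : adj u v -> dist o v = (dist o u).+1 \/ dist o u = (dist o v).+1.
Proof.
move=> uv; have := dist_triangle o u v; have := dist_triangle o v u.
have := dist_adj uv; rewrite (dist_sym v u).
have [e|ne] := eqVneq (dist o u) (dist o v); last by move/eqP: ne; lia.
exfalso; have [ou|ou] := pselect (o = u).
  by move: uv; rewrite -(dist_eq0 (etrans (esym e) _)) -?ou ?distxx// adj_irr.
have [w [wu d]] := dist_pred ou.
have vw : v = w by apply: (@parent_uniq o u) => //; [rewrite adj_sym|lia|lia].
by move: d; rewrite e vw; lia.
Qed.

Lemma geodesic_point o u n : (n <= dist o u)%N ->
  exists w, dist o w = n /\ dist w u = (dist o u - n)%N.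
Proof.
have [k] := ubnP (dist o u); elim: k u => // k IH u lk le.
have [e|ne] := eqVneq n (dist o u); first by exists u; rewrite e distxx subnn.
have ou : o <> u by move=> ou; rewrite -ou distxx in le ne; move/eqP: ne; lia.
have [v [vu d]] := dist_pred ou.
have [||w [ow wv]] := IH v; [lia|by move/eqP: ne; lia|].
exists w; split=> //; have := dist_triangle w v u; have := dist_triangle o w u.
by have := dist_adj vu; lia.
Qed.

Lemma geodesic_uniq o u n w w' : (n <= dist o u)%N ->
  dist o w = n -> dist w u = (dist o u - n)%N ->
  dist o w' = n -> dist w' u = (dist o u - n)%N -> w = w'.
Proof.
move e : (dist o u - n)%N => k; elim: k n w w' e => [|k IH] n w w' e le ow wu ow' w'u.
  by rewrite (dist_eq0 wu) (dist_eq0 w'u).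
have next x : dist o x = n -> dist x u = k.+1 ->
    exists y, [/\ adj y x, dist o y = n.+1 & dist y u = k].
  move=> ox xu; have ux : u <> x by move=> ux; rewrite ux distxx in xu.
  have [y [yx d]] := dist_pred ux; rewrite dist_sym xu in d; case: d => d.
  exists y; rewrite (dist_sym y u) -d; split=> //.
  have := dist_triangle o x y; have := dist_triangle o y u; have := dist_adj yx.
  by rewrite (dist_sym x y) (dist_sym y u); lia.
have [y [yw oy yu]] := next _ ow wu; have [y' [yw' oy' yu']] := next _ ow' w'u.
have yy' : y = y' by apply: (IH n.+1) => //; lia.
by apply: (@parent_uniq o y) => //; rewrite ?yy'//; lia.
Qed.

Lemma lev_subproof o u n : exists w, (n <= dist o u)%N ->
  dist o w = n /\ dist w u = (dist o u - n)%N.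
Proof.
have [h|h] := leqP n (dist o u); last by exists o; lia.
by have [w hw] := geodesic_point h; exists w.
Qed.

(* The point at distance [n] from [o] on the geodesic from [o] to [u]; it is
   meaningful only for [n <= dist o u]. *)
Definition lev o n u : V := projT1 (cid (lev_subproof o u n)).

Lemma levP o n u : (n <= dist o u)%N ->
  dist o (lev o n u) = n /\ dist (lev o n u) u = (dist o u - n)%N.
Proof. by rewrite /lev; case: cid. Qed.

Lemma lev_eq o n u w : dist o w = n -> (dist o w + dist w u)%N = dist o u -> lev o n u = w.
Proof.
move=> ow e; have le : (n <= dist o u)%N by lia.
by have [h1 h2] := levP le; apply: (geodesic_uniq le) => //; lia.
Qed.

Lemma lev0 o u : lev o 0 u = o.
Proof. by apply: lev_eq; rewrite distxx. Qed.

Lemma lev_id o u : lev o (dist o u) u = u.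
Proof. by apply: lev_eq; rewrite ?distxx ?addn0. Qed.

Lemma lev_lev o m n u : (m <= n)%N -> (n <= dist o u)%N -> lev o m (lev o n u) = lev o m u.
Proof.
move=> mn nu; have [h1 h2] := levP nu.
have le : (m <= dist o (lev o n u))%N by rewrite h1.
have [k1 k2] := levP le; apply/esym; apply: lev_eq => //.
have := dist_triangle o (lev o m (lev o n u)) u.
have := dist_triangle (lev o m (lev o n u)) (lev o n u) u; lia.
Qed.

Definition agree o u v n := [/\ n <= dist o u, n <= dist o v & lev o n u = lev o n v]%N.

Lemma gp_subproof o u v : exists n, `[< agree o u v n >].
Proof. by exists 0%N; apply/asboolP; split=> //; rewrite !lev0. Qed.

Lemma gp_bound o u v n : `[< agree o u v n >] -> (n <= dist o u)%N.
Proof. by case/asboolP. Qed.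

(* The Gromov product of two vertices based at a third one. *)
Definition gp o u v : nat := ex_maxn (gp_subproof o u v) (@gp_bound o u v).

Lemma gp_agree o u v : agree o u v (gp o u v).
Proof. by rewrite /gp; case: ex_maxnP => n /asboolP. Qed.

Lemma gp_geP o u v n : (n <= gp o u v)%N <-> agree o u v n.
Proof.
split=> [le|h]; last by rewrite /gp; case: ex_maxnP => m _; apply; apply/asboolP.
have [h1 h2 h3] := gp_agree o u v; split; [lia|lia|].
by rewrite -(lev_lev le h1) -(lev_lev le h2) h3.
Qed.

Lemma gp_sym o u v : gp o u v = gp o v u.
Proof.
have le a b : (gp o a b <= gp o b a)%N.
  by apply/gp_geP; have [? ? ?] := gp_agree o a b.
by apply/eqP; rewrite eqn_leq !le.
Qed.

Lemma gp_le o u v : (gp o u v <= dist o u)%N.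
Proof. by have [] := gp_agree o u v. Qed.

Lemma gp_ultra o u v w : (minn (gp o u v) (gp o v w) <= gp o u w)%N.
Proof.
apply/gp_geP; set m := minn _ _.
have /gp_geP[h1 h2 h3] : (m <= gp o u v)%N by exact: geq_minl.
have /gp_geP[h4 h5 h6] : (m <= gp o v w)%N by exact: geq_minr.
by split=> //; rewrite h3.
Qed.

(** Identifies the length of the common initial segment with the usual formula for the Gromov
    product, by moving [u] one step towards [v] at a time. *)
Lemma dist_gp o u v : (dist u v + 2 * gp o u v)%N = (dist o u + dist o v)%N.
Proof.
apply/eqP; rewrite eqn_leq; apply/andP; split.
  have [h1 h2 h3] := gp_agree o u v.
  have [_ e1] := levP h1; have [_ e2] := levP h2.
  have := dist_triangle u (lev o (gp o u v) u) v.
  by rewrite (dist_sym u (lev _ _ _)) e1 {1}h3 e2; lia.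
move e : (dist u v) => n; elim: n u e => [|n IH] u e.
  rewrite (dist_eq0 e).
  have : (dist o v <= gp o v v)%N by apply/gp_geP.
  lia.
have vu : v <> u by move=> vu; rewrite vu distxx in e.
have [u' [uu' d]] := dist_pred vu; rewrite dist_sym e in d; case: d => d.
have {}IH := IH u'; rewrite dist_sym -d in IH; have {}IH := IH erefl.
have := gp_agree o u' v; have := gp_le o u' v.
move: (gp o u' v) IH => k IH g [h1 h2 h3].
case: (adj_dist o uu') => ou.
  have : (k <= gp o u v)%N.
    apply/gp_geP; split=> //; [lia|rewrite -h3].
    have e' : lev o (dist o u') u = u'.
      apply: lev_eq => //; have := dist_triangle o u' u; have := dist_adj uu'; lia.
    by rewrite -{1}e' lev_lev//; lia.
  lia.
have lu : lev o (dist o u) u' = u.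
  apply: lev_eq => //; have := dist_triangle o u u'; have := dist_adj uu'.
  by rewrite (dist_sym u u'); lia.
have : (minn k (dist o u) <= gp o u v)%N.
  apply/gp_geP; split; [lia|lia|].
  have m1 : (minn k (dist o u) <= k)%N by exact: geq_minl.
  have m2 : (minn k (dist o u) <= dist o u)%N by exact: geq_minr.
  move: (minn _ _) m1 m2 => m m1 m2.
  rewrite -(lev_lev m1 h2) -h3 lev_lev//.
  have le : (dist o u <= dist o u')%N by lia.
  by have := lev_lev m2 le; rewrite lu.
lia.
Qed.

End TreeDistance.

Local Open Scope ring_scope.

(** * The realization compared with its vertices *)

Section RealizationMetric.
Variables (R : realType) (T : tree).
Local Notation V := (vertex T).
Local Notation X := (realization R T).
Local Notation pt := (@vertex_point R T).

Lemma ev_bary (c : V -> R) u v t :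
  \sum_(w \in [set: V]) (bary u v t w * c w) = (1 - t) * c u + t * c v.
Proof.
have -> : \sum_(w \in [set: V]) (bary u v t w * c w) = \sum_(w \in [set u; v]) (bary u v t w * c w).
  rewrite -(fsbig_widen [set u; v])// => w [_ /= /not_orP[wu wv]].
  rewrite /bary; case: eqVneq => [//|_]; case: eqVneq => [//|_].
  by rewrite !mulr0n addr0 mul0r.
have [->|uv] := eqVneq u v.
  by rewrite setUid fsbig_set1 /bary eqxx !mulr1n -mulrDl.
rewrite fsbigU//=; last by move=> w [/= -> vw]; move: uv; rewrite vw eqxx.
rewrite !fsbig_set1 /bary !eqxx (negbTE uv) eq_sym (negbTE uv).
by rewrite !mulr1n !mulr0n addr0 add0r.
Qed.

(** The affine extension of the distance to [o] changes at unit rate along every edge, so chains are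
    at least as long as its variation. This bounds the path metric from below. *)
Lemma chain_dist o (x y : X) l : chain x y l ->
  `|\sum_(w \in [set: V]) (Defs.coord x w * (dist o w)%:R) -
    \sum_(w \in [set: V]) (Defs.coord y w * (dist o w)%:R)| <= l.
Proof.
elim=> [{}x|{}x {}y z u v s t {}l uv _ _ xs yt _ IH]; first by rewrite subrr normr0.
apply: (le_trans (ler_distD (\sum_(w \in [set: V]) (Defs.coord y w * (dist o w)%:R)) _ _)).
apply: lerD => //; rewrite xs yt !ev_bary.
have [->|->] := adj_dist o uv; rewrite -natr1 le_eqVlt; apply/orP; left; apply/eqP.
  by congr `|_|; ring.
by rewrite distrC; congr `|_|; ring.
Qed.

Lemma mdist_vertex u v : mdist (pt u) (pt v) = (dist u v)%:R.
Proof.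
apply/eqP; rewrite eq_le; apply/andP; split; last first.
  apply: le_tree_dist => l /(chain_dist u).
  rewrite /= !ev_bary subr0 !mul1r !mul0r !addr0 distxx sub0r normrN.
  by rewrite ger0_norm.
have [p [up <- <-]] := dist_path u v; apply: tree_dist_le.
elim: p u up => [u _|w p IH u /= /andP[uw wp]]; first exact: chain0.
rewrite -nat1r -[X in (X + _)%R](_ : `|0 - 1| = 1); last by rewrite sub0r normrN normr1.
apply: (chainS uw _ _ _ _ (IH w wp)); rewrite ?lexx ?ler01//=.
  by rewrite (bary_vertex0 R u w).
by rewrite bary_vertex1.
Qed.

Lemma near_vertex (x : X) : exists v, mdist x (pt v) <= 1.
Proof.
case E: x => [f [u [v [t [uv t1 fe]]]]]; rewrite -E.
have {E} xe : Defs.coord x = bary u v t by rewrite E.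
exists u; case/orP: uv => [/eqP vu|uv].
  suff -> : x = pt u by rewrite mdistxx ler01.
  by apply: coord_inj; rewrite xe -vu bary_diag.
apply: (@le_trans _ _ `|t - 0|); last by rewrite subr0 ger0_norm; case/andP: t1.
apply: tree_dist_le; apply: chain1 uv t1 _ xe _; rewrite ?lexx ?ler01//=.
by rewrite (bary_vertex0 R u v).
Qed.

Definition rnd (x : X) : V := projT1 (cid (near_vertex x)).

Lemma rndP x : mdist x (pt (rnd x)) <= 1.
Proof. by rewrite /rnd; case: cid. Qed.

Lemma mdist_rnd x y : `|mdist x y - (dist (rnd x) (rnd y))%:R| <= 2.
Proof.
rewrite -mdist_vertex.
have h1 := metric_triangle x (pt (rnd x)) y.
have h2 := metric_triangle (pt (rnd x)) (pt (rnd y)) y.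
have h3 := metric_triangle (pt (rnd x)) x (pt (rnd y)).
have h4 := metric_triangle x y (pt (rnd y)).
have h5 := rndP x; have h6 := rndP y.
rewrite (metric_sym (pt (rnd y)) y) (metric_sym (pt (rnd x)) x) in h1 h2 h3 h4.
rewrite ler_norml; apply/andP; split; lra.
Qed.

End RealizationMetric.

Lemma near_oo2 (P : nat -> nat -> Prop) : (\forall i \near \oo & j \near \oo, P i j) <->
  exists N, forall i j, (N <= i)%N -> (N <= j)%N -> P i j.
Proof.
split=> [[[A A'] [[N _ NA] [N' _ NA']] h]|[N h]].
  exists (maxn N N') => i j Ni Nj; apply: (h (i, j)); split.
    by apply: NA => /=; apply: leq_trans Ni; exact: leq_maxl.
  by apply: NA' => /=; apply: leq_trans Nj; exact: leq_maxr.
exists ([set i | (N <= i)%N], [set i | (N <= i)%N]); first by split; exists N.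
by move=> [i j] [/= Ni Nj]; exact: h.
Qed.

(** * Boundary points as geodesic rays from a base vertex *)

Section Boundary.
Variables (R : realType) (T : tree) (o : vertex T).
Local Notation V := (vertex T).
Local Notation X := (realization R T).
Local Notation pt := (@vertex_point R T).
Local Notation B := (boundary X).
Implicit Types (a b : B) (u v : nat -> V) (x y : nat -> X).

Lemma gromov_rnd (x y : X) :
  `|gromov_product (pt o) x y - (gp o (rnd x) (rnd y))%:R| <= 2.
Proof.
have E : (dist (rnd x) (rnd y))%:R + 2 * (gp o (rnd x) (rnd y))%:R =
    (dist (rnd x) o)%:R + (dist (rnd y) o)%:R :> R.
  by rewrite -natrM -!natrD (dist_sym _ o) (dist_sym _ o) dist_gp.
have h := @mdist_rnd R T x y; rewrite ler_norml in h; case/andP: h => h1 h2.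
have h3 := metric_triangle x (pt (rnd x)) (pt o).
have h4 := metric_triangle (pt (rnd x)) x (pt o).
have h5 := metric_triangle y (pt (rnd y)) (pt o).
have h6 := metric_triangle (pt (rnd y)) y (pt o).
have k1 := rndP x; have k2 := rndP y.
rewrite (metric_sym (pt (rnd x)) x) in h4; rewrite (metric_sym (pt (rnd y)) y) in h6.
rewrite !mdist_vertex in h3 h4 h5 h6.
rewrite /gromov_product ler_norml; apply/andP; split; lra.
Qed.

Lemma gromov_base (o' : X) (x y : X) :
  `|gromov_product o' x y - gromov_product (pt o) x y| <= mdist o' (pt o).
Proof.
have h1 := metric_triangle x o' (pt o); have h2 := metric_triangle x (pt o) o'.
have h3 := metric_triangle y o' (pt o); have h4 := metric_triangle y (pt o) o'.
rewrite (metric_sym (pt o) o') in h2 h4.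
rewrite /gromov_product ler_norml; apply/andP; split; lra.
Qed.

Lemma gromov_ge (o' : X) (M : R) : exists n, forall x y : X,
  (n <= gp o (rnd x) (rnd y))%N -> M <= gromov_product o' x y.
Proof.
exists (Num.bound (`|M| + mdist o' (pt o) + 2)) => x y le.
have : `|M| + mdist o' (pt o) + 2 < (gp o (rnd x) (rnd y))%:R.
  apply: (@lt_le_trans _ _ (Num.bound (`|M| + mdist o' (pt o) + 2))%:R).
    by apply: archi_boundP; rewrite !addr_ge0// ?mdist_ge0.
  by rewrite ler_nat.
have := gromov_rnd x y; have := gromov_base o' x y.
rewrite !ler_norml => /andP[h1 h2] /andP[h3 h4] h5; have := ler_norm M; lra.
Qed.

Lemma ge_gromov n (o' x y : X) : n%:R + 2 + mdist o' (pt o) <= gromov_product o' x y ->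
  (n <= gp o (rnd x) (rnd y))%N.
Proof.
have := gromov_rnd x y; have := gromov_base o' x y.
rewrite !ler_norml => /andP[h1 h2] /andP[h3 h4] h5.
rewrite -(ler_nat R); lra.
Qed.

Lemma asymptoticP x y : asymptotic x y <-> forall n, exists N, forall i j,
  (N <= i)%N -> (N <= j)%N -> (n <= gp o (rnd (x i)) (rnd (y j)))%N.
Proof.
split=> [h n|h o' M].
  have /near_oo2[N hN] := h (pt o) (n%:R + 2 + mdist (pt o) (pt o)).
  by exists N => i j Ni Nj; apply: (ge_gromov (hN i j Ni Nj)).
have [n hn] := gromov_ge o' M; have [N hN] := h n.
by apply/near_oo2; exists N => i j Ni Nj; apply: hn; exact: hN.
Qed.

Definition is_ray (r : nat -> V) := forall n, dist o (r n) = n /\ lev o n (r n.+1) = r n.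
Definition ray_conv u (r : nat -> V) := forall n, exists N, forall i, (N <= i)%N ->
  (n <= dist o (u i))%N /\ lev o n (u i) = r n.

Lemma is_ray_lev r m n : is_ray r -> (m <= n)%N -> lev o m (r n) = r m.
Proof.
move=> hr; elim: n => [|n IH]; first by rewrite leqn0 => /eqP ->; rewrite -{1}(hr 0%N).1 (hr 0%N).1 lev0 -(lev_id o (r 0%N)) (hr 0%N).1 lev0.
rewrite leq_eqVlt => /orP[/eqP ->|]; first by rewrite -{1}(hr n.+1).1 lev_id.
rewrite ltnS => mn; rewrite -(IH mn) -(hr n).2 lev_lev// (hr n.+1).1.
exact: leqnSn.
Qed.

Lemma conv_close C u v r : is_ray r -> (forall i, dist (u i) (v i) <= C)%N -> ray_conv u r -> ray_conv v r.
Proof.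
move=> hr uv ur n; have [N hN] := ur (n + C)%N; exists N => i Ni.
have [h1 h2] := hN i Ni.
have /gp_geP[g1 g2 g3] : (n <= gp o (u i) (v i))%N.
  have := dist_gp o (u i) (v i); have := dist_triangle o (v i) (u i).
  by have := uv i; rewrite (dist_sym (v i)); lia.
split=> //; rewrite -g3 -(is_ray_lev hr (leq_addr C n)) -h2 lev_lev//.
exact: leq_addr.
Qed.

Lemma conv_uniq u r r' : ray_conv u r -> ray_conv u r' -> r =1 r'.
Proof.
move=> h h' n; have [N hN] := h n; have [N' hN'] := h' n.
have [_ <-] := hN (maxn N N') (leq_maxl _ _).
by have [_ <-] := hN' (maxn N N') (leq_maxr _ _).
Qed.

Lemma conv_gp u v r : ray_conv u r -> ray_conv v r -> forall n, exists N, forall i j,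
  (N <= i)%N -> (N <= j)%N -> (n <= gp o (u i) (v j))%N.
Proof.
move=> h h' n; have [N hN] := h n; have [N' hN'] := h' n; exists (maxn N N') => i j Ni Nj.
have [|h1 h2] := hN i; first by apply: leq_trans Ni; exact: leq_maxl.
have [|h3 h4] := hN' j; first by apply: leq_trans Nj; exact: leq_maxr.
by apply/gp_geP; split=> //; rewrite h2.
Qed.

Lemma gp_conv u v r : ray_conv u r -> (forall n, exists N, forall i j,
  (N <= i)%N -> (N <= j)%N -> (n <= gp o (u i) (v j))%N) -> ray_conv v r.
Proof.
move=> h h' n; have [N hN] := h n; have [N' hN'] := h' n; exists N' => j Nj.
have [_ <-] := hN (maxn N N') (leq_maxl _ _).
by have /gp_geP[? ? ->] := hN' (maxn N N') j (leq_maxr _ _) Nj.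
Qed.

Lemma gp_conv_ex u : (forall n, exists N, forall i j,
  (N <= i)%N -> (N <= j)%N -> (n <= gp o (u i) (u j))%N) -> exists r, is_ray r /\ ray_conv u r.
Proof.
move=> h; have [N hN] := choice h.
have lv n i : (N n <= i)%N -> lev o n (u i) = lev o n (u (N n)) /\ (n <= dist o (u i))%N.
  by move=> Ni; have /gp_geP[? ? ?] := hN n i (N n) Ni (leqnn _).
exists (fun n => lev o n (u (N n))); split=> n; last first.
  by exists (N n) => i /lv[].
split; first by have [_ /levP[]] := lv n (N n) (leqnn _).
have [e1 _] := lv n _ (leq_maxl (N n) (N n.+1)).
have [e2 d2] := lv n.+1 _ (leq_maxr (N n) (N n.+1)).
by rewrite -e1 -e2 lev_lev.
Qed.

Lemma boundary_eq a b : seqs_to a = seqs_to b -> a = b.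
Proof. by case: a b => S hS [S' hS'] /= e; subst S'; congr Boundary; exact: Prop_irrelevance. Qed.

(** At each level the projections of a sequence converging at infinity are eventually constant;
    their limits form the ray. *)
Lemma ray_ex a : exists r, is_ray r /\ forall x, tends_to x a <-> ray_conv (fun i => rnd (x i)) r.
Proof.
case: a => S hS; have [x ax SE] := hS.
have [r [hr cr]] := gp_conv_ex ((asymptoticP x x).1 ax).
exists r; split=> // y; rewrite /tends_to /= SE /=; split=> [[_ /asymptoticP xy]|cy].
  exact: (gp_conv cr xy).
by split; apply/asymptoticP; [exact: (conv_gp cy cy)|exact: (conv_gp cr cy)].
Qed.

Definition ray a : nat -> V := projT1 (cid (ray_ex a)).

Lemma ray_is_ray a : is_ray (ray a).
Proof. by rewrite /ray; case: cid => r []. Qed.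

Lemma tends_toP x a : tends_to x a <-> ray_conv (fun i => rnd (x i)) (ray a).
Proof. by rewrite /ray; case: cid => r []. Qed.

Lemma dist_ray a n : dist o (ray a n) = n.
Proof. by have [] := ray_is_ray a n. Qed.

Lemma lev_ray a m n : (m <= n)%N -> lev o m (ray a n) = ray a m.
Proof. by move=> mn; apply: is_ray_lev mn; exact: ray_is_ray. Qed.

Lemma ray0 a : ray a 0 = o.
Proof. by apply/esym/dist_eq0; rewrite dist_ray. Qed.

Lemma ray_inj a b : ray a =1 ray b -> a = b.
Proof.
move=> /funext e; apply: boundary_eq; apply/funext => x; apply/propext.
by rewrite -/(tends_to x a) -/(tends_to x b) !tends_toP e.
Qed.

Lemma dist_rnd_vertex (w : V) : (dist (rnd (pt w)) w <= 1)%N.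
Proof. by have := @rndP R T (pt w); rewrite mdist_vertex dist_sym -[1]/(1%:R) ler_nat. Qed.

Lemma tends_to_vertexP u a : tends_to (fun i => pt (u i)) a <-> ray_conv u (ray a).
Proof.
rewrite tends_toP; split; apply: conv_close (ray_is_ray a) _ => i; last rewrite dist_sym.
  exact: dist_rnd_vertex.
exact: dist_rnd_vertex.
Qed.

Lemma conv_ray r : is_ray r -> ray_conv r r.
Proof.
move=> hr n; exists n => i ni; rewrite (hr i).1; split=> //; exact: is_ray_lev.
Qed.

Lemma tends_ray a : tends_to (fun i => pt (ray a i)) a.
Proof. by apply/tends_to_vertexP/conv_ray/ray_is_ray. Qed.

Lemma conv_boundary u r : is_ray r -> ray_conv u r -> exists a, ray a =1 r.
Proof.
move=> hr cr.
have rr : ray_conv (fun i => rnd (pt (r i))) r.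
  apply: conv_close (hr) _ (conv_ray hr) => i; rewrite dist_sym; exact: dist_rnd_vertex.
have as_r : asymptotic (fun i => pt (r i)) (fun i => pt (r i)).
  by apply/asymptoticP; exact: (conv_gp rr rr).
have ex : exists2 x, asymptotic x x &
    [set y | asymptotic y y /\ asymptotic (fun i => pt (r i)) y] =
    [set y | asymptotic y y /\ asymptotic x y] by exists (fun i => pt (r i)).
exists (Boundary ex).
have /tends_toP h : tends_to (fun i => pt (r i)) (Boundary ex) by split.
exact: (conv_uniq h rr).
Qed.

Lemma tends_to_uniq x a b : tends_to x a -> tends_to x b -> a = b.
Proof. by move=> /tends_toP ha /tends_toP hb; apply: ray_inj; exact: conv_uniq ha hb. Qed.

Lemma ray_boundary r : is_ray r -> exists a, ray a =1 r.
Proof. by move=> hr; exact: conv_boundary hr (conv_ray hr). Qed.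

Lemma bp_subproof a b : exists n, `[< a <> b -> ray a n <> ray b n >].
Proof.
have [->|ab] := pselect (a = b); first by exists 0%N; apply/asboolP.
apply: contrapT => h; apply: ab; apply: ray_inj => n; apply: contrapT => ne.
by apply: h; exists n; apply/asboolP.
Qed.

(* The last level at which the rays towards [a] and [b] agree, and [0] if [a = b]. *)
Definition bp a b : nat := (ex_minn (bp_subproof a b)).-1.

Lemma ray_le a b m n : (m <= n)%N -> ray a n = ray b n -> ray a m = ray b m.
Proof. by move=> mn e; rewrite -(lev_ray a mn) e lev_ray. Qed.

Lemma bp_sim n a b : sim bp n a b <-> ray a n = ray b n.
Proof.
split=> [[->//|]|e].
  rewrite /bp; case: ex_minnP => -[|m] _ hm /=; first by rewrite leqn0 => /eqP ->; rewrite !ray0.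
  move=> nm; apply: contrapT => ne; have := hm n; rewrite asboolT// => /(_ isT).
  by rewrite ltnNge nm.
have [->|ab] := pselect (a = b); first by left.
right; rewrite /bp; case: ex_minnP => m /asboolP/(_ ab) hm _.
have mn : (n < m)%N by rewrite ltnNge; apply/negP => mn; apply: hm; exact: ray_le e.
lia.
Qed.

Lemma bp_diag a : bp a a = 0%N.
Proof. by rewrite /bp; case: ex_minnP => m _ /(_ 0%N); rewrite asboolT// => /(_ isT); lia. Qed.

Lemma bp_sym a b : bp a b = bp b a.
Proof.
have [->//|ab] := pselect (a = b).
have le c d : c <> d -> (bp c d <= bp d c)%N.
  move=> cd; have /bp_sim/esym/bp_sim[dc|//] : sim bp (bp c d) c d by right.
  by exfalso; apply: cd.
by apply/eqP; rewrite eqn_leq !le//; exact: nesym.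
Qed.

Lemma bp_min a b c : a <> c -> (minn (bp a b) (bp b c) <= bp a c)%N.
Proof.
move=> ac; set m := minn _ _.
have /bp_sim h1 : sim bp m a b by right; exact: geq_minl.
have /bp_sim h2 : sim bp m b c by right; exact: geq_minr.
by have /bp_sim[|//] : ray a m = ray c m by rewrite h1.
Qed.

Lemma bp_lt a b : a <> b -> ray a (bp a b).+1 <> ray b (bp a b).+1.
Proof. by move=> ab /bp_sim[//|]; rewrite ltnn. Qed.

Lemma conv_bp u v a b : ray_conv u (ray a) -> ray_conv v (ray b) -> a <> b ->
  exists N, forall i j, (N <= i)%N -> (N <= j)%N -> gp o (u i) (v j) = bp a b.
Proof.
move=> ua vb ab; have [N hN] := ua (bp a b).+1; have [N' hN'] := vb (bp a b).+1.
exists (maxn N N') => i j Ni Nj.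
have [|h1 h2] := hN i; first by apply: leq_trans Ni; exact: leq_maxl.
have [|h3 h4] := hN' j; first by apply: leq_trans Nj; exact: leq_maxr.
apply/eqP; rewrite eqn_leq; apply/andP; split.
  rewrite leqNgt; apply/negP => /gp_geP[_ _]; rewrite h2 h4; exact: bp_lt.
apply/gp_geP; split; [exact: ltnW|exact: ltnW|].
rewrite -(lev_lev (leqnSn _) h1) -(lev_lev (leqnSn _) h3) h2 h4 !lev_ray//.
by apply/bp_sim; right.
Qed.

(** Changing the base point and rounding to vertices alter Gromov products by bounded amounts, so
    the Gromov topology is that of the ultrametric [bp]. *)
Lemma boundary_openP (A : set B) : open A <->
  forall a, A a -> exists n, level_ball bp n a `<=` A.
Proof.
have E : open A = boundary_open A by [].
rewrite E; split=> h a Aa; last first.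
  move=> o'; have [n hn] := h a Aa; exists (n%:R + 2 + mdist o' (pt o)).
  move=> b [x [y [/tends_toP xa /tends_toP yb /near_oo2[N hN]]]]; apply: hn; apply/bp_sim.
  have [N1 h1] := xa n; have [N2 h2] := yb n.
  pose k := maxn N (maxn N1 N2).
  have kN1 : (N1 <= k)%N by rewrite /k; lia.
  have kN2 : (N2 <= k)%N by rewrite /k; lia.
  have kN : (N <= k)%N by rewrite /k; lia.
  have [_ <-] := h1 k kN1; have [_ <-] := h2 k kN2.
  by have /ge_gromov/gp_geP[_ _ ->] := hN k k kN kN.
have [r hr] := h a Aa (pt o); have [n hn] := gromov_ge (pt o) r.
exists n.+1 => b /bp_sim ab; apply: hr.
exists (fun i => pt (ray a i)), (fun i => pt (ray b i)).
split; [exact: tends_ray|exact: tends_ray|apply/near_oo2].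
have ca : ray_conv (fun i => rnd (pt (ray a i))) (ray a) by apply/tends_toP; exact: tends_ray.
have cb : ray_conv (fun i => rnd (pt (ray b i))) (ray b) by apply/tends_toP; exact: tends_ray.
have [N1 h1] := ca n.+1; have [N2 h2] := cb n.+1.
exists (maxn N1 N2) => i j Ni Nj; apply: hn.
have [|? e1] := h1 i; first by apply: leq_trans Ni; exact: leq_maxl.
have [|? e2] := h2 j; first by apply: leq_trans Nj; exact: leq_maxr.
by apply: ltnW; apply/gp_geP; split=> //; rewrite e1 e2.
Qed.

Lemma nbhs_boundaryP a (A : set B) : nbhs a A <-> exists n, level_ball bp n a `<=` A.
Proof.
have sb n b : level_ball bp n a b -> level_ball bp n b `<=` level_ball bp n a.
  by move=> /bp_sim e c /bp_sim e'; apply/bp_sim; rewrite e' e.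
split=> [|[n hn]].
  rewrite nbhsE => -[U [/boundary_openP oU Ua] UA]; have [n hn] := oU a Ua.
  by exists n => b /hn /UA.
rewrite nbhsE; exists (level_ball bp n a) => //; split; last by left.
by apply/boundary_openP => b /sb h; exists n.
Qed.

End Boundary.

(** * Compactness of the boundary of a locally finite tree *)

Section LocallyFinite.
Variables (R : realType) (T : tree) (o : vertex T).
Local Notation V := (vertex T).
Local Notation X := (realization R T).
Local Notation B := (boundary X).
Local Notation ray := (@ray R T o).
Local Notation bp := (@bp R T o).
Hypothesis lf : forall v : V, finite_set [set u | adj v u].

Lemma dist1_adj (u v : V) : dist u v = 1%N -> adj u v.
Proof.
move=> d; have [p [up pv sp]] := dist_path u v; rewrite d in sp.
by case: p up pv sp => [|w [|? ?]] //= /andP[uw _] <-.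
Qed.

Lemma ray_adj (a : B) n : adj (ray a n) (ray a n.+1).
Proof.
apply: dist1_adj; have [h1 h2] := ray_is_ray o a n.
have /levP[_] : (n <= dist o (ray a n.+1))%N by rewrite dist_ray.
by rewrite h2 dist_ray subSnn.
Qed.

Lemma konig (P : V -> Prop) : P o ->
  (forall w, P w -> exists w', [/\ adj w w', dist o w' = (dist o w).+1 & P w']) ->
  exists a : B, forall n, P (ray a n).
Proof.
move=> Po step.
have /choice[f hf] : forall w, exists w', P w ->
    [/\ adj w w', dist o w' = (dist o w).+1 & P w'].
  move=> w; have [/step[w' h]|h] := pselect (P w); first by exists w'.
  by exists w.
pose r n := iter n f o.
have Pr n : P (r n) /\ dist o (r n) = n.
  elim: n => [|n [Pn dn]]; first by rewrite distxx.
  by have [_ d Pn'] := hf _ Pn; split=> //; rewrite /r iterS d dn.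
have [n|a ra] := @ray_boundary R T o r; last by exists a => n; rewrite ra; case: (Pr n).
have [Pn dn] := Pr n; have [ad d _] := hf _ Pn.
split=> //; apply: lev_eq => //; rewrite dn [r n.+1]iterS d dn.
have := dist_adj ad; have := dist_triangle o (r n) (f (r n)); rewrite d dn /r; lia.
Qed.

(** [P w] says that every member of the filter contains a point whose ray passes through [w]. If
    every child of [w] failed, the intersection of finitely many bad members would contradict [P w];
    so [konig] yields a cluster point. *)
Lemma boundary_compact : compact [set: B].
Proof.
move=> F PF _.
pose P w := forall A : set B, F A -> exists a, A a /\ ray a (dist o w) = w.
have [||a Pa] := konig (P := P).
- by move=> A /filter_ex[a Aa]; exists a; rewrite distxx ray0.
- move=> w Pw; apply: contrapT => no.
  have /choice[A hA] : forall w', exists A : set B, F A /\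
      (adj w w' -> dist o w' = (dist o w).+1 -> forall a, A a -> ray a (dist o w') <> w').
    move=> w'; apply: contrapT => h; apply: no; exists w'.
    have h1 : adj w w' /\ dist o w' = (dist o w).+1.
      apply: contrapT => h1; apply: h; exists setT; split; first exact: filterT.
      by move=> h2 h3; exfalso; apply: h1.
    split=> [||A FA]; [by case: h1|by case: h1|].
    apply: contrapT => h2; apply: h; exists A; split=> // _ _ a Aa e.
    by apply: h2; exists a.
  have FI : F (\bigcap_(i in [set` fset_set [set u | adj w u]]) A i).
    by apply: filter_bigI => i _; case: (hA i).
  have [a [Aa e]] := Pw _ FI.
  have ad : adj w (ray a (dist o w).+1) by rewrite -{1}e; exact: ray_adj.
  apply: (hA (ray a (dist o w).+1)).2 => //; first by rewrite dist_ray.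
    by apply: Aa => /=; rewrite in_fset_set// inE.
  by rewrite dist_ray.
exists a; split=> // A U FA /(nbhs_boundaryP o)[n hn].
have [b [Ab e]] := Pa n A FA; exists b; split=> //; apply: hn; apply/bp_sim.
by rewrite dist_ray in e.
Qed.

Lemma boundary_cluster (u : nat -> B) : exists a (s : nat -> nat),
  (forall n, n <= s n)%N /\ forall n, sim bp n (u (s n)) a.
Proof.
have [a [_ ca]] := boundary_compact (fmap_proper_filter u eventually_filter) (filterT : (u @ \oo) setT).
have /choice[s hs] : forall n, exists m, (n <= m)%N /\ sim bp n (u m) a.
  move=> n; have [||b [[m nm <-] h]] := ca (u @` [set m | (n <= m)%N]) (level_ball bp n a).
  - by exists n => // m nm; exists m.
  - by apply/(nbhs_boundaryP o); exists n.
  by exists m.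
by exists a, s; split=> n; have [] := hs n.
Qed.

Lemma finite_sphere n : finite_set [set v | dist o v = n].
Proof.
elim: n => [|n IH].
  by apply: sub_finite_set (finite_set1 o) => v /dist_eq0 ->.
apply: sub_finite_set (bigcup_finite IH (fun w _ => lf w)) => v ov.
have ne : o <> v by move=> e; rewrite -e /= distxx in ov.
have [w [wv d]] := dist_pred ne; exists w => //=.
by move: ov; rewrite /= d => -[].
Qed.

Lemma boundary_classes n : exists N (f : B -> 'I_N), forall a b, f a = f b -> sim bp n a b.
Proof.
pose s : seq V := fset_set [set v | dist o v = n].
have sP (a : B) : ray a n \in s.
  by rewrite /s in_fset_set ?inE//= ?dist_ray//; exact: finite_sphere.
have lt (a : B) : (index (ray a n) s < size s)%N by rewrite index_mem.
exists (size s), (fun a => Ordinal (lt a)) => a b [e].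
by apply/bp_sim; rewrite -(nth_index o (sP a)) e nth_index.
Qed.

Lemma boundary_ultrametric D :
  (forall (a : B) n, exists b, b <> a /\ (n <= bp a b <= n + D)%N) ->
  branching_ultrametric bp D.
Proof.
move=> br; split => //.
- exact: bp_diag.
- exact: bp_sym.
- exact: bp_min.
- exact: boundary_classes.
- exact: boundary_cluster.
Qed.

End LocallyFinite.

(** * Edges, components of the complement of a vertex, and bushiness *)

Section Segments.
Variables (R : realType) (T : tree).
Local Notation V := (vertex T).
Local Notation X := (realization R T).
Local Notation pt := (@vertex_point R T).

(** Truncation lets an edge be parametrized by the whole real line, where continuity is stated
    without subspaces. *)
Definition clip (r : R) : R := Num.min 1 (Num.max 0 r).

Lemma clip_itv r : 0 <= clip r <= 1.
Proof. by rewrite /clip le_min ler01 le_max lexx /= ge_min lexx. Qed.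

Lemma clip_id r : 0 <= r <= 1 -> clip r = r.
Proof. by move=> /andP[h0 h1]; rewrite /clip max_r// min_r. Qed.

Lemma clip_lip r s : `|clip r - clip s| <= `|r - s|.
Proof.
have cases t : [\/ t <= 0 /\ clip t = 0, 0 <= t <= 1 /\ clip t = t | 1 <= t /\ clip t = 1].
  rewrite /clip; have [t0|/ltW t0] := lerP 0 t; last by constructor 1; rewrite min_r.
  by have [t1|t1] := lerP 1 t; [constructor 3|constructor 2; split=> //; exact: ltW].
have h1 := ler_norm (r - s); have h2 := ler_norm (s - r); rewrite (distrC s r) in h2.
rewrite ler_norml; apply/andP; split;
  case: (cases r) => -[? ->]; case: (cases s) => -[? ->]; lra.
Qed.

Lemma segment_subproof (u v : V) (r : R) : adj u v ->
  exists u' v' t, [/\ (u' == v') || adj u' v', 0 <= t <= 1 & bary u v (clip r) = bary u' v' t].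
Proof. by move=> uv; exists u, v, (clip r); rewrite uv orbT clip_itv. Qed.

Definition segment u v (uv : adj u v) (r : R) : X := Point (segment_subproof r uv).

Lemma segment_lip u v (uv : adj u v) r s :
  mdist (segment uv r) (segment uv s) <= `|r - s|.
Proof.
apply: le_trans (clip_lip r s); apply: tree_dist_le.
by apply: (chain1 uv (clip_itv r) (clip_itv s)).
Qed.

Lemma segment_continuous u v (uv : adj u v) : continuous (segment uv : R -> X).
Proof.
move=> r; apply/metricType_numDomainType.cvgrPdist_lt => e e0; near=> s.
apply: le_lt_trans (segment_lip uv r s) _.
by near: s; apply: cvgr_dist_lt.
Unshelve. all: by end_near. Qed.

End Segments.

Section Branches.
Variables (R : realType) (T : tree).
Local Notation V := (vertex T).
Local Notation X := (realization R T).
Local Notation pt := (@vertex_point R T).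
Implicit Types (u v w : V) (x y : X).

(** A combinatorial form of the component of the complement of [v] on the side of [u], read off from
    the support of the coordinates. *)
Definition branch v u : set X :=
  [set x | exists w, [/\ w <> v, Defs.coord x w <> 0 & lev v 1 w = u]].

Lemma realizationP x : exists u v t, [/\ (u == v) || adj u v, 0 <= t <= 1 & Defs.coord x = bary u v t].
Proof. by case: x. Qed.

Lemma coord_lip x y w : `|Defs.coord x w - Defs.coord y w| <= mdist x y.
Proof. by apply: le_tree_dist => l /chain_lip; exact. Qed.

Lemma bary_sym u v (t : R) : bary u v t = bary v u (1 - t).
Proof. by apply/funext => w; rewrite /bary subKr addrC. Qed.

Lemma baryE u v (t : R) w : bary u v t w <> 0 -> w = u \/ w = v.
Proof.
rewrite /bary; case: eqVneq => [->|_]; first by left.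
by case: eqVneq => [->|_]; [right|rewrite !mulr0n addr0].
Qed.

Lemma bary_l u v (t : R) : u != v -> bary u v t u = 1 - t.
Proof. by move=> uv; rewrite /bary eqxx (negbTE uv) mulr1n mulr0n addr0. Qed.

Lemma adj_neq u v : adj u v -> u != v.
Proof. by move=> uv; apply/eqP => e; move: uv; rewrite e adj_irr. Qed.

Lemma coord_vertex v w : Defs.coord (pt v) w <> 0 -> w = v.
Proof. by move=> /baryE[]. Qed.

Lemma support_edge x w : Defs.coord x w <> 0 ->
  x = pt w \/ exists w' t, [/\ adj w w', 0 <= t < 1 & Defs.coord x = bary w w' t].
Proof.
have [u [v [t [uv /andP[t0 t1] e]]]] := realizationP x.
have edge a b s : adj a b -> 0 <= s -> s <= 1 -> Defs.coord x = bary a b s -> Defs.coord x a <> 0 ->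
    exists w' t, [/\ adj a w', 0 <= t < 1 & Defs.coord x = bary a w' t].
  move=> ab s0 s1 xe; rewrite xe bary_l ?adj_neq// => h; exists b, s; split=> //.
  by rewrite s0 lt_neqAle s1 andbT; apply/eqP => s1'; apply: h; rewrite s1' subrr.
case/orP: uv => [/eqP uv|uv] xw.
  left; apply: coord_inj; rewrite e -uv bary_diag /=.
  by have [->|->] : w = u \/ w = v by [apply: (@baryE u v t); rewrite -e]; rewrite -?uv.
right; have [wu|wv] : w = u \/ w = v by apply: (@baryE u v t); rewrite -e.
  by subst w; exact: (edge u v t).
subst w; apply: (edge v u (1 - t)) => //; rewrite ?subr_ge0 ?gerBl//; first by rewrite adj_sym.
by rewrite e bary_sym.
Qed.

Lemma support_near x w : Defs.coord x w <> 0 -> mdist x (pt w) <= 1.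
Proof.
move=> /support_edge[->|[w' [t [ww' /andP[t0 t1] e]]]]; first by rewrite mdistxx.
apply: (@le_trans _ _ `|t - 0|); last by rewrite subr0 ger0_norm// ltW.
apply: tree_dist_le; apply: (chain1 ww') => //=; rewrite ?lexx ?ler01 ?t0 ?ltW//.
by rewrite (bary_vertex0 R w w').
Qed.

Lemma support_ex x v : x <> pt v -> exists2 w, w <> v & Defs.coord x w <> 0.
Proof.
move=> xv; apply: contrapT => h; apply: xv.
have h' w : Defs.coord x w <> 0 -> w = v.
  by move=> xw; apply: contrapT => wv; apply: h; exists w.
have [u [u' [t [uu' /andP[t0 t1] e]]]] := realizationP x.
have [w xw] : exists w, Defs.coord x w <> 0.
  apply: contrapT => no; have z w : bary u u' t w = 0.
    by rewrite -e; apply: contrapT => xw; apply: no; exists w.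
  case/orP: uu' => [/eqP uu'|uu'].
    by have := z u; rewrite -uu' bary_diag /bary eqxx subr0 mulr1n mul0rn addr0 => /eqP; rewrite oner_eq0.
  have := z u; rewrite bary_l ?adj_neq// => h1.
  have := z u'; rewrite bary_sym bary_l ?(eq_sym u')// ?adj_neq// subKr => h2.
  by move: h1; rewrite h2 subr0 => /eqP; rewrite oner_eq0.
have := h' w xw => wv; subst w; have [//|[w' [s [vw' /andP[s0 s1] e']]]] := support_edge xw.
have [s0'|s0'] := eqVneq s 0.
  by apply: coord_inj; rewrite e' s0' (bary_vertex0 R v w').
exfalso; have : w' = v.
  apply: h'; rewrite e' bary_sym bary_l; first by rewrite subKr; exact/eqP.
  by rewrite eq_sym adj_neq.
by move=> e2; move: vw'; rewrite e2 adj_irr.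
Qed.

Lemma lev1_adj v w w' : adj w w' -> w <> v -> w' <> v -> lev v 1 w = lev v 1 w'.
Proof.
have half a b : adj a b -> a <> v -> dist v b = (dist v a).+1 -> lev v 1 a = lev v 1 b.
  move=> ab av d; have e : lev v (dist v a) b = a.
    by apply: lev_eq => //; have := dist_triangle v a b; have := dist_adj ab; lia.
  have a1 : (1 <= dist v a)%N.
    by case E : (dist v a) => //; case: av; rewrite (dist_eq0 E).
  by rewrite -{1}e lev_lev//; lia.
move=> ww' wv wv'; case: (adj_dist v ww') => d; first exact: half d.
by apply/esym; apply: half d => //; rewrite adj_sym.
Qed.

Lemma support_lev x v w w' : Defs.coord x w <> 0 -> Defs.coord x w' <> 0 ->
  w <> v -> w' <> v -> lev v 1 w = lev v 1 w'.
Proof.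
move=> /support_edge[->|[w1 [t [ww1 _ ->]]]].
  by move=> /coord_vertex ->.
move=> /baryE[->//|->]; exact: lev1_adj.
Qed.

Lemma branch_uniq v u u' x : branch v u x -> branch v u' x -> u = u'.
Proof. by move=> [w [wv xw <-]] [w' [wv' xw' <-]]; exact: support_lev xw xw' wv wv'. Qed.

Lemma branch_open v u : open (branch v u).
Proof.
rewrite openE => x [w [wv xw wu]]; rewrite /interior -metricType_numDomainType.filter_from_mdist_nbhs.
exists `|Defs.coord x w| => /=; first by rewrite normr_gt0; exact/eqP.
move=> y /= xy; exists w; split=> // yw.
by have := coord_lip x y w; rewrite yw subr0 leNgt xy.
Qed.

(** The branches at [v] are open, disjoint, and cover the complement of [v], so each is also closed
    there. *)
Lemma connected_branch v u (C : set X) x : connected C -> C `<=` ~` [set pt v] ->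
  C x -> branch v u x -> C `<=` branch v u.
Proof.
move=> cC Cv Cx bx y Cy.
suff : C `&` branch v u = C by move=> E; rewrite -E in Cy; case: Cy.
apply: cC; first by exists x.
  by exists (branch v u) => //; exact: branch_open.
pose O := \bigcup_(u' in [set u' | u' <> u]) branch v u'.
exists (~` O); first by apply: open_closedC; apply: bigcup_open => u' _; exact: branch_open.
apply/seteqP; split=> z [Cz bz]; split=> //.
  by move=> [u' /= uu' bz']; apply: uu'; exact: branch_uniq bz' bz.
have [w wv zw] := support_ex (Cv z Cz).
apply: contrapT => nb; apply: bz; exists (lev v 1 w); last by exists w.
by move=> e; apply: nb; exists w.
Qed.

Lemma component_support v x w : w <> v -> Defs.coord x w <> 0 ->
  connected_component (~` [set pt v]) (pt w) x.
Proof.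
move=> wv xw; have xv : x <> pt v by move=> xv; apply: wv; apply: coord_vertex; rewrite -xv.
have [->|[w' [t [ww' /andP[t0 t1] e]]]] := support_edge xw.
  by apply: connected_component_refl => /(congr1 (fun z => Defs.coord z w))/= h; apply: wv;
    apply: coord_vertex; rewrite /= -h /bary eqxx subr0 mulr1n mul0rn addr0; apply/eqP/oner_neq0.
have t01 : 0 <= t <= 1 by rewrite t0 ltW.
have c : connected (segment ww' @` `[0, t]).
  apply: connected_continuous_connected; first exact: segment_connected.
  by apply: continuous_subspaceT; exact: segment_continuous.
apply: (connected_component_max _ _ c).
- exists 0; first by rewrite /= in_itv /= lexx t0.
  by apply: coord_inj; rewrite /= clip_id ?lexx ?ler01//= (bary_vertex0 R w w').
- move=> _ [s /= + <-]; rewrite in_itv /= => /andP[s0 st] /(congr1 (fun z => Defs.coord z w)) /= h.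
  have s01 : 0 <= s <= 1 by rewrite s0 (le_trans st)// ltW.
  apply: wv; apply: coord_vertex; rewrite /= -h clip_id// bary_l ?adj_neq//.
  by apply/eqP; rewrite gt_eqF// subr_gt0 (le_lt_trans st).
- exists t; first by rewrite /= in_itv /= lexx t0.
  by apply: coord_inj; rewrite /= clip_id// e.
Qed.

Lemma component_adj v w w' : adj w w' -> w <> v -> w' <> v ->
  connected_component (~` [set pt v]) (pt w) = connected_component (~` [set pt v]) (pt w').
Proof.
move=> ww' wv wv'; pose x : X := segment ww' (1 / 2).
have h : Defs.coord x = bary w w' (1 / 2) by rewrite /= clip_id//; lra.
have /same_connected_component -> : connected_component (~` [set pt v]) (pt w) x.
  by apply: component_support => //; rewrite h bary_l ?adj_neq//; apply/eqP; rewrite gt_eqF//; lra.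
have /same_connected_component -> // : connected_component (~` [set pt v]) (pt w') x.
apply: component_support => //; rewrite h bary_sym bary_l ?(eq_sym w')// ?adj_neq//.
by apply/eqP; rewrite gt_eqF//; lra.
Qed.

Lemma component_lev1 v w : w <> v ->
  connected_component (~` [set pt v]) (pt w) = connected_component (~` [set pt v]) (pt (lev v 1 w)).
Proof.
move e : (dist v w) => n; elim: n w e => [|n IH] w e wv; first by case: wv; rewrite (dist_eq0 e).
case: n IH e => [|n] IH e; first by rewrite -e lev_id.
have vw : v <> w by move=> h; exact: wv.
have [w' [w'w d]] := dist_pred vw; rewrite e in d; case: d => d.
have wv' : w' <> v by move=> h; rewrite h distxx in d.
rewrite -(component_adj w'w wv' wv) (IH w' (esym d) wv').
by rewrite (lev1_adj w'w).
Qed.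

Lemma branch_component v u x : branch v u x ->
  connected_component (~` [set pt v]) x = connected_component (~` [set pt v]) (pt u).
Proof.
move=> [w [wv xw <-]]; rewrite -component_lev1//.
by apply/esym/same_connected_component; exact: component_support.
Qed.

Definition unbounded_direction v u := forall N, exists w, lev v 1 w = u /\ (N <= dist v w)%N.

Lemma unbounded_branch v u : ~ bounded_subset (branch v u) -> unbounded_direction v u.
Proof.
move=> ub N; apply: contrapT => h; apply: ub; exists ((N.+1)%:R + (N.+1)%:R) => x y bx by_.
have near z : branch v u z -> mdist (pt v) z <= N.+1%:R.
  move=> [w [wv zw wu]]; have := support_near zw; have := metric_triangle (pt v) (pt w) z.
  rewrite (metric_sym (pt w)) mdist_vertex -natr1.
  have : (dist v w <= N)%N.
    by rewrite leqNgt; apply/negP => lt; apply: h; exists w; split=> //; exact: ltnW.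
  rewrite -(ler_nat R); lra.
have := near x bx; have := near y by_; have := metric_triangle x (pt v) y.
rewrite (metric_sym x (pt v)); lra.
Qed.

(** Each unbounded component lies in a branch, which is then unbounded, and distinct components lie
    in distinct branches because a branch determines its component. *)
Lemma bushy_directions : bushy R T -> exists D : nat, forall w, exists v, (dist w v <= D)%N /\
  exists u : 'I_3 -> V, injective u /\ forall i, unbounded_direction v (u i).
Proof.
move=> [D hD]; exists (Num.bound `|D|) => w.
have [v [dwv [C [Ci hC]]]] := hD (pt w); exists v; split.
  rewrite mdist_vertex in dwv; rewrite -(ler_nat R); apply: le_trans dwv _.
  apply: le_trans (ler_norm D) _; exact/ltW/archi_boundP.
have /choice[p hp] : forall i, exists p, p <> pt v /\ C i = connected_component (~` [set pt v]) p.
  by move=> i; have [_ [p]] := hC i; exists p.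
have /choice[u hu] : forall i, exists u, branch v u (p i).
  by move=> i; have [z zv pz] := support_ex (hp i).1; exists (lev v 1 z), z.
exists u; split=> [i j ij|i].
  apply: Ci; rewrite (hp i).2 (hp j).2 (branch_component (hu i)) (branch_component (hu j)).
  by rewrite ij.
apply: unbounded_branch => -[M hM]; apply: (hC i).1; exists M => x y Cx Cy.
have sub : C i `<=` branch v (u i).
  rewrite (hp i).2; apply: connected_branch (hu i).
  - exact: component_connected.
  - exact: connected_component_sub.
  - by apply: connected_component_refl; exact: (hp i).1.
by apply: hM; exact: sub.
Qed.

(* Away from [o], an unbounded direction at [v] contains a ray from [o]. *)
Lemma unbounded_direction_ray (o v t : V) : (forall v, finite_set [set u | adj v u]) ->
  unbounded_direction v t -> t <> lev v 1 o ->
  exists b : boundary X, ray o b (dist o v) = v /\ ray o b (dist o v).+1 = t.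
Proof.
move=> lf ub ui1; pose l := (dist o v).+1.
have down z : (1 <= dist v z)%N -> lev v 1 z = t -> [/\ (l <= dist o z)%N, lev o l z = t &
    dist o z = (dist o v + dist v z)%N].
  move=> vz zt.
  have d : dist o z = (dist o v + dist v z)%N.
    have [vo|vo] := pselect (v = o); first by rewrite vo distxx.
    have := dist_gp v o z; suff : gp v o z = 0%N by rewrite (dist_sym v o); lia.
    apply/eqP; rewrite -leqn0 leqNgt; apply/negP => /gp_geP[_ _ e].
    by apply: ui1; rewrite e.
  have [d1 d2] := levP vz; rewrite zt in d1 d2.
  split=> //; first by rewrite /l; lia.
  have := dist_triangle o v t; have := dist_triangle o t z => h1 h2.
  by apply: lev_eq; rewrite /l; lia.
have dt : dist o t = l.
  have [z [zt vz]] := ub 1%N; have [h1 h2 h3] := down z vz zt.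
  by have [] := levP h1; rewrite h2.
pose P (x : V) := forall N, exists z, [/\ (N <= dist o z)%N, (dist o x <= dist o z)%N,
  (l <= dist o z)%N, lev o (dist o x) z = x & lev o l z = t].
have [||b hb] := @konig R T o P.
- move=> N; have [z [zt vz]] := ub N.+1; have [h1 h2 h3] := down z (leq_trans (ltn0Sn N) vz) zt.
  by exists z; rewrite distxx lev0; split=> //; lia.
- move=> x Px; apply: contrapT => no.
  have /choice[M hM] : forall x' : V, exists M, adj x x' -> dist o x' = (dist o x).+1 ->
      ~ exists z, [/\ (M <= dist o z)%N, (dist o x' <= dist o z)%N,
         (l <= dist o z)%N, lev o (dist o x') z = x' & lev o l z = t].
    move=> x'; apply: contrapT => h.
    have h0 : adj x x' /\ dist o x' = (dist o x).+1.
      by apply: contrapT => h0; apply: h; exists 0%N => h1 h2; exfalso; apply: h0.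
    apply: no; exists x'; split; [by case: h0|by case: h0|move=> N].
    by apply: contrapT => nN; apply: h; exists N.
  pose K := \max_(y <- fset_set [set y | adj x y]) M y.
  have [z [h1 h2 h3 h4 h5]] := Px (maxn K (dist o x).+1).
  have lt : ((dist o x).+1 <= dist o z)%N by apply: leq_trans h1; exact: leq_maxr.
  pose x' := lev o (dist o x).+1 z; have [d1 d2] := levP lt.
  have e : lev o (dist o x) x' = x by rewrite /x' lev_lev.
  have le : (dist o x <= dist o x')%N by rewrite d1.
  have xx' : adj x x'.
    by apply: dist1_adj; have [_] := levP le; rewrite e /x' d1 subSnn.
  apply: (hM x' xx') => //; exists z; split=> //; last 2 first.
  - by rewrite d1.
  - by rewrite d1.
  apply: leq_trans h1; apply: leq_trans (leq_maxl _ _).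
  by rewrite /K (bigD1_seq x') ?fset_uniq ?in_fset_set ?mem_set//= leq_maxl.
have rt : ray o b l = t.
  by have [z [_ _ _]] := hb l 0%N; rewrite dist_ray => -> ->.
exists b; split=> //.
have [z [zt vz]] := ub 1%N; have [h1 h2 h3] := down z vz zt.
rewrite -(lev_ray o b (leqnSn (dist o v))) -/l rt -h2 lev_lev//.
by apply: lev_eq.
Qed.

Lemma avoid_two (u : 'I_3 -> V) (x y : V) : injective u -> exists i, u i <> x /\ u i <> y.
Proof.
move=> ui.
have n01 : u 0 <> u 1 by move=> /ui.
have n02 : u 0 <> u ord_max by move=> /ui.
have n12 : u 1 <> u ord_max by move=> /ui.
apply: contrapT => no.
have h i : u i = x \/ u i = y.
  have [|h1] := pselect (u i = x); first by left.
  by right; apply: contrapT => h2; apply: no; exists i.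
by case: (h 0) (h 1) (h ord_max) => h0 [] h1 [] h2; move: n01 n02 n12; rewrite h0 h1 h2.
Qed.

Lemma bushy_boundary_point : (forall v, finite_set [set u | adj v u]) -> bushy R T ->
  exists a : boundary X, True.
Proof.
move=> lf /bushy_directions[D hD]; case: (tree_nonempty T) => o.
have [v [_ [u [ui ub]]]] := hD o; have [i [h _]] := avoid_two (lev v 1 o) (lev v 1 o) ui.
by have [a _] := unbounded_direction_ray lf (ub i) h; exists a.
Qed.

(** Near the point of the ray of [a] at level [n + D] there is a branching vertex [v]. One of its
    three directions leads neither back to [o] nor along [a]. The ray through it still agrees with
    [a] at level [n], and leaves it at or before level [n + D + D]. *)
Lemma bushy_branching (o : V) : (forall v, finite_set [set u | adj v u]) -> bushy R T ->
  exists D, forall (a : boundary X) n, exists b, b <> a /\ (n <= bp o a b <= n + D)%N.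
Proof.
move=> lf /bushy_directions[D hD]; exists (D + D)%N => a n.
pose w0 := ray o a (n + D)%N.
have [v [dv [u [ui ub]]]] := hD w0.
have dw0 : dist o w0 = (n + D)%N by rewrite /w0 dist_ray.
have [i [ui1 ui2]] := avoid_two (lev v 1 o) (ray o a (dist o v).+1) ui.
have [b [rv rt]] := unbounded_direction_ray lf (ub i) ui1.
pose l := (dist o v).+1; rewrite -/l in rt.
have ne : ray o b l <> ray o a l by rewrite rt.
exists b; split; first by move=> e; apply: ne; rewrite e.
have agr : (n <= gp o w0 v)%N.
  have := dist_gp o w0 v; have := dist_triangle o v w0.
  by rewrite (dist_sym v w0) dw0; lia.
have lv : (dist o v <= n + D + D)%N by have := dist_triangle o w0 v; lia.
have nab : ray o a n = ray o b n.
  have /gp_geP[g1 g2 g3] := agr.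
  rewrite -(lev_ray o a (leq_addr D n)) -/w0 g3 -{1}rv lev_ray//.
apply/andP; split.
  by have /bp_sim[e|//] := nab; exfalso; apply: ne; rewrite e.
have ab : a <> b by move=> e; apply: ne; rewrite e.
rewrite leqNgt; apply/negP => lt; apply: ne; apply/esym/bp_sim; right.
by rewrite /l; lia.
Qed.

End Branches.

Lemma limn_einf_bounds (R : realType) (u : nat -> \bar R) (c d : \bar R) N :
  (forall i, (N <= i)%N -> (c <= u i <= d)%E) -> (c <= limn_einf u <= d)%E.
Proof.
move=> h; rewrite limn_einf_lim; apply/andP; split.
  apply: lime_ge; first exact: is_cvg_einfs.
  exists N => // n /= Nn; apply: le_ereal_inf_tmp => _ [m /= nm <-].
  by have /andP[] := h m (leq_trans Nn nm).
apply: lime_le; first exact: is_cvg_einfs.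
exists N => // n /= Nn; apply: (@le_trans _ _ (u n)); last by have /andP[] := h n Nn.
by apply: ereal_inf_lbound; exists n => //=.
Qed.

Lemma uniq4P (U : eqType) (a b c d : U) : uniq [:: a; b; c; d] ->
  [/\ a <> b, a <> c & a <> d] /\ [/\ b <> c, b <> d & c <> d].
Proof.
rewrite /= !inE !negb_or => /and4P[/and3P[/eqP ? /eqP ? /eqP ?] /andP[/eqP ? /eqP ?] /eqP ? _].
by [].
Qed.

(** * Cross-ratios and quasiconformality *)

Section CrossRatio.
Variables (R : realType) (T : tree).
Local Notation V := (vertex T).
Local Notation X := (realization R T).
Local Notation pt := (@vertex_point R T).
Local Notation B := (boundary X).
Implicit Types (a b c d : B) (o q : V).

(** By [cross_ratio_bounds], the logarithm of the cross-ratio is the left side minus the two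
    products on the right, up to an error of 4. *)
Definition mobius_le o L a b c d : Prop :=
  (bp o a b + bp o c d <= bp o a d + bp o b c + L)%N.

Definition mobius_log o a b c d : R :=
  (bp o a b)%:R + (bp o c d)%:R - (bp o a d)%:R - (bp o b c)%:R.

(** The distances to [o] cancel in the alternating sum, leaving twice the Gromov products; each of
    the four distances costs 2 by rounding to vertices. *)
Lemma cross_term_bound (x y z t : nat -> X) o a b c d : uniq [:: a; b; c; d] ->
  tends_to x a -> tends_to y b -> tends_to z c -> tends_to t d ->
  exists N, forall i, (N <= i)%N ->
  `|mdist (x i) (t i) - mdist (t i) (z i) + mdist (z i) (y i) - mdist (y i) (x i) -
    2 * mobius_log o a b c d| <= 8.
Proof.
move=> /uniq4P[[ab ac ad] [bc bd cd]].
move=> /(tends_toP o) xa /(tends_toP o) yb /(tends_toP o) zc /(tends_toP o) td.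
have [N1 h1] := conv_bp xa yb ab; have [N2 h2] := conv_bp zc td cd.
have [N3 h3] := conv_bp xa td ad; have [N4 h4] := conv_bp yb zc bc.
exists (maxn (maxn N1 N2) (maxn N3 N4)) => i Ni.
have {}h1 : gp o (rnd (x i)) (rnd (y i)) = bp o a b by apply: h1; lia.
have {}h2 : gp o (rnd (z i)) (rnd (t i)) = bp o c d by apply: h2; lia.
have {}h3 : gp o (rnd (x i)) (rnd (t i)) = bp o a d by apply: h3; lia.
have {}h4 : gp o (rnd (y i)) (rnd (z i)) = bp o b c by apply: h4; lia.
have e u v : (dist u v)%:R = (dist o u)%:R + (dist o v)%:R - 2 * (gp o u v)%:R :> R.
  by rewrite -natrD -dist_gp natrD natrM addrK.
have k1 := mdist_rnd (x i) (t i); have k2 := mdist_rnd (t i) (z i).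
have k3 := mdist_rnd (z i) (y i); have k4 := mdist_rnd (y i) (x i).
rewrite (e (rnd (x i))) in k1; rewrite (e (rnd (t i))) in k2.
rewrite (e (rnd (z i))) in k3; rewrite (e (rnd (y i))) in k4.
rewrite (gp_sym o (rnd (t i)) (rnd (z i))) h2 in k2.
rewrite (gp_sym o (rnd (z i)) (rnd (y i))) h4 in k3.
rewrite (gp_sym o (rnd (y i)) (rnd (x i))) h1 in k4; rewrite h3 in k1.
rewrite ler_norml in k1; rewrite ler_norml in k2; rewrite ler_norml in k3; rewrite ler_norml in k4.
case/andP: k1 => ? ?; case/andP: k2 => ? ?; case/andP: k3 => ? ?; case/andP: k4 => ? ?.
rewrite ler_norml /mobius_log; apply/andP; split; lra.
Qed.

Lemma cross_ratio_bounds o a b c d : uniq [:: a; b; c; d] ->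
  expR (mobius_log o a b c d - 4) <= cross_ratio a b c d <= expR (mobius_log o a b c d + 4).
Proof.
move=> u; set l := mobius_log o a b c d; rewrite /cross_ratio; set S := (X in ereal_sup X).
have Sb e : S e -> ((2 * l - 8)%:E <= e <= (2 * l + 8)%:E)%E.
  move=> [x [y [z [t [xa yb zc td ->]]]]].
  have [N hN] := cross_term_bound o u xa yb zc td.
  apply: (limn_einf_bounds (N := N)) => i /hN; rewrite ler_norml => /andP[h1 h2].
  by rewrite !lee_fin; apply/andP; split; rewrite /l; lra.
have [e Se] : exists e, S e.
  eexists; exists (fun i => pt (ray o a i)), (fun i => pt (ray o b i)),
    (fun i => pt (ray o c i)), (fun i => pt (ray o d i)).
  by split; try exact: tends_ray.
have lo : ((2 * l - 8)%:E <= ereal_sup S)%E.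
  by have /andP[h _] := Sb e Se; apply: (le_trans h); exact: ereal_sup_ubound.
have hi : (ereal_sup S <= (2 * l + 8)%:E)%E.
  by apply: ge_ereal_sup => f /Sb/andP[].
have fS : ereal_sup S \is a fin_num.
  by rewrite fin_numE; apply/andP; split; apply/eqP => E; rewrite E in lo hi.
move: lo hi; rewrite -(fineK fS) !lee_fin => lo hi.
by rewrite !ler_expR; apply/andP; split; lra.
Qed.

(** [1 + x <= expR x] takes the place of a logarithm; applied to an exponent shifted by 4, it leaves
    the constant 3. *)
Lemma cross_ratio_ge o L a b c d : uniq [:: a; b; c; d] ->
  cross_ratio a b c d + 3 <= L%:R -> mobius_le o L a b c d.
Proof.
move=> u h; have /andP[h1 _] := cross_ratio_bounds o u.
have h2 := expR_ge1Dx (mobius_log o a b c d - 4).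
rewrite /mobius_log in h1 h2.
by rewrite /mobius_le -(ler_nat R) !natrD; lra.
Qed.

Lemma cross_ratio_le o L a b c d : uniq [:: a; b; c; d] ->
  mobius_le o L a b c d -> cross_ratio a b c d <= expR (L%:R + 4).
Proof.
move=> u; rewrite /mobius_le -(ler_nat R) !natrD => h.
have /andP[_ h1] := cross_ratio_bounds o u; apply: (le_trans h1).
by rewrite ler_expR /mobius_log; lra.
Qed.

Lemma conv_ray_base o q a : ray_conv q (ray o a) (ray q a).
Proof. by apply/(tends_to_vertexP q); exact: tends_ray. Qed.

Lemma mobius_le_base o q L a b c d : uniq [:: a; b; c; d] ->
  mobius_le q L a b c d -> mobius_le o L a b c d.
Proof.
move=> /uniq4P[[ab ac ad] [bc bd cd]].
have ev (e f : B) : e <> f -> exists N, forall i, (N <= i)%N ->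
    gp o (ray o e i) (ray o f i) = bp o e f /\ gp q (ray o e i) (ray o f i) = bp q e f.
  move=> ef; have [N hN] := conv_bp (conv_ray_base o o e) (conv_ray_base o o f) ef.
  have [N' hN'] := conv_bp (conv_ray_base o q e) (conv_ray_base o q f) ef.
  exists (maxn N N') => i Ni; split; [apply: hN|apply: hN']; lia.
have [N1 h1] := ev _ _ ab; have [N2 h2] := ev _ _ cd.
have [N3 h3] := ev _ _ ad; have [N4 h4] := ev _ _ bc.
pose i := maxn (maxn N1 N2) (maxn N3 N4).
have [|o1 q1] := h1 i; first by rewrite /i; lia.
have [|o2 q2] := h2 i; first by rewrite /i; lia.
have [|o3 q3] := h3 i; first by rewrite /i; lia.
have [|o4 q4] := h4 i; first by rewrite /i; lia.
rewrite /mobius_le -o1 -o2 -o3 -o4 -q1 -q2 -q3 -q4.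
move: (ray o a i) (ray o b i) (ray o c i) (ray o d i) => x y z t.
have := dist_gp o x y; have := dist_gp q x y; have := dist_gp o z t; have := dist_gp q z t.
have := dist_gp o x t; have := dist_gp q x t; have := dist_gp o y z; have := dist_gp q y z.
lia.
Qed.

(** [gp q x y] is the distance from [q] to the geodesic from [x] to [y]. The vertex [q], where the
    paths from [o] to [z] and [t] part, lies on the geodesic between them, and the cross-ratio
    bounds its distance to the other geodesic. *)
Lemma near_both_lines_vertex o L (x y z t : V) :
  (gp o x y <= gp o z t)%N -> (gp o x y + gp o z t <= gp o x t + gp o y z + L)%N ->
  let q := lev o (gp o z t) z in (gp q x y <= L)%N /\ (gp q z t <= L)%N.
Proof.
move=> le h q; have [g1 g2 g3] := gp_agree o z t.
have [d1 d2] := levP g1; have [_ d3] := levP g2; rewrite -g3 -/q in d3; rewrite -/q in d1 d2.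
have e1 := dist_gp q z t; have e2 := dist_gp o z t.
split; last by lia.
have gqz : (gp o z t <= gp o q z)%N by have := dist_gp o q z; lia.
have gqt : (gp o z t <= gp o q t)%N by have := dist_gp o q t; lia.
have u1 := gp_ultra o q t x; have u2 := gp_ultra o q z y.
have u3 := gp_ultra o q x y; have u4 := gp_ultra o q y x.
rewrite (gp_sym o t x) in u1; rewrite (gp_sym o z y) in u2; rewrite (gp_sym o y x) in u4.
have := gp_le o q x; have := gp_le o q y.
have := dist_gp q x y; have := dist_gp o x y; have := dist_gp o q x; have := dist_gp o q y.
lia.
Qed.

(* The witness is the deeper of the two branching points of the pairs. *)
Lemma near_both_lines o L a b c d : uniq [:: a; b; c; d] -> mobius_le o L a b c d ->
  exists q, (bp q a b <= L)%N /\ (bp q c d <= L)%N.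
Proof.
move=> /uniq4P[[ab ac ad] [bc bd cd]].
have main (a' b' c' d' : B) : a' <> b' -> c' <> d' -> a' <> d' -> b' <> c' ->
    (bp o a' b' <= bp o c' d')%N -> mobius_le o L a' b' c' d' ->
    exists q, (bp q a' b' <= L)%N /\ (bp q c' d' <= L)%N.
  move=> ab' cd' ad' bc' le h.
  have ev p (e f : B) : e <> f -> exists N, forall i, (N <= i)%N -> gp p (ray o e i) (ray o f i) = bp p e f.
    move=> ef; have [N hN] := conv_bp (conv_ray_base o p e) (conv_ray_base o p f) ef.
    by exists N => i Ni; apply: hN.
  pose q := ray o c' (bp o c' d'); exists q.
  have [N1 h1] := ev o _ _ ab'; have [N2 h2] := ev o _ _ cd'.
  have [N3 h3] := ev o _ _ ad'; have [N4 h4] := ev o _ _ bc'.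
  have [N5 h5] := ev q _ _ ab'; have [N6 h6] := ev q _ _ cd'.
  pose i := maxn (maxn (maxn N1 N2) (maxn N3 N4)) (maxn (maxn N5 N6) (bp o c' d')).
  rewrite -(h5 i) -?(h6 i); [|rewrite /i; lia|rewrite /i; lia].
  have := @near_both_lines_vertex o L (ray o a' i) (ray o b' i) (ray o c' i) (ray o d' i).
  rewrite h1; last by rewrite /i; lia.
  rewrite h2; last by rewrite /i; lia.
  rewrite h3; last by rewrite /i; lia.
  rewrite h4; last by rewrite /i; lia.
  rewrite lev_ray; last by rewrite /i; lia.
  by apply.
case: (leqP (bp o a b) (bp o c d)) => [le|/ltnW le] h; first exact: main h.
have [||||||q [h1 h2]] := main c d a b => //; try exact: nesym; last by exists q.
by move: h; rewrite /mobius_le (bp_sym o c b) (bp_sym o d a); lia.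
Qed.

End CrossRatio.

(** * Stability of geodesics under quasi-isometries of trees *)

Section Morse.
Variable T : tree.
Local Notation V := (vertex T).
Implicit Types (q s u v x y : V) (F : V -> V).

Definition vertex_qi (K C : nat) F : Prop := forall u v,
  (dist (F u) (F v) <= K * dist u v + C)%N /\ (dist u v <= K * dist (F u) (F v) + C)%N.

(* A coarse path which leaves a branch of a tree passes close to its root. *)
Lemma last_far_point K C F x q H : vertex_qi K C F -> (H <= dist (F q) (F x))%N -> (0 < H)%N ->
  exists s, [/\ (dist x s + dist s q)%N = dist x q, (H <= gp (F q) (F s) (F x))%N &
    (dist (F q) (F s) <= H + K + C)%N].
Proof.
move=> hF Hx H0.
suff main n s : dist s q = n -> (dist x s + dist s q)%N = dist x q ->
    (H <= gp (F q) (F s) (F x))%N -> exists s', [/\ (dist x s' + dist s' q)%N = dist x q,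
    (H <= gp (F q) (F s') (F x))%N & (dist (F q) (F s') <= H + K + C)%N].
  apply: (main _ x erefl); first by rewrite distxx.
  by have := dist_gp (F q) (F x) (F x); rewrite distxx; lia.
elim: n s => [|n IH] s e gs Ps.
  by move: Ps; rewrite (dist_eq0 e); have := gp_le (F q) (F q) (F x); rewrite distxx; lia.
have qs : q <> s by move=> qs; rewrite qs distxx in e.
have [s' [s's d]] := dist_pred qs; rewrite dist_sym e dist_sym in d; case: d => d.
have [Ps'|Ps'] := leqP H (gp (F q) (F s') (F x)).
  apply: (IH s') => //.
  have := dist_triangle x s s'; have := dist_triangle x s' q; have := dist_adj s's.
  by rewrite (dist_sym s s'); lia.
exists s; split=> //.
have [k _] := hF s s'; have ad := dist_adj s's; rewrite dist_sym in ad.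
have le : (dist (F s) (F s') <= K + C)%N.
  by apply: (leq_trans k); rewrite leq_add2r; apply: leq_trans (leq_mul (leqnn K) ad) _; rewrite muln1.
have := gp_ultra (F q) (F s') (F s) (F x).
have := dist_gp (F q) (F s) (F s'); have := gp_le (F q) (F s') (F s).
rewrite (gp_sym (F q) (F s') (F s)); lia.
Qed.

(** If the images of [x] and [y] share a long branch at [F q], let [s] and [t] be the last points of
    the geodesics from [x] and [y] to [q] with image in it. Their images are close, so [s] and [t]
    are close. But these geodesics stay apart until they are near [q], so [s] is near [q] and the
    branch is short. *)
Lemma morse K C L : exists M, forall F q x y, vertex_qi K C F ->
  (gp q x y <= L)%N -> (gp (F q) (F x) (F y) <= M)%N.
Proof.
pose c1 := (K * (2 * (K + C)) + C)%N.
exists (K * (c1 + 2 * L) + C)%N => F q x y hF hL.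
have [->//|H0] := posnP (gp (F q) (F x) (F y)).
set H := gp (F q) (F x) (F y) in H0 *.
have Hx : (H <= dist (F q) (F x))%N by exact: gp_le.
have Hy : (H <= dist (F q) (F y))%N by rewrite /H gp_sym; exact: gp_le.
have [s [s1 s2 s3]] := last_far_point hF Hx H0.
have [t [t1 t2 t3]] := last_far_point hF Hy H0.
have g1 := gp_ultra (F q) (F s) (F x) (F y); have g2 := gp_ultra (F q) (F s) (F y) (F t).
rewrite -/H in g1; rewrite (gp_sym _ (F y) (F t)) in g2.
have d1 := dist_gp (F q) (F s) (F t).
have le : (dist (F s) (F t) <= 2 * (K + C))%N by lia.
have [_ k1] := hF s t; have {}k1 : (dist s t <= c1)%N.
  by apply: (leq_trans k1); rewrite /c1 leq_add2r leq_mul2l le orbT.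
have gs : gp q x s = dist q s.
  by have := dist_gp q x s; rewrite (dist_sym q x) (dist_sym q s); lia.
have gt : gp q y t = dist q t.
  by have := dist_gp q y t; rewrite (dist_sym q y) (dist_sym q t); lia.
have u1 := gp_ultra q x s t; have u2 := gp_ultra q x t y.
rewrite gs in u1; rewrite (gp_sym q t y) gt in u2.
have l1 := gp_le q s t; have l2 := gp_le q t s; rewrite (gp_sym q t s) in l2.
have d2 := dist_gp q s t.
have h : (dist q s <= c1 + 2 * L)%N by lia.
have [k2 _] := hF q s.
have le2 : (H <= dist (F q) (F s))%N by apply: leq_trans s2 (gp_le _ _ _).
apply: (leq_trans le2); apply: (leq_trans k2).
by rewrite leq_add2r leq_mul2l h orbT.
Qed.

End Morse.

(** * Mobius bounds from each of the three criteria *)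

Section Criteria.
Variables (R : realType) (T : tree).
Local Notation V := (vertex T).
Local Notation X := (realization R T).
Local Notation pt := (@vertex_point R T).
Local Notation B := (boundary X).
Implicit Types (a b c d : B) (o q : V) (f : B -> B) (h : X -> X) (F : set (B -> B)).

Definition uniform_mobius o F : Prop := forall L, exists M, forall f a b c d, F f ->
  uniq [:: a; b; c; d] -> mobius_le o L a b c d -> mobius_le o M (f a) (f b) (f c) (f d).

Lemma homeomorphism_inj (U W : topologicalType) (f : U -> W) : homeomorphism f -> injective f.
Proof. by move=> [g [fK _ _ _]]; exact: can_inj fK. Qed.

Lemma uniq4_map (U W : eqType) (f : U -> W) (a b c d : U) : injective f ->
  uniq [:: a; b; c; d] -> uniq [:: f a; f b; f c; f d].
Proof. by move=> fi u; rewrite -[X in uniq X]/(map f [:: a; b; c; d]) map_inj_uniq. Qed.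

(** A cross-ratio is bounded when two lines pass close to a common vertex, and conversely by
    [near_both_lines]. It thus suffices to follow such a vertex through the map. *)
Lemma uniform_mobius_of_base o F : (forall f, F f -> injective f) ->
  (forall L, exists M, forall f a b c d q, F f -> uniq [:: a; b; c; d] ->
    (bp q a b <= L)%N -> (bp q c d <= L)%N ->
    exists q', (bp q' (f a) (f b) <= M)%N /\ (bp q' (f c) (f d) <= M)%N) ->
  uniform_mobius o F.
Proof.
move=> Fi hF L; have [M hM] := hF L; exists (M + M)%N => f a b c d Ff u le.
have [q [q1 q2]] := near_both_lines u le.
have [q' [h1 h2]] := hM f a b c d q Ff u q1 q2.
apply: (@mobius_le_base R T o q'); first exact: uniq4_map (Fi f Ff) u.
by rewrite /mobius_le; lia.
Qed.

Lemma extends_gp h f q q' a b : extends_to_boundary h f -> a <> b -> f a <> f b ->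
  exists x y, [/\ gp q x y = bp q a b, gp q' (rnd (h (pt x))) (rnd (h (pt y))) = bp q' (f a) (f b) &
   `|gromov_product (pt q) (pt x) (pt y) - (bp q a b)%:R| <= 2 /\
   `|gromov_product (pt q') (h (pt x)) (h (pt y)) - (bp q' (f a) (f b))%:R| <= 2].
Proof.
move=> hf ab fab.
have [N1 h1] := conv_bp (conv_ray_base q q a) (conv_ray_base q q b) ab.
have /(tends_toP q') ca := hf a _ (tends_ray q a).
have /(tends_toP q') cb := hf b _ (tends_ray q b).
have [N2 h2] := conv_bp ca cb fab.
have /(tends_toP q) ca' := tends_ray q a; have /(tends_toP q) cb' := tends_ray q b.
have [N3 h3] := conv_bp ca' cb' ab.
pose i := maxn N1 (maxn N2 N3); exists (ray q a i), (ray q b i).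
have e1 : gp q (ray q a i) (ray q b i) = bp q a b by apply: h1; rewrite /i; lia.
have e2 : gp q' (rnd (h (pt (ray q a i)))) (rnd (h (pt (ray q b i)))) = bp q' (f a) (f b).
  by apply: h2; rewrite /i; lia.
have e3 : gp q (rnd (pt (ray q a i))) (rnd (pt (ray q b i))) = bp q a b.
  by apply: h3; rewrite /i; lia.
split=> //; split; first by rewrite -e3; exact: gromov_rnd.
by rewrite -e2; exact: gromov_rnd.
Qed.

Lemma quasi_isometry_vertex_qi (K C : R) : 1 <= K -> 0 <= C -> exists K' C', forall h,
  quasi_isometry K C h -> vertex_qi K' C' (fun v => rnd (h (pt v))).
Proof.
(* Rounding images to vertices adds 2 to the additive constant, and solving the lower estimate for
   [dist u v] multiplies it by [K]. *)
move=> K1 C0; exists (Num.bound K), (Num.bound (C + 2 + K * (C + 2))) => h [hq _] u v.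
have K0 : 0 < K by lra.
have [] := andP (hq (pt u) (pt v)); rewrite mdist_vertex => h1 h2.
have := mdist_rnd (h (pt u)) (h (pt v)); rewrite ler_norml => /andP[h3 h4].
have KC : 0 <= K * (C + 2) by apply: mulr_ge0; lra.
have bC : C + 2 + K * (C + 2) <= (Num.bound (C + 2 + K * (C + 2)))%:R.
  by apply/ltW/archi_boundP; lra.
have bK : K <= (Num.bound K)%:R by apply/ltW/archi_boundP; lra.
have d0 n : K * n%:R <= (Num.bound K)%:R * n%:R by apply: ler_wpM2r.
have h1' : (dist u v)%:R <= K * (mdist (h (pt u)) (h (pt v)) + C).
  by rewrite -ler_pdivrMl//; lra.
have h5 : K * (mdist (h (pt u)) (h (pt v)) + C) <=
    K * ((dist (rnd (h (pt u))) (rnd (h (pt v))))%:R + (C + 2)).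
  by rewrite ler_pM2l//; lra.
rewrite mulrDr in h5.
split; rewrite -(ler_nat R) natrD natrM.
  by have := d0 (dist u v); lra.
by have := d0 (dist (rnd (h (pt u))) (rnd (h (pt v)))); lra.
Qed.

Lemma qi_bp K C L : exists M, forall h f q a b, vertex_qi K C (fun v => rnd (h (pt v))) ->
  extends_to_boundary h f -> a <> b -> f a <> f b -> (bp q a b <= L)%N ->
  (bp (rnd (h (pt q))) (f a) (f b) <= M)%N.
Proof.
have [M hM] := morse T K C L; exists M => h f q a b hq hf ab fab le.
have [x [y [e1 e2 _]]] := extends_gp q (rnd (h (pt q))) hf ab fab.
by rewrite -e2; apply: (hM (fun v => rnd (h (pt v)))) => //; rewrite e1.
Qed.

Lemma uniform_mobius_ext o F : (forall f, F f -> homeomorphism f) ->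
  uniformly_qc_ext F -> uniform_mobius o F.
Proof.
move=> Fh [K [C [K1 C0 hF]]]; apply: uniform_mobius_of_base => [f /Fh|L].
  exact: homeomorphism_inj.
have [K' [C' hKC]] := quasi_isometry_vertex_qi K1 C0.
have [M hM] := qi_bp K' C' L; exists M => f a b c d q Ff u q1 q2.
have [h [/hKC hq hf]] := hF f Ff.
have [[ab _ _] [_ _ cd]] := uniq4P u.
have [[fab _ _] [_ _ fcd]] := uniq4P (uniq4_map (homeomorphism_inj (Fh f Ff)) u).
by exists (rnd (h (pt q))); split; exact: hM.
Qed.

Lemma uniform_mobius_mobius o F : (forall f, F f -> homeomorphism f) ->
  uniformly_qc_mobius F -> uniform_mobius o F.
Proof.
move=> Fh [I [[I0 Imon _] hF]] L.
exists (Num.bound (I (expR (L%:R + 4)) + 3)) => f a b c d Ff u le.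
have u' := uniq4_map (homeomorphism_inj (Fh f Ff)) u.
apply: cross_ratio_ge => //.
have [_ h1] := hF f Ff a b c d u.
have h2 := cross_ratio_le u le.
have cr0 : 0 <= cross_ratio a b c d by apply: ltW; exact: expR_gt0.
have h3 : I (cross_ratio a b c d) <= I (expR (L%:R + 4)).
  by move: h2; rewrite le_eqVlt => /orP[/eqP->//|h2]; exact/ltW/Imon.
have I0' := I0 _ (expR_ge0 (L%:R + 4)).
have bd : I (expR (L%:R + 4)) + 3 <= (Num.bound (I (expR (L%:R + 4)) + 3))%:R.
  by apply/ltW/archi_boundP; lra.
lra.
Qed.

Lemma isometry_inverse h : self_isometry h -> exists h', [/\ self_isometry h', cancel h h' & cancel h' h].
Proof.
move=> [hd hs]; have [h' hh'] := choice hs.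
have hi : injective h.
  by move=> x y e; apply: mdist_positivity; rewrite -hd e mdistxx.
have hK : cancel h h' by move=> x; apply: hi; rewrite hh'.
exists h'; split=> //; split=> [x y|y]; first by rewrite -hd !hh'.
by exists (h y).
Qed.

Lemma isometry_asymptotic h (x y : nat -> X) : self_isometry h -> asymptotic x y -> asymptotic (h \o x) (h \o y).
Proof.
move=> [hd hs] xy o' M; have [z <-] := hs o'.
apply: filterS (xy z M) => -[i j] /=.
by rewrite /gromov_product !hd.
Qed.

Lemma isometry_extends h : self_isometry h -> exists f, extends_to_boundary h f.
Proof.
move=> hh; case: (tree_nonempty T) => o.
have hb a : exists b, forall x, tends_to x a -> tends_to (h \o x) b.
  pose x0 i := pt (ray o a i); have t0 : tends_to x0 a by exact: tends_ray.
  have asym x y : tends_to x a -> tends_to y a -> asymptotic x y.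
    by move=> /(tends_toP o) xa /(tends_toP o) ya; apply/(asymptoticP o); exact: conv_gp xa ya.
  have ex : exists2 x, asymptotic x x &
      [set y | asymptotic y y /\ asymptotic (h \o x0) y] =
      [set y | asymptotic y y /\ asymptotic x y].
    by exists (h \o x0) => //; apply: isometry_asymptotic => //; exact: asym.
  exists (Boundary ex) => x xa; split; apply: isometry_asymptotic => //; exact: asym.
by have [f hf] := choice hb; exists f => a x; exact: hf.
Qed.

(** The 4 is the rounding error of two Gromov products, 2 for each; [r] pays for the change of base
    point. *)
Lemma isometry_bp h f q q' a b (r : R) : self_isometry h -> extends_to_boundary h f ->
  a <> b -> f a <> f b -> mdist (h (pt q)) (pt q') <= r ->
  (bp q' (f a) (f b) <= bp q a b + Num.bound (`|r| + 4))%N /\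
  (bp q a b <= bp q' (f a) (f b) + Num.bound (`|r| + 4))%N.
Proof.
move=> hh hf ab fab hr.
have [x [y [_ _ [h1 h2]]]] := extends_gp q q' hf ab fab.
have h3 := gromov_base q' (h (pt q)) (h (pt x)) (h (pt y)).
have e : gromov_product (h (pt q)) (h (pt x)) (h (pt y)) = gromov_product (pt q) (pt x) (pt y).
  by rewrite /gromov_product !hh.1.
rewrite e in h3.
have h4 : `|r| + 4 < (Num.bound (`|r| + 4))%:R.
  by apply: archi_boundP; rewrite addr_ge0.
have h5 := ler_norm r.
rewrite ler_norml in h1; rewrite ler_norml in h2; rewrite ler_norml in h3.
case/andP: h1 => ? ?; case/andP: h2 => ? ?; case/andP: h3 => ? ?.
by split; rewrite -(ler_nat R) natrD; lra.
Qed.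

(** For a sequence of violations, the pairs converge to two distinct points and the maps accumulate
    at some injective [f] in [KK]. Balls are compact and open, so compact-open neighbourhoods of [f]
    keep the images near the distinct points [f a] and [f b]. *)
Lemma compact_family_bp o (KK : set {compact-open, B -> B}) m :
  (forall v : V, finite_set [set u | adj v u]) ->
  compact KK -> KK `<=` [set f | homeomorphism f] ->
  exists M, forall f a b, KK f -> a <> b -> (bp o a b <= m)%N -> (bp o (f a) (f b) <= M)%N.
Proof.
move=> lf cK hK; apply: contrapT => no.
have /choice[t ht] : forall i, exists t : (B -> B) * B * B,
    [/\ KK t.1.1, t.1.2 <> t.2, (bp o t.1.2 t.2 <= m)%N & (i < bp o (t.1.1 t.1.2) (t.1.1 t.2))%N].
  move=> i; apply: contrapT => h; apply: no; exists i => f a b Kf ab le.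
  by rewrite leqNgt; apply/negP => lt; apply: h; exists (f, a, b).
have [a [s [sle hs]]] := @boundary_cluster R T o lf (fun i => (t i).1.2).
have [b [s' [sle' hs']]] := @boundary_cluster R T o lf (fun i => (t (s i)).2).
pose k i := s (s' i).
have kle i : (i <= k i)%N by apply: leq_trans (sle' i) (sle _).
have ka i : ray o (t (k i)).1.2 i = ray o a i.
  by apply: (ray_le (sle' i)); apply/bp_sim; exact: hs.
have kb i : ray o (t (k i)).2 i = ray o b i by apply/bp_sim; exact: hs'.
have ab : a <> b.
  move=> e; have [_ ne le _] := ht (k m.+1); apply: (bp_lt (o := o) ne).
  by apply: (@ray_le _ _ _ _ _ _ m.+1) => //; rewrite ka kb e.
pose g i : {compact-open, B -> B} := (t (k i)).1.1.
have [f [Kf cf]] : KK `&` cluster (g @ \oo) !=set0.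
  apply: (cK (g @ \oo) (fmap_proper_filter g eventually_filter)).
  by exists 0%N => // i _; have [] := ht (k i).
have fh := hK _ Kf; have fi := homeomorphism_inj fh.
have [f' [_ _ fc _]] := fh.
pose l := (bp o (f a) (f b)).+1.
have fab : ray o (f a) l <> ray o (f b) l by apply: bp_lt => /fi.
have open_ball n c : open (level_ball (@bp R T o) n c).
  apply/(boundary_openP o) => x /bp_sim xc; exists n => y /bp_sim yx.
  by apply/bp_sim; rewrite yx.
have closed_ball n c : closed (level_ball (@bp R T o) n c).
  rewrite -[level_ball _ _ _]setCK; apply: open_closedC.
  apply/(boundary_openP o) => x xc; exists n => y /bp_sim yx /bp_sim yc; apply: xc.
  by apply/bp_sim; rewrite -yx.
have compact_ball n c : compact (level_ball (@bp R T o) n c).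
  by apply: (subclosed_compact (closed_ball n c) (@boundary_compact R T o lf)).
have cont c : exists n, level_ball (@bp R T o) n c `<=` f @^-1` level_ball (@bp R T o) l (f c).
  apply/(nbhs_boundaryP o); apply: fc; apply/(nbhs_boundaryP o); by exists l.
have [n hn] := cont a; have [n' hn'] := cont b.
pose U := [set g0 : {compact-open, B -> B} |
  g0 @` level_ball (@bp R T o) n a `<=` level_ball (@bp R T o) l (f a)].
pose U' := [set g0 : {compact-open, B -> B} |
  g0 @` level_ball (@bp R T o) n' b `<=` level_ball (@bp R T o) l (f b)].
have nU : nbhs (f : {compact-open, B -> B}) U.
  apply: open_nbhs_nbhs; split; last by move=> _ [x /hn ? <-].
  exact: compact_open_open.
have nU' : nbhs (f : {compact-open, B -> B}) U'.
  apply: open_nbhs_nbhs; split; last by move=> _ [x /hn' ? <-].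
  exact: compact_open_open.
have [g0 [[j jN <-] [Ug Ug']]] := cf (g @` [set i | (maxn l (maxn n n') <= i)%N]) (U `&` U')
  (ex_intro2 _ _ (maxn l (maxn n n')) I (fun i hi => ex_intro2 _ _ i hi erefl)) (filterI nU nU').
rewrite /= in jN.
have /bp_sim e1 : level_ball (@bp R T o) l (f a) (g j (t (k j)).1.2).
  apply: Ug; exists (t (k j)).1.2 => //; apply/bp_sim.
  by apply: (@ray_le _ _ _ _ _ _ j) => //; lia.
have /bp_sim e2 : level_ball (@bp R T o) l (f b) (g j (t (k j)).2).
  apply: Ug'; exists (t (k j)).2 => //; apply/bp_sim.
  by apply: (@ray_le _ _ _ _ _ _ j) => //; lia.
apply: fab; rewrite -e1 -e2; apply/bp_sim; right.
have [_ _ _ lt] := ht (k j); apply: leq_trans (ltnW lt).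
by apply: leq_trans (kle j); lia.
Qed.

(** An isometry [al] takes a point near [o] to [q], and [be] is its companion. Pairs whose line
    passes near [q] are pulled back by [al] to pairs near [o], mapped by the compact family, and
    pulled back by [be]; the new vertex is the preimage of [o] under [be], rounded. *)
Lemma uniform_mobius_compact o F : (forall v : V, finite_set [set u | adj v u]) ->
  (forall f, F f -> homeomorphism f) -> uniformly_qc_compact F -> uniform_mobius o F.
Proof.
move=> lf Fh [[x0 [D hD]] _ [KK [cK KKh hF]]].
apply: uniform_mobius_of_base => [f /Fh|L]; first exact: homeomorphism_inj.
pose r := mdist (pt o) x0 + D.
pose m := (L + Num.bound (`|r| + 4))%N.
have [M hM] := compact_family_bp o m lf cK KKh.
pose e1 := Num.bound (`|1 : R| + 4).
exists (M + e1)%N => f a b c d q Ff u q1 q2.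
have fi := homeomorphism_inj (Fh f Ff).
have [al [ali dal]] := hD (pt q).
have [al' [ali' alK alK']] := isometry_inverse ali.
have [dal0 hdal] := isometry_extends ali; have [dal' hdal'] := isometry_extends ali'.
have [be [dbe [bei hbe KKf]]] := hF f Ff al dal0 ali hdal.
have [be' [bei' beK beK']] := isometry_inverse bei.
have dK e : dal0 (dal' e) = e.
  have t1 := tends_ray o e; have := hdal _ _ (hdal' _ _ t1).
  have -> : al \o (al' \o fun i => pt (ray o e i)) = fun i => pt (ray o e i).
    by apply/funext => i /=; rewrite alK'.
  by move=> t2; exact: (tends_to_uniq o t2 t1).
have al'q : mdist (al' (pt q)) (pt o) <= r.
  rewrite -(ali.1 _ (pt o)) alK' metric_sym.
  apply: le_trans (metric_triangle _ (al x0) _) _.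
  by rewrite ali.1 lerD2l.
have beo : mdist (be (pt (rnd (be' (pt o))))) (pt o) <= 1.
  by rewrite -{2}(beK' (pt o)) bei.1 metric_sym; exact: rndP.
have one (x y : B) : x <> y -> (bp q x y <= L)%N ->
    (bp (rnd (be' (pt o))) (f x) (f y) <= M + e1)%N.
  move=> xy le.
  have xy' : dal' x <> dal' y by move=> e; apply: xy; rewrite -(dK x) e dK.
  have [k1 _] := isometry_bp ali' hdal' xy xy' al'q.
  have k2 : (bp o (dal' x) (dal' y) <= m)%N.
    by apply: leq_trans k1 _; rewrite /m leq_add2r.
  have := hM _ _ _ KKf xy' k2; rewrite /= !dK => k3.
  have fxy : f x <> f y by move=> /fi.
  have bxy : dbe (f x) <> dbe (f y).
    move=> e; apply: xy'; apply: (homeomorphism_inj (KKh _ KKf)) => /=.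
    by rewrite !dK.
  have [_ k4] := isometry_bp bei hbe fxy bxy beo; apply: leq_trans k4 _.
  by rewrite /e1 leq_add2r.
have [[ab _ _] [_ _ cd]] := uniq4P u.
by exists (rnd (be' (pt o))); split; exact: one.
Qed.

Lemma uniformly_quasiconformal_mobius o F : (forall v : V, finite_set [set u | adj v u]) ->
  uniformly_quasiconformal F -> uniform_mobius o F.
Proof.
move=> lf [Fh [h|h|h]].
- exact: uniform_mobius_ext.
- exact: uniform_mobius_mobius.
- exact: uniform_mobius_compact.
Qed.

End Criteria.

(** * The structure tree of a nested family *)

Section StructureTree.
Variables (B : choiceType) (EE : set (set B)).
Implicit Types (E F H : set B).

Record tree_family : Prop := TreeFamily {
  tf_compl : forall E, EE E -> EE (~` E);
  tf_nonempty : forall E, EE E -> exists x, E x;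
  tf_nested : forall E F, EE E -> EE F -> ~ crosses E F;
  tf_interval : forall E F, EE E -> EE F -> finite_set [set H | [/\ EE H, E `<=` H & H `<=` F]];
  tf_inhabited : exists E, EE E }.

Hypothesis tf : tree_family.

Lemma nested_cases E F : EE E -> EE F -> [\/ F `<=` E, E `<=` F, F `<=` ~` E | ~` E `<=` F].
Proof.
move=> eE eF; apply: contrapT; rewrite or4E !not_orE => -[h1 [h2 [h3 h4]]].
apply: (tf_nested tf eE eF); split.
- move/existsNP: h3 => [x /not_implyP[Fx /contrapT Ex]]; by exists x.
- by move/existsNP: h2 => [x /not_implyP[Ex Fx]]; exists x.
- by move/existsNP: h1 => [x /not_implyP[Fx Ex]]; exists x.
- by move/existsNP: h4 => [x /not_implyP[Ex Fx]]; exists x.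
Qed.

Lemma setC_sub E F : E `<=` F -> ~` F `<=` ~` E.
Proof. by move=> EF x nF /EF. Qed.

Lemma setC_inj E F : ~` E = ~` F -> E = F.
Proof. by move=> e; rewrite -(setCK E) e setCK. Qed.

Lemma family_not_sub_compl E F : EE E -> E `<=` F -> E `<=` ~` F -> False.
Proof. by move=> /(tf_nonempty tf)[x Ex] h /(_ x Ex); apply; exact: h. Qed.

Lemma family_compl_not_sub E F : EE E -> E `<=` F -> ~` E `<=` F -> EE F -> False.
Proof.
move=> eE h1 h2 /(tf_compl tf)/(tf_nonempty tf)[x Fx].
by have [/h1|/h2] := pselect (E x).
Qed.

(* The orientation of the family given by the terminal vertex of the edge [E]:
   the members that contain [E], or contain its complement strictly. *)
Definition orient E : set (set B) := [set F | EE F /\ (E `<=` F \/ (~` E `<=` F /\ F <> ~` E))].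

Lemma orient_self E : EE E -> orient E E.
Proof. by split=> //; left. Qed.

Lemma orientC E F : EE E -> EE F -> (orient E F <-> ~ orient E (~` F)).
Proof.
move=> eE eF; have eCE := tf_compl tf eE; have eCF := tf_compl tf eF.
split=> [[_ h] [_ h']|h].
  case: h h' => [h|[h n]] [h'|[h' n']].
  - exact: family_not_sub_compl eE h h'.
  - apply: n'; congr (~` _); apply/seteqP; split=> //.
    by have := setC_sub h'; rewrite !setCK.
  - apply: n; apply/seteqP; split=> //.
    by have := setC_sub h'; rewrite !setCK.
  - exact: family_not_sub_compl eCE h h'.
split=> //; have [h1|h1|h1|h1] := nested_cases eE eF.
- have [->|ne] := pselect (F = E); first by left.
  exfalso; apply: h; split=> //; right; split; first exact: setC_sub.
  by move/setC_inj.
- by left.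
- exfalso; apply: h; split=> //; left.
  by have := setC_sub h1; rewrite setCK.
- have [e|ne] := pselect (F = ~` E); last by right.
  by exfalso; apply: h; split=> //; left; rewrite e setCK.
Qed.

Lemma orient_up E F F' : EE E -> orient E F -> F `<=` F' -> EE F' -> orient E F'.
Proof.
move=> eE [eF h] FF' eF'; split=> //; case: h => [h|[h n]].
  by left; exact: subset_trans FF'.
right; split; first exact: subset_trans FF'.
by move=> e; apply: n; apply/seteqP; split=> //; rewrite -e.
Qed.

Lemma orient_min E F : EE E -> orient E F -> F `<=` E -> F = E.
Proof.
move=> eE [eF [h|[h _]]] FE; first by apply/seteqP.
exfalso; apply: (@family_compl_not_sub E E) => //; exact: subset_trans FE.
Qed.

(** An orientation is determined by any of its minimal members: the edges [E] and [F] then have the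
    same terminal vertex. *)
Lemma orient_eq E F : EE E -> EE F -> orient E F ->
  (forall H, orient E H -> H `<=` F -> H = F) -> orient E = orient F.
Proof.
move=> eE eF oF minF; apply/seteqP; split=> H oH.
  have eH := oH.1; apply/(orientC eF eH) => -[eCH [h|[h n]]].
    by apply: ((orientC eE eH).1 oH); exact: orient_up h _.
  apply: n; congr (~` _); apply: minF => //.
  by have := setC_sub h; rewrite !setCK.
have [eH h] := oH; case: h => [h|[h n]]; first exact: orient_up h _.
apply: contrapT => nH; have oCH : orient E (~` H).
  apply: contrapT => nCH; apply: nCH; apply/(orientC eE (tf_compl tf eH)).
  by rewrite setCK.
apply: n; rewrite -(minF _ oCH) ?setCK//.
by have := setC_sub h; rewrite !setCK.
Qed.

Lemma orient_compl_self E : EE E -> ~ orient E (~` E).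
Proof. by move=> eE; apply/(orientC eE eE); exact: orient_self. Qed.

Lemma orient_flip E F : EE E -> F <> E -> F <> ~` E -> orient E F -> orient (~` E) F.
Proof. by move=> eE n1 n2 [eF [h|[h _]]]; split=> //; [right; rewrite setCK|left]. Qed.

(** Vertices are the orientations themselves, which identifies the terminal vertices of different
    edges without a quotient. *)
Definition svertex : choiceType :=
  {s : set (set B) | `[< exists2 E, EE E & s = orient E >]}.
Implicit Types u v w : svertex.

Definition mkvertex E (eE : EE E) : svertex :=
  exist (fun s => `[< exists2 E, EE E & s = orient E >]) _
    (asboolT (ex_intro2 _ _ E eE (erefl (orient E)))).

Lemma svertexP v : exists2 E, EE E & val v = orient E.
Proof. by have /asboolP := valP v. Qed.

Lemma sv_eq u v : val u = val v -> u = v. Proof. exact: val_inj. Qed.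

Lemma sv_sub v F : val v F -> EE F.
Proof. by have [E eE ->] := svertexP v; case. Qed.

Lemma svC v F : EE F -> (val v F <-> ~ val v (~` F)).
Proof. by have [E eE ->] := svertexP v; exact: orientC. Qed.

Lemma sv_up v F F' : val v F -> F `<=` F' -> EE F' -> val v F'.
Proof. by have [E eE ->] := svertexP v; exact: orient_up. Qed.

Definition sadj : rel svertex := fun u v =>
  `[< exists E, [/\ EE E, val u = orient E & val v = orient (~` E)] >].

Lemma sadjP u v : reflect (exists E, [/\ EE E, val u = orient E & val v = orient (~` E)]) (sadj u v).
Proof. exact: asboolP. Qed.

Lemma sadj_sym : symmetric sadj.
Proof.
have h u v : sadj u v -> sadj v u.
  move=> /sadjP[E [eE eu ev]]; apply/sadjP; exists (~` E); split=> //; first exact: tf_compl.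
  by rewrite setCK.
by move=> u v; apply/idP/idP; exact: h.
Qed.

Lemma sadj_irr : irreflexive sadj.
Proof.
move=> u; apply/negP => /sadjP[E [eE eu]]; rewrite eu => e.
by apply: (orient_compl_self eE); rewrite e; apply/orient_self/tf_compl.
Qed.

Lemma sadj_change u v F : sadj u v -> EE F -> ~ val u F -> val v F ->
  val u = orient (~` F) /\ val v = orient F.
Proof.
move=> /sadjP[E [eE -> ->]] eF nu vF.
have [e|n1] := pselect (F = E).
  by exfalso; apply: nu; rewrite e; exact: orient_self.
have [e|n2] := pselect (F = ~` E); first by rewrite e setCK.
exfalso; apply: nu; rewrite -(setCK E); apply: orient_flip => //; first exact: tf_compl.
by rewrite setCK.
Qed.

(** Traversing an edge changes the orientation of that edge only, so a path along which [F] becomes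
    a member traverses the edge [F]. *)
Lemma sadj_crossing p u F : EE F -> path sadj u p -> ~ val u F -> val (last u p) F ->
  exists p1 v p2, [/\ p = p1 ++ v :: p2, val (last u p1) = orient (~` F) & val v = orient F].
Proof.
move=> eF; elim: p u => [|w p IH] u //= /andP[uw wp] nu lF.
have [wF|wF] := pselect (val w F).
  have [h1 h2] := sadj_change uw eF nu wF.
  by exists [::], w, p.
have [p1 [v [p2 [-> h1 h2]]]] := IH w wp wF lF.
by exists (w :: p1), v, p2.
Qed.

Definition sdiff u v : set (set B) := [set H | val u H /\ ~ val v H].

Lemma finite_sdiff u v : finite_set (sdiff u v).
Proof.
have [E eE eu] := svertexP u; have [F eF ev] := svertexP v.
have eCE := tf_compl tf eE; have eCF := tf_compl tf eF.
pose I E F := [set H | [/\ EE H, E `<=` H & H `<=` F]].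
apply: (@sub_finite_set _ _ ((I E F `|` I (~` E) F) `|` (I E (~` F) `|` I (~` E) (~` F)))).
  move=> H [uH vH]; have eH := sv_sub uH.
  have {}vH : orient F (~` H).
    rewrite -ev; apply/(svC v (tf_compl tf eH)); by rewrite setCK.
  have h1 : E `<=` H \/ ~` E `<=` H by move: uH; rewrite eu => -[_ [|[]]]; [left|right].
  have h2 : H `<=` ~` F \/ H `<=` F.
    case: vH => _ [/setC_sub|[/setC_sub]]; rewrite !setCK; [left|right] => //.
  by case: h1 => ?; case: h2 => ?; [right; left|left; left|right; right|left; right].
by rewrite !finite_setU; do !split; exact: tf_interval.
Qed.

Lemma sdiff0 u v : sdiff u v = set0 -> u = v.
Proof.
move=> d0; have uv H : val u H -> val v H.
  by move=> uH; apply: contrapT => vH; have : sdiff u v H by []; rewrite d0.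
apply: sv_eq; apply/seteqP; split=> H //; first exact: uv.
move=> vH; have eH := sv_sub vH; apply/(svC u eH) => /uv.
by apply/(svC v eH).
Qed.

(** A minimal member [H] of the finite difference of [u] and [v] is minimal in [u], hence [u] is the
    terminal vertex of [H]; traversing this edge removes [H] from the difference and adds
    nothing. *)
Lemma sadj_connected u v : exists2 p, path sadj u p & last u p = v.
Proof.
have [n] := ubnP (csize (sdiff u v)); elim: n u => // n IH u lt.
have [[H0 dH0]|h] := pselect (exists H, sdiff u v H); last first.
  exists [::] => //=; apply: sdiff0; apply/seteqP; split=> // H dH.
  by apply: h; exists H.
have [H [dH minH]] := nat_argmin (fun H => csize [set F | sdiff u v F /\ F `<=` H])
  (ex_intro (sdiff u v) H0 dH0).
have fin K : finite_set [set F | sdiff u v F /\ F `<=` K].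
  by apply: sub_finite_set (finite_sdiff u v) => F [].
have eH := sv_sub dH.1; have [E eE eu] := svertexP u.
have uE : val u = orient H.
  rewrite eu; apply: orient_eq => //; first by rewrite -eu; case: dH.
  move=> F; rewrite -eu => uF FH; apply: contrapT => ne.
  have dF : sdiff u v F by split=> // vF; apply: dH.2; exact: sv_up FH _.
  have := minH F dF; rewrite leqNgt => /negP; apply.
  apply: (csize_lt (fin H) (x := H)).
  - by move=> K [? KF]; split=> //; exact: subset_trans FH.
  - by split.
  - by move=> [_ HF]; apply: ne; apply/seteqP.
pose u' := mkvertex (tf_compl tf eH).
have uu' : sadj u u' by apply/sadjP; exists H.
have sub : sdiff u' v `<=` sdiff u v `\ H.
  move=> F [/= u'F vF]; have eF := u'F.1.
  have FH : F <> H.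
    by move=> FH; rewrite FH -{2}(setCK H) in u'F; exact: (orient_compl_self (tf_compl tf eH) u'F).
  split=> //; split=> //; rewrite uE -(setCK H); apply: orient_flip => //.
  - exact: tf_compl.
  - move=> FH'; apply: dH.2; apply/(svC v eH) => h; apply: vF; by rewrite FH'.
  - by rewrite setCK.
have le : (csize (sdiff u' v) < n)%N.
  rewrite -ltnS; apply: leq_trans lt; rewrite ltnS.
  apply: (csize_lt (finite_sdiff u v) (x := H)) => //.
    by move=> F /sub[].
  by move/sub => [_]; apply.
have [p up pv] := IH u' le.
by exists (u' :: p); rewrite //= uu'.
Qed.

(** A cycle leaving [x] for [y] along an edge must traverse the same edge from [y] to [x] on its way
    back, so it repeats a vertex unless it has length two. *)
Lemma sadj_acyclic c : ucycle sadj c -> (size c <= 2)%N.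
Proof.
case: c => [//|x [//|y s]] /andP[/= /andP[/sadjP[E [eE xE yE]] ps] /andP[xs /andP[ys us]]].
have nyE : ~ val y E.
  by rewrite yE -{2}(setCK E); exact: (orient_compl_self (tf_compl tf eE)).
have lE : val (last y (rcons s x)) E by rewrite last_rcons xE; exact: orient_self.
have [p1 [v [p2 [e h1 h2]]]] := sadj_crossing eE ps nyE lE.
have h3 : last y p1 = y by apply: sv_eq; rewrite h1 yE.
have vx : v = x by apply: sv_eq; rewrite h2 xE.
case: p1 e h3 {h1} => [|z p1] e h3; last first.
  have ly : y \in z :: p1 by rewrite -h3 /= mem_last.
  have : y \in take (size s) (rcons s x).
    rewrite e take_cat ifF ?mem_cat//; last first.
      apply/negbTE; rewrite -leqNgt.
      have := congr1 size e; rewrite size_rcons size_cat /=; lia.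
    by rewrite ly.
  by rewrite -cats1 take_size_cat// (negbTE ys).
case: s {ps} xs ys us e lE => [//|z s] xs ys us [e1 e2] _.
by move: xs; rewrite e1 vx !inE eqxx orbT.
Qed.

Definition stree : tree.
Proof.
refine (@Tree svertex sadj _ sadj_sym sadj_irr sadj_connected sadj_acyclic).
by have [E eE] := tf_inhabited tf; exact: inhabits (mkvertex eE).
Defined.
End StructureTree.

(** * Distances and local finiteness in the tree of a cut family *)

Section TreeOfCuts.
Variables (B : choiceType) (p : B -> B -> nat) (G : groupType) (act : G -> B -> B).
Variables (D : nat) (EE : set (set B)) (x0 : B).
Hypotheses (um : branching_ultrametric p D) (cf : cut_family p act EE).
Local Notation sim := (sim p).
Local Notation level_ball := (level_ball p).
Implicit Types (E F H : set B).

Definition in_ball j E : Prop := exists x, E `<=` level_ball j x.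

(** Such a set crosses one of the finitely many balls of level [j], which [cf_finite] controls, or
    it is a union of such balls. *)
Lemma finite_not_in_ball j :
  finite_set [set H | [/\ EE H, ~ in_ball j H & ~ in_ball j (~` H)]].
Proof.
have [N [f fj]] := um_classes um j.
have /choice[r hr] : forall i : 'I_N, exists x : B, (exists y, f y = i) -> f x = i.
  move=> i; have [[y fy]|h] := pselect (exists y, f y = i); first by exists y.
  by exists x0.
pose inv H := forall x y, sim j x y -> H x -> H y.
have fin_inv : finite_set [set H | inv H].
  pose code H : {set 'I_N} := [set i | `[< exists x, H x /\ f x = i >]]%SET.
  apply: (@finite_by_code _ _ _ code); last exact: finite_finset.
  have sub H H' : inv H -> inv H' -> code H = code H' -> H `<=` H'.
    move=> iH iH' e x Hx; have : f x \in code H by rewrite inE; apply/asboolP; exists x.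
    by rewrite e inE => /asboolP[y [H'y /fj yx]]; exact: iH' yx H'y.
  by move=> H H' iH iH' e; apply/seteqP; split; apply: sub.
apply: (@sub_finite_set _ _ ([set H | inv H] `|`
  \bigcup_(i in [set: 'I_N]) [set H | EE H /\ crosses H (level_ball j (r i))])).
  move=> H [eH h1 h2]; have [[i ci]|nc] := pselect (exists i, crosses H (level_ball j (r i))).
    by right; exists i.
  left=> x y xy Hx; apply: contrapT => Hy.
  have xr : sim j x (r (f x)) by apply: fj; rewrite hr//; exists x.
  have yr : sim j y (r (f x)) := sim_trans um (sim_sym um xy) xr.
  apply: nc; exists (f x); split; [by exists x| |by exists y|].
    apply: contrapT => h; apply: h1; exists (r (f x)) => z Hz.
    by apply: contrapT => nz; apply: h; exists z.
  apply: contrapT => h; apply: h2; exists (r (f x)) => z Hz.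
  by apply: contrapT => nz; apply: h; exists z.
rewrite finite_setU; split=> //; apply: bigcup_finite => [|i _]; first exact: finite_finset.
exact: cf_finite cf _ _.
Qed.

Lemma not_in_ball E : EE E -> exists j, ~ in_ball j E.
Proof.
move=> eE; have [x Ex] := cf_nonempty cf eE; have [j hj] := cf_open cf eE Ex.
have [y [yx /andP[jy _]]] := um_branch um x j.
have Ey : E y by apply: hj; right; rewrite (um_sym um).
exists (p x y).+1 => -[z hz].
have /sim_sym h := hz y Ey; have [e|] := sim_trans um (hz x Ex) (h D um); first by apply: yx.
by rewrite ltnn.
Qed.

Lemma in_ball_le i j E : (i <= j)%N -> in_ball j E -> in_ball i E.
Proof. by move=> ij [x hx]; exists x => y /hx; exact: sim_le. Qed.

Lemma in_ball_sub j E F : E `<=` F -> in_ball j F -> in_ball j E.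
Proof. by move=> EF [x hx]; exists x => y /EF /hx. Qed.

Lemma cut_tree_family : tree_family EE.
Proof.
split; [exact: cf_compl cf|exact: cf_nonempty cf|exact: cf_nested cf| |].
  move=> E F eE eF; have [j hj] := not_in_ball eE.
  have [j' hj'] := not_in_ball (cf_compl cf eF).
  apply: sub_finite_set (finite_not_in_ball (maxn j j')) => H [eH EH HF]; split=> //.
    move=> h; apply: hj; apply: in_ball_le (leq_maxl j j') _; exact: in_ball_sub h.
  move=> h; apply: hj'; apply: in_ball_le (leq_maxr j j') _.
  by apply: in_ball_sub h => x nF /HF.
by have [E [eE _ _]] := cf_basis cf x0 0; exists E.
Qed.

Let tf := cut_tree_family.
Definition cut_tree : tree := stree tf.
Local Notation V := (vertex cut_tree).
Implicit Types (u v w o : V).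

Definition vset v : set (set B) := val (v : svertex EE).

Lemma vt_ex E : exists v, EE E -> vset v = orient EE E.
Proof.
have [eE|nE] := pselect (EE E); first by exists (mkvertex eE).
by have [F [eF _ _]] := cf_basis cf x0 0; exists (mkvertex eF).
Qed.

(** Total, with an arbitrary vertex outside the family, so that no membership proof appears in
    terms. *)
Definition vt E : V := projT1 (cid (vt_ex E)).

Lemma vset_vt E : EE E -> vset (vt E) = orient EE E.
Proof. by rewrite /vt; case: cid. Qed.

Lemma vset_inj u v : vset u = vset v -> u = v. Proof. exact: val_inj. Qed.

Lemma vsetP v : exists2 E, EE E & v = vt E.
Proof.
by have [E eE h] := svertexP (v : svertex EE); exists E => //; apply: vset_inj; rewrite vset_vt.
Qed.

Lemma vset_compl v E : EE E -> (vset v E <-> ~ vset v (~` E)).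
Proof. exact: svC tf _ _. Qed.

Lemma vset_up v E F : vset v E -> E `<=` F -> EE F -> vset v F.
Proof. exact: sv_up. Qed.

Lemma vset_self E : EE E -> vset (vt E) E.
Proof. by move=> eE; rewrite vset_vt//; exact: orient_self. Qed.

Lemma vset_self_compl E : EE E -> ~ vset (vt (~` E)) E.
Proof.
move=> eE; have eCE := cf_compl cf eE; rewrite -{2}(setCK E) vset_vt//.
exact: (orient_compl_self tf).
Qed.

Lemma vset_min E F : EE E -> vset (vt E) F -> F `<=` E -> F = E.
Proof. by move=> eE; rewrite vset_vt//; exact: (orient_min tf). Qed.

Lemma adj_vtP u v : adj u v <-> exists E, [/\ EE E, u = vt E & v = vt (~` E)].
Proof.
split=> [/(@sadjP _ _ (u : svertex EE) (v : svertex EE))[E [eE e1 e2]]|[E [eE -> ->]]].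
  exists E; split=> //; apply: vset_inj; rewrite vset_vt//; exact: cf_compl cf _ _.
apply/(@sadjP _ _ (vt E : svertex EE) (vt (~` E) : svertex EE)); exists E; split=> //.
  exact: vset_vt.
by apply: vset_vt; exact: cf_compl cf _ _.
Qed.

Lemma dist_through E u w : EE E -> ~ vset u E -> vset w E ->
  (dist u w = dist u (vt E) + dist (vt E) w /\ 0 < dist u (vt E))%N.
Proof.
move=> eE nu wE; have [q [uq qw sq]] := dist_path u w; rewrite -sq.
have lE : vset (last u q) E by rewrite qw.
have [q1 [v [q2 [e h1 h2]]]] := sadj_crossing tf eE (uq : path (@sadj _ EE) u q) nu lE.
have vE : v = vt E by apply: vset_inj; rewrite vset_vt.
subst v q; have := uq; rewrite cat_path /= => /andP[p1 /andP[a1 p2]].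
have q1p : path (@adj cut_tree) u (rcons q1 (vt E)) by rewrite rcons_path; apply/andP; split.
have d1 := dist_le q1p; rewrite last_rcons size_rcons in d1.
have d2 := @dist_le cut_tree (vt E) q2 p2.
have qw' : last (vt E) q2 = w by rewrite -qw last_cat.
rewrite qw' in d2; rewrite size_cat /=.
have tri := dist_triangle u (vt E) w; rewrite -sq size_cat /= in tri.
have ne : dist u (vt E) <> 0%N.
  by move/dist_eq0 => e; apply: nu; rewrite e; exact: vset_self.
have key n1 n2 e1 e2 : (e1 <= n1.+1 -> e2 <= n2 -> e1 <> 0 -> n1 + n2.+1 <= e1 + e2 ->
    n1 + n2.+1 = e1 + e2 /\ 0 < e1)%N by lia.
exact: key d1 d2 ne tri.
Qed.

(** With [gp_sep], this translates membership in [E] into Gromov products: a path from [o] to a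
    vertex beyond [E] passes through [vt E]. *)
Lemma gp_both o E u w : EE E -> ~ vset o E -> vset u E -> vset w E ->
  (dist o (vt E) <= gp o u w)%N.
Proof.
move=> eE oE uE wE; have [d1 _] := dist_through eE oE uE; have [d2 _] := dist_through eE oE wE.
have := dist_gp o u w; have := dist_triangle u (vt E) w; rewrite (dist_sym u (vt E)); lia.
Qed.

Lemma gp_sep o E u w : EE E -> ~ vset o E -> vset u E -> ~ vset w E ->
  (gp o u w <= dist o (vt E))%N.
Proof.
move=> eE oE uE wE; have [d1 _] := dist_through eE oE uE; have [d2 _] := dist_through eE wE uE.
have := dist_gp o u w; have := dist_triangle o w (vt E).
have := dist_triangle o (vt E) w.
rewrite (dist_sym u w) (dist_sym (vt E) w); lia.
Qed.

Lemma small_cut o x j : exists E, [/\ EE E, E x, E `<=` level_ball j x & ~ vset o E].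
Proof.
have [E0 eE0 ->] := vsetP o; have [j0 h0] := not_in_ball eE0.
have [j1 h1] := not_in_ball (cf_compl cf eE0).
have [E [eE Ex sE]] := cf_basis cf x (maxn j (maxn j0 j1)).
exists E; split=> //.
  by move=> y /sE; apply: sim_le; exact: leq_maxl.
have inb k : (k <= maxn j0 j1)%N -> in_ball k E.
  by move=> le; exists x => y /sE; apply: sim_le; lia.
rewrite vset_vt// => -[_ [h|[h _]]].
  by apply: h0; apply: in_ball_sub h (inb _ (leq_maxl _ _)).
by apply: h1; apply: in_ball_sub h (inb _ (leq_maxr _ _)).
Qed.

(** Shrinking the cut strictly around [x] makes the path from [o] pass through the previous vertex
    and then at least one more. *)
Lemma deep_cut o x k : exists E, [/\ EE E, E x, ~ vset o E & (k <= dist o (vt E))%N].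
Proof.
elim: k => [|k [E [eE Ex oE le]]].
  by have [E [? ? _ ?]] := small_cut o x 0; exists E.
have [j hj] := cf_open cf eE Ex; have [i hi] := not_in_ball eE.
have [E' [eE' Ex' sE' oE']] := small_cut o x (maxn i j).
have EE' : E' `<=` E by move=> y /sE' h; apply: hj; apply: sim_le h; exact: leq_maxr.
exists E'; split=> //.
have vE' : vset (vt E') E by apply: vset_up (vset_self eE') EE' eE.
have [-> _] := dist_through eE oE vE'.
have [vE|nE] := pselect (vset (vt E) E'); last first.
  have [_] := dist_through eE' nE (vset_self eE'); lia.
exfalso; apply: hi; exists x => y; rewrite -(vset_min eE vE EE') => /sE' hy.
by apply: sim_le hy; exact: leq_maxl.
Qed.

(** Infinitely many edges ending at [v] have pairwise disjoint complements, which eventually become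
    small and accumulate at some [x]. A small member [F] around [x] is not in the orientation [v],
    and this forces [F] into the complement of [e i] as soon as it contains that complement; so [x]
    lies in two disjoint sets. *)
Lemma finite_neighbours v : finite_set [set u | adj v u].
Proof.
pose K := [set E | EE E /\ vt E = v].
suff fK : finite_set K.
  apply: sub_finite_set (finite_image (fun E => vt (~` E)) fK) => u /adj_vtP[E [eE ev ->]].
  by exists E.
apply: contrapT => /infiniteP/pcard_leP[e].
have Ke i : K (e i) by exact: funS.
have ei : injective e by move=> i j h; apply: (@inj _ _ _ e) => //; rewrite inE.
have eK i : EE (e i) by have [] := Ke i.
have star i j : i <> j -> ~` e j `<=` e i.
  move=> ij; have : vset (vt (e j)) (e i).
    by rewrite (Ke j).2 -(Ke i).2; exact: vset_self.
  rewrite vset_vt// => -[_ [h|[h _]]] //.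
  exfalso; apply: ij; apply: ei; apply/esym; apply: (vset_min (eK i)) => //.
  by rewrite (Ke i).2 -(Ke j).2; exact: vset_self.
have [y hy] : exists y : nat -> B, forall i, ~ e i (y i).
  have /choice[y hy] : forall i, exists z, ~ e i z.
    by move=> i; have [z ?] := cf_nonempty cf (cf_compl cf (eK i)); exists z.
  by exists y.
have disj i j z : i <> j -> ~ e i z -> e j z.
  by move=> ij nz; apply: (star j i) => //; exact: nesym.
have [x [s [sle hs]]] := um_cluster um y.
have [j0 h0] := not_in_ball (cf_compl cf (eK 0%N)).
have [j1 h1] := not_in_ball (cf_compl cf (eK 1%N)).
(* At most one of the disjoint complements contains [x]. The two that do not contain it are used to
   show that [F], chosen to avoid [y a] and [y b], is not in the orientation [v]. *)
have [a [b [ab ax bx]]] : exists a b, [/\ a <> b, e a x & e b x].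
  have [h|h] := pselect (e 0%N x); have [h'|h'] := pselect (e 1%N x).
  - by exists 0%N, 1%N.
  - by exists 0%N, 2%N; split=> //; exact: disj h'.
  - by exists 1%N, 2%N; split=> //; exact: disj h.
  - by exfalso; apply: h'; exact: disj h.
have [F [eF Fx sF]] := cf_basis cf x (p (y a) x + p (y b) x).+1.
have nF c : e c x -> (p (y c) x <= p (y a) x + p (y b) x)%N -> ~ F (y c).
  move=> ex le /sF h; have := hy c; have [e'|] := h; first by rewrite e'.
  by move=> h'; lia.
have Fa : ~ F (y a) by apply: nF => //; exact: leq_addr.
have Fb : ~ F (y b) by apply: nF => //; exact: leq_addl.
have nvF : ~ vset v F.
  have aux c d : c <> d -> e c x -> ~ F (y c) -> ~ F (y d) -> ~ vset v F.
    move=> cd ex Fc Fd; rewrite -(Ke c).2 vset_vt// => -[_ [h|[h _]]].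
      by apply: Fd; apply: h; apply: disj (hy d); exact: nesym.
    by apply: Fc; apply: h; exact: hy.
  exact: aux ab ax Fa Fb.
have vCF : vset v (~` F).
  by apply: contrapT => h; apply: nvF; apply/vset_compl.
have sub i : ~` e i `<=` F -> F `<=` ~` e i.
  move=> iF; move: vCF; rewrite -(Ke i).2 vset_vt// => -[_ [h|[h _]]].
    by have := @setC_sub _ _ _ h; rewrite setCK.
  by exfalso; apply: (h _ (hy i)); apply: iF; exact: hy.
have [j hj] := cf_open cf eF Fx.
pose m := maxn j (maxn j0 j1).
have fin := finite_not_in_ball m.
have small i : (2 <= i)%N -> ~ [set H | [/\ EE H, ~ in_ball m H & ~ in_ball m (~` H)]] (e i) ->
    in_ball m (~` e i).
  move=> i2 h; apply: contrapT => h'; apply: h; split=> // h''.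
  apply: h0; apply: (in_ball_le (j := m)); first by rewrite /m; lia.
  by apply: in_ball_sub h''; apply: star => i0; rewrite i0 in i2.
have finI : finite_set [set i | [/\ EE (e i), ~ in_ball m (e i) & ~ in_ball m (~` e i)]].
  apply: (@finite_by_code _ _ _ e) => [i i' _ _|]; first exact: ei.
  by apply: sub_finite_set fin => _ [i h <-].
have [N hN] : exists N, forall i, (N <= i)%N ->
    ~ [/\ EE (e i), ~ in_ball m (e i) & ~ in_ball m (~` e i)].
  exists (\max_(i <- fset_set [set i | [/\ EE (e i), ~ in_ball m (e i) & ~ in_ball m (~` e i)]]) i).+1.
  move=> i + h; rewrite ltnNge => /negP; apply.
  by rewrite (bigD1_seq i) ?fset_uniq ?in_fset_set ?mem_set//= leq_maxl.
have near n : (maxn m (maxn N 2) <= n)%N -> F `<=` ~` e (s n).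
  move=> le; apply: sub => z ez; apply: hj.
  have sn : (maxn m (maxn N 2) <= s n)%N := leq_trans le (sle n).
  have [c hc] : in_ball m (~` e (s n)) by apply: small; [lia|apply: hN; lia].
  apply: (@sim_le _ _ _ m); first by rewrite /m; lia.
  apply: (sim_trans um (hc z ez)); apply: (sim_trans um (sim_sym um (hc _ (hy _)))).
  by apply: sim_le (hs n); lia.
pose n1 := maxn m (maxn N 2); pose n2 := (s n1).+1.
have F1 := near n1 (leqnn _) x Fx.
have n12 : (n1 <= n2)%N by apply: leq_trans (sle n1) (leqnSn _).
have F2 := near n2 n12 x Fx.
apply: F1; apply: disj F2 => e12.
by have := sle n2; rewrite e12 /n2 ltnn.
Qed.

End TreeOfCuts.

(** * Isometries of the realization and properness *)

Section TreeAutomorphism.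
Variables (R : realType) (T : tree).
Local Notation V := (vertex T).
Local Notation X := (realization R T).
Local Notation pt := (@vertex_point R T).
Implicit Types (f : V -> V) (x y : X).

Record tree_automorphism f (fi : V -> V) : Prop := TreeAut {
  ta_K : cancel f fi;
  ta_Ki : cancel fi f;
  ta_adj : forall u v, adj u v -> adj (f u) (f v);
  ta_adji : forall u v, adj u v -> adj (fi u) (fi v) }.

Lemma bary_comp f fi u v (t : R) : tree_automorphism f fi ->
  (fun w => bary u v t (fi w)) = bary (f u) (f v) t.
Proof.
move=> [K Ki _ _]; apply/funext => w.
have e z : (fi w == z) = (w == f z) by apply/eqP/eqP => [<-|->]; rewrite ?Ki ?K.
by rewrite /bary !e.
Qed.

Lemma realization_map_subproof f fi x : tree_automorphism f fi ->
  exists u v t, [/\ (u == v) || adj u v, 0 <= t <= 1 & (fun w => Defs.coord x (fi w)) = bary u v t].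
Proof.
move=> hf; have [u [v [t [uv t01 e]]]] := realizationP x; exists (f u), (f v), t; split=> //.
  by case/orP: uv => [/eqP ->|/(ta_adj hf) ->]; rewrite ?eqxx ?orbT.
by rewrite e; exact: bary_comp.
Qed.

Definition realization_map f fi (hf : tree_automorphism f fi) x : X :=
  Point (realization_map_subproof x hf).

Lemma realization_map_vertex f fi (hf : tree_automorphism f fi) v :
  realization_map hf (pt v) = pt (f v).
Proof. by apply: coord_inj; exact: bary_comp. Qed.

Lemma chain_map f fi (hf : tree_automorphism f fi) x y l :
  chain x y l -> chain (realization_map hf x) (realization_map hf y) l.
Proof.
elim=> [{}x|{}x {}y z u v s t {}l uv s01 t01 xs yt _ IH]; first exact: chain0.
apply: (chainS (ta_adj hf uv) s01 t01 _ _ IH) => /=.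
  by rewrite xs; exact: bary_comp.
by rewrite yt; exact: bary_comp.
Qed.

Lemma tree_automorphismV f fi : tree_automorphism f fi -> tree_automorphism fi f.
Proof. by case. Qed.

Lemma realization_mapK f fi (hf : tree_automorphism f fi) (hfi : tree_automorphism fi f) x :
  realization_map hfi (realization_map hf x) = x.
Proof. by apply: coord_inj; apply/funext => w /=; rewrite (ta_K hf). Qed.

Lemma realization_map_isometry f fi (hf : tree_automorphism f fi) :
  self_isometry (realization_map hf).
Proof.
have hfi := tree_automorphismV hf.
split=> [x y|y]; last by exists (realization_map hfi y); exact: realization_mapK.
apply/eqP; rewrite eq_le; apply/andP; split; apply: le_tree_dist => l c.
  by apply: tree_dist_le; exact: chain_map.
apply: tree_dist_le; have := chain_map hfi c.
by rewrite !realization_mapK.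
Qed.

Definition edge_set (u v : V) : set X :=
  [set x | exists2 t, 0 <= t <= 1 & Defs.coord x = bary u v t].

Lemma edge_set_compact u v : adj u v -> compact (edge_set u v).
Proof.
move=> uv; have -> : edge_set u v = segment uv @` `[0, 1].
  apply/seteqP; split=> [x [t t01 e]|_ [t /= t01 <-]].
    exists t; first by rewrite /= in_itv.
    by apply: coord_inj; rewrite /= clip_id.
  by rewrite in_itv /= in t01; exists t => //=; rewrite clip_id.
apply: continuous_compact; last exact: segment_compact.
by apply: continuous_subspaceT; exact: segment_continuous.
Qed.

Lemma edge_set_cover x : (forall v : V, exists w, adj v w) ->
  exists u v, adj u v /\ edge_set u v x.
Proof.
move=> noiso; have [u [v [t [uv t01 e]]]] := realizationP x.
case/orP: uv => [/eqP uv|uv]; last by exists u, v; split=> //; exists t.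
have [w uw] := noiso u; exists u, w; split=> //; exists 0; first by rewrite lexx ler01.
by rewrite e -uv bary_diag (bary_vertex0 R u w).
Qed.

Lemma finite_bigcup_compact (I : choiceType) (A : set I) (K : I -> set X) :
  finite_set A -> (forall i, A i -> compact (K i)) -> compact (\bigcup_(i in A) K i).
Proof.
move=> fA cK; rewrite -(fset_setK fA) bigcup_fset big_seq; apply: bigsetU_compact => i.
by rewrite in_fset_set// inE; exact: cK.
Qed.

Lemma locally_finite_proper : (forall v : V, finite_set [set u | adj v u]) ->
  (forall v : V, exists w, adj v w) -> proper_space X.
Proof.
move=> lf noiso x r; pose o := rnd x.
(* Rounding [x] and passing from [y] to an end of its edge cost 1 each; the remaining unit is
   slack. *)
pose N := Num.bound (`|r| + 3).
pose S := \bigcup_(n in `I_N) [set v | dist o v = n].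
have fS : finite_set S by apply: bigcup_finite => [|n _]; [exact: finite_II|exact: finite_sphere].
pose A := S `*` S `&` [set e | adj e.1 e.2].
have fA : finite_set A by apply: finite_setIl; exact: finite_setX.
have cU : compact (\bigcup_(e in A) edge_set e.1 e.2).
  by apply: finite_bigcup_compact => // -[u v] [_ /= uv]; exact: edge_set_compact.
apply: (subclosed_compact _ cU).
  rewrite -[X in closed X]setCK; apply: open_closedC; rewrite openE => y /negP; rewrite -ltNge => ry.
  rewrite /interior -metricType_numDomainType.filter_from_mdist_nbhs.
  exists (mdist x y - r) => /=; first by rewrite subr_gt0.
  move=> z /= yz; apply/negP; rewrite -ltNge; have := metric_triangle x z y.
  rewrite (metric_sym z y); lra.
move=> y /= xy; have [u [v [uv yuv]]] := edge_set_cover y noiso.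
have inS w : mdist y (pt w) <= 1 -> S w.
  move=> yw; exists (dist o w) => //=; rewrite -(ltr_nat R) -mdist_vertex.
  apply: (@le_lt_trans _ _ (`|r| + 3)); last by apply: archi_boundP; rewrite addr_ge0.
  have := metric_triangle (pt o) x (pt w); have := metric_triangle x y (pt w).
  have := rndP x; rewrite -/o (metric_sym (pt o) x); have := ler_norm r; lra.
exists (u, v) => //; split=> //; have [t t01 e] := yuv; have /andP[t0 t1] := t01.
split=> /=; apply: inS.
  apply: (@le_trans _ _ `|t - 0|); last by rewrite subr0 ger0_norm.
  apply: tree_dist_le; apply: (chain1 uv) => //=; rewrite ?lexx ?ler01//.
  by rewrite (bary_vertex0 R u v).
apply: (@le_trans _ _ `|t - 1|); last by rewrite ler0_norm; lra.
apply: tree_dist_le; apply: (chain1 uv) => //=; rewrite ?lexx ?ler01//.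
by rewrite bary_vertex1.
Qed.

End TreeAutomorphism.

Lemma tends_to_asymptotic (R : realType) (T : tree) (x y : nat -> realization R T) a :
  tends_to x a -> asymptotic x y -> tends_to y a.
Proof.
case: (tree_nonempty T) => o /(tends_toP o) xa /(asymptoticP o) xy; apply/(tends_toP o).
exact: gp_conv xa xy.
Qed.

Lemma asymptotic_tends_to (R : realType) (T : tree) (x y : nat -> realization R T) a :
  tends_to x a -> tends_to y a -> asymptotic x y.
Proof.
case: (tree_nonempty T) => o /(tends_toP o) xa /(tends_toP o) ya; apply/(asymptoticP o).
exact: conv_gp xa ya.
Qed.

Section VertexSequences.
Variables (R : realType) (T : tree) (o : vertex T).
Local Notation pt := (@vertex_point R T).
Local Notation B := (boundary (realization R T)).

Lemma ray_eq_of_gp (u w : nat -> vertex T) (a b : B) k :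
  tends_to (fun i => pt (u i)) a -> tends_to (fun i => pt (w i)) b ->
  (exists N, forall i, (N <= i)%N -> (k <= gp o (u i) (w i))%N) -> ray o a k = ray o b k.
Proof.
move=> /(tends_to_vertexP o) ua /(tends_to_vertexP o) wb [N hN].
have [N1 h1] := ua k; have [N2 h2] := wb k; pose i := maxn N (maxn N1 N2).
have [|_ <-] := h1 i; first by rewrite /i; lia.
have [|_ <-] := h2 i; first by rewrite /i; lia.
by have /gp_geP[_ _ ->] : (k <= gp o (u i) (w i))%N by apply: hN; rewrite /i; lia.
Qed.

Lemma gp_of_ray_eq (u w : nat -> vertex T) (a b : B) k :
  tends_to (fun i => pt (u i)) a -> tends_to (fun i => pt (w i)) b -> ray o a k = ray o b k ->
  exists N, forall i, (N <= i)%N -> (k <= gp o (u i) (w i))%N.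
Proof.
move=> /(tends_to_vertexP o) ua /(tends_to_vertexP o) wb e.
have [N1 h1] := ua k; have [N2 h2] := wb k; exists (maxn N1 N2) => i le.
have [|d1 e1] := h1 i; first by lia.
have [|d2 e2] := h2 i; first by lia.
by apply/gp_geP; split=> //; rewrite e1 e2.
Qed.

Lemma gp_tends_to (u : nat -> vertex T) : (forall n, exists N, forall i j,
  (N <= i)%N -> (N <= j)%N -> (n <= gp o (u i) (u j))%N) ->
  exists a : B, tends_to (fun i => pt (u i)) a.
Proof.
move=> /gp_conv_ex[r [hr cr]]; have [a ra] := conv_boundary R hr cr.
exists a; apply/(tends_to_vertexP o) => n; have [N hN] := cr n; exists N => i /hN.
by rewrite ra.
Qed.

Lemma gp_tends_to_same (u w : nat -> vertex T) (a : B) : tends_to (fun i => pt (u i)) a ->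
  (forall n, exists N, forall i j, (N <= i)%N -> (N <= j)%N -> (n <= gp o (u i) (w j))%N) ->
  tends_to (fun i => pt (w i)) a.
Proof. by move=> /(tends_to_vertexP o) ua h; apply/(tends_to_vertexP o); exact: gp_conv ua h. Qed.

End VertexSequences.

(** * The boundary of the structure tree *)

Section BoundaryOfCuts.
Variables (R : realType) (B : choiceType) (p : B -> B -> nat) (G : groupType) (act : G -> B -> B).
Variables (D : nat) (EE : set (set B)) (x0 : B).
Hypotheses (um : branching_ultrametric p D) (cf : cut_family p act EE) (actP : is_action act).
Hypothesis act_cont : forall g j, exists l, forall x y, sim p l x y -> sim p j (act g x) (act g y).
Local Notation sim := (sim p).
Local Notation level_ball := (level_ball p).
Local Notation T' := (cut_tree x0 um cf).
Local Notation V := (vertex T').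
Local Notation vt := (vt x0 um cf).
Local Notation X' := (realization R T').
Local Notation B' := (boundary X').
Local Notation pt := (@vertex_point R T').
Implicit Types (E F : set B) (H : nat -> set B) (v : V) (x y : B).

(** Quantifying over all sequences of members shrinking to [x], monotone or not, makes the end point
    independent of choices and stable under the action. *)
Definition shrinks H x : Prop := (forall n, EE (H n)) /\
  forall m, exists N, forall n, (N <= n)%N -> H n x /\ H n `<=` level_ball m x.

Lemma shrinks_ex x : exists H, shrinks H x.
Proof.
have /choice[H hH] : forall n, exists E, [/\ EE E, E x & E `<=` level_ball n x].
  by move=> n; exact: cf_basis cf x n.
exists H; split=> [n|m]; first by have [] := hH n.
exists m => n mn; have [_ Hx sH] := hH n; split=> // y /sH; exact: sim_le.
Qed.

Lemma shrinks_in H x E : shrinks H x -> EE E -> E x ->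
  exists N, forall n, (N <= n)%N -> vset (vt (H n)) E.
Proof.
move=> [eH hH] eE Ex; have [m hm] := cf_open cf eE Ex; have [N hN] := hH m.
exists N => n /hN[_ sH]; apply: vset_up (vset_self x0 um cf (eH n)) _ eE.
exact: subset_trans hm.
Qed.

Lemma shrinks_out H x E : shrinks H x -> EE E -> ~ E x ->
  exists N, forall n, (N <= n)%N -> ~ vset (vt (H n)) E.
Proof.
move=> hH eE Ex; have [N hN] := shrinks_in hH (cf_compl cf eE) Ex.
by exists N => n /hN h /(vset_compl _ eE).
Qed.

Lemma shrinks_gp (o : V) H H' x : shrinks H x -> shrinks H' x -> forall k, exists N, forall i j,
  (N <= i)%N -> (N <= j)%N -> (k <= gp o (vt (H i)) (vt (H' j)))%N.
Proof.
move=> h h' k; have [E [eE Ex oE le]] := deep_cut o x k.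
have [N hN] := shrinks_in h eE Ex; have [N' hN'] := shrinks_in h' eE Ex.
exists (maxn N N') => i j Ni Nj; apply: leq_trans le _; apply: gp_both => //.
  by apply: hN; lia.
by apply: hN'; lia.
Qed.

Lemma end_point_ex x : exists b : B', forall H, shrinks H x -> tends_to (fun n => pt (vt (H n))) b.
Proof.
case: (tree_nonempty T') => o; have [H hH] := shrinks_ex x.
have [b hb] := gp_tends_to R (shrinks_gp o hH hH); exists b => H' hH'.
exact: gp_tends_to_same hb (shrinks_gp o hH hH').
Qed.

Definition end_point x : B' := projT1 (cid (end_point_ex x)).

Lemma end_pointP H x : shrinks H x -> tends_to (fun n => pt (vt (H n))) (end_point x).
Proof. by rewrite /end_point; case: cid => b hb /hb. Qed.

Lemma end_point_agree (o : V) E x y : EE E -> ~ vset o E -> E x -> E y ->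
  ray o (end_point x) (dist o (vt E)) = ray o (end_point y) (dist o (vt E)).
Proof.
move=> eE oE Ex Ey; have [H hH] := shrinks_ex x; have [H' hH'] := shrinks_ex y.
apply: (ray_eq_of_gp (end_pointP hH) (end_pointP hH')).
have [N hN] := shrinks_in hH eE Ex; have [N' hN'] := shrinks_in hH' eE Ey.
exists (maxn N N') => i le; apply: gp_both => //; [apply: hN|apply: hN']; lia.
Qed.

Lemma end_point_differ (o : V) E x y : EE E -> ~ vset o E -> E x -> ~ E y ->
  ray o (end_point x) (dist o (vt E)).+1 <> ray o (end_point y) (dist o (vt E)).+1.
Proof.
move=> eE oE Ex Ey e; have [H hH] := shrinks_ex x; have [H' hH'] := shrinks_ex y.
have [N1 h1] := gp_of_ray_eq (end_pointP hH) (end_pointP hH') e.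
have [N hN] := shrinks_in hH eE Ex; have [N' hN'] := shrinks_out hH' eE Ey.
pose i := maxn N1 (maxn N N').
have := h1 i; have := gp_sep eE oE (hN i _) (hN' i _).
by move=> /(_ ltac:(lia) ltac:(lia)) g /(_ ltac:(lia)); rewrite ltnNge g.
Qed.

Lemma end_point_inj : injective end_point.
Proof.
move=> x y e; case: (tree_nonempty T') => o; apply: contrapT => xy.
have [E [eE Ex sE oE]] := small_cut o x (p x y).+1.
apply: (@end_point_differ o E x y) => //; last by rewrite e.
move/sE => h; have [//|] : sim (p x y).+1 x y := sim_sym um h.
by rewrite ltnn.
Qed.

(** The edges of a ray are members that decrease. They are closed, having open complements, so a
    cluster point of points chosen in them lies in all of them, and its end is [b]. *)
Lemma end_point_surj (b : B') : exists x, end_point x = b.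
Proof.
case: (tree_nonempty T') => o.
have /choice[E hE] : forall n, exists E, [/\ EE E, ray o b n = vt (~` E) & ray o b n.+1 = vt E].
  move=> n; have /adj_vtP[E [eE e1 e2]] := ray_adj o b n.
  by exists (~` E); rewrite setCK; split=> //; exact: cf_compl cf _ _.
have eE n : EE (E n) by have [] := hE n.
have dec n : E n.+1 `<=` E n.
  have [eE1 e1 e2] := hE n; have [eE2 e3 e4] := hE n.+1.
  have eC := cf_compl cf eE2.
  have ne : E n.+1 <> ~` E n.
    move=> e; have := dist_ray o b n.+2; rewrite e4 e -e1 dist_ray; lia.
  have h1 : vset (vt (~` E n.+1)) (E n) by rewrite -e3 e2; exact: vset_self.
  have h2 : vset (vt (E n)) (~` E n.+1) by rewrite -e2 e3; exact: vset_self.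
  rewrite vset_vt// in h1; case: h1 => _ [h1|[h1 _]]; last by rewrite setCK in h1.
  exfalso; apply: ne; rewrite -(setCK (E n.+1)); congr (~` _).
  exact: vset_min (eE n) h2 h1.
have decr m n : (m <= n)%N -> E n `<=` E m.
  elim: n => [|n IH]; first by rewrite leqn0 => /eqP ->.
  rewrite leq_eqVlt => /orP[/eqP -> //|]; rewrite ltnS => /IH; exact: subset_trans.
have [y hy] := choice (fun n => cf_nonempty cf (eE n)).
have [x [s [sle hs]]] := um_cluster um y.
have Ex k : E k x.
  apply: contrapT => nEx; have [m hm] := cf_open cf (cf_compl cf (eE k)) nEx.
  apply: (hm (y (s (maxn m k)))).
    by apply: sim_le (hs (maxn m k)); exact: leq_maxl.
  by apply: decr (hy _); apply: leq_trans (sle _); exact: leq_maxr.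
have oE k : ~ vset o (E k).
  have -> : o = vt (~` E 0%N) by have [_ <- _] := hE 0%N; rewrite ray0.
  move=> h; have := vset_up h (decr 0%N k (leq0n k)) (eE 0%N).
  exact: vset_self_compl.
exists x; apply: (ray_inj (o := o)) => k.
have [H hH] := shrinks_ex x.
apply: (ray_eq_of_gp (end_pointP hH) (tends_ray o b)).
have [N hN] := shrinks_in hH (eE k) (Ex k).
exists (maxn N k.+1) => i le.
have bE : vset (ray o b i) (E k).
  have i0 : (0 < i)%N by lia.
  have [_ _] := hE i.-1; rewrite prednK// => ->.
  by apply: vset_up (vset_self x0 um cf (eE i.-1)) _ (eE k); apply: decr; lia.
have hi : vset (vt (H i)) (E k) by apply: hN; lia.
have := gp_both (eE k) (oE k) hi bE.
have [_ _ <-] := hE k; rewrite dist_ray; lia.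
Qed.

Lemma end_point_open_map (o : V) x k : exists m, forall y, sim m y x ->
  ray o (end_point y) k = ray o (end_point x) k.
Proof.
have [E [eE Ex oE le]] := deep_cut o x k.
have [m hm] := cf_open cf eE Ex; exists m => y /hm Ey.
exact: ray_le le (end_point_agree eE oE Ey Ex).
Qed.

Lemma end_point_continuous_inv (o : V) x j : exists k, forall y,
  ray o (end_point y) k = ray o (end_point x) k -> sim j y x.
Proof.
have [E [eE Ex sE oE]] := small_cut o x j.
exists (dist o (vt E)).+1 => y e; apply: sE; apply: contrapT => nEy.
exact: (end_point_differ eE oE Ex nEy).
Qed.

Let actK := actK actP.
Let actVK := actVK actP.

Definition gset g E : set B := act g^-1%g @^-1` E.

Lemma gset_family g E : EE E -> EE (gset g E).
Proof. exact: cf_act cf _ _. Qed.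

Lemma gsetK g E : gset g^-1%g (gset g E) = E.
Proof. by apply/seteqP; split=> x; rewrite /gset /= invgK actK. Qed.

Lemma gset_sub g E F : gset g E `<=` gset g F <-> E `<=` F.
Proof.
split=> h x; last exact: h.
by move=> Ex; have := h (act g x); rewrite /gset /= actK; exact.
Qed.

Lemma gset_preimage g F : act g @^-1` F = gset g^-1%g F.
Proof. by rewrite /gset invgK. Qed.

Lemma gset_compl g E : gset g (~` E) = ~` gset g E. Proof. by []. Qed.

Lemma orient_gset g E : EE E ->
  [set F | orient EE E (act g @^-1` F)] = orient EE (gset g E).
Proof.
move=> eE.
have iff F : EE (act g @^-1` F) <-> EE F.
  split=> [h|]; last exact: cf_act cf g _.
  have := gset_family g h; rewrite gset_preimage -{1}(invgK g) gsetK; exact.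
have eF F : F = gset g (act g @^-1` F).
  by rewrite gset_preimage -{1}(invgK g) gsetK.
apply/seteqP; split=> F /=.
  move=> [/iff eFF h]; split=> //; case: h => [h|[h n]]; [left|right].
    by rewrite (eF F); apply/gset_sub.
  split; first by rewrite (eF F) -gset_compl; apply/gset_sub.
  by move=> e; apply: n; rewrite e -gset_compl gset_preimage gsetK.
move=> [eFF h]; split; first exact/iff.
case: h => [h|[h n]]; [left|right].
  by apply/(gset_sub g); rewrite -eF.
split; first by apply/(gset_sub g); rewrite -eF.
by move=> e; apply: n; rewrite (eF F) e.
Qed.

Lemma gvert_subproof g (v : svertex EE) :
  `[< exists2 E, EE E & [set F | val v (act g @^-1` F)] = orient EE E >].
Proof.
have [E eE ->] := svertexP v; apply/asboolP; exists (gset g E); first exact: gset_family.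
exact: orient_gset.
Qed.

Definition gvert g v : V := exist (fun s => `[< exists2 E, EE E & s = orient EE E >]) _
  (gvert_subproof g (v : svertex EE)).

Lemma gvert_vt g E : EE E -> gvert g (vt E) = vt (gset g E).
Proof.
move=> eE; apply: vset_inj; rewrite vset_vt; last exact: gset_family.
by rewrite -orient_gset//; apply/seteqP; split=> F; rewrite /vset /= -/(vset _) vset_vt.
Qed.

Lemma gvert1 v : gvert 1%g v = v.
Proof.
have [E eE ->] := vsetP v; rewrite gvert_vt//; congr vt.
by apply/seteqP; split=> x; rewrite /gset /= invg1 actP.1.
Qed.

Lemma gvertM g h v : gvert (g * h)%g v = gvert g (gvert h v).
Proof.
have [E eE ->] := vsetP v; rewrite !gvert_vt//; last exact: gset_family.
by congr vt; apply/seteqP; split=> x; rewrite /gset /= invgM actP.2.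
Qed.

Lemma gvert_automorphism g : tree_automorphism (gvert g) (gvert g^-1%g).
Proof.
have ad h u v : adj u v -> adj (gvert h u) (gvert h v).
  move=> /adj_vtP[E [eE -> ->]]; apply/adj_vtP; exists (gset h E).
  split; [exact: gset_family|exact: gvert_vt|].
  by rewrite gvert_vt//; exact: cf_compl cf _ _.
split=> [v|v| |]; [|  |exact: ad|exact: ad].
  by rewrite -gvertM mulVg gvert1.
by rewrite -gvertM mulgV gvert1.
Qed.

Definition tree_action g : X' -> X' := realization_map (gvert_automorphism g).

Lemma tree_action_is_action : is_action tree_action.
Proof.
split=> [x|g h x]; apply: coord_inj; apply/funext => w /=.
  by rewrite invg1 gvert1.
by rewrite invgM gvertM.
Qed.

Lemma shrinks_gset g H x : shrinks H x -> shrinks (fun n => gset g (H n)) (act g x).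
Proof.
move=> [eH hH]; split=> [n|m]; first exact: gset_family.
have [l hl] := act_cont g m; have [N hN] := hH l; exists N => n /hN[Hx sH].
split; first by rewrite /gset /= actK.
by move=> y /sH /hl; rewrite actVK.
Qed.

Lemma tree_action_extends g (f : B' -> B') : (forall x, f (end_point x) = end_point (act g x)) ->
  extends_to_boundary (tree_action g) f.
Proof.
move=> hf b z zb; have [x xb] := end_point_surj b; rewrite -xb in zb *; rewrite hf.
have [H hH] := shrinks_ex x.
have as1 := asymptotic_tends_to (end_pointP hH) zb.
have iso := realization_map_isometry R (gvert_automorphism g).
have := isometry_asymptotic iso as1; apply: tends_to_asymptotic.
have := end_pointP (shrinks_gset g hH); congr tends_to; apply/funext => n /=.
rewrite /tree_action realization_map_vertex gvert_vt//; exact: hH.1.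
Qed.

(** The compact set is the union of the edges representing the finitely many orbits of the
    family. *)
Lemma tree_action_cocompact : cocompact_on setT tree_action.
Proof.
have [FF fF [sF hF]] := cf_orbits cf.
exists (\bigcup_(E in FF) (edge_set (vt E) (vt (~` E)) : set X')); split=> //.
  apply: finite_bigcup_compact => // E /sF eE; apply: edge_set_compact.
  by apply/adj_vtP; exists E.
move=> x _; have noiso v : exists w, adj v w.
  by have [E eE ->] := vsetP v; exists (vt (~` E)); apply/adj_vtP; exists E.
have [u [v [/adj_vtP[E [eE -> ->]] [t t01 e]]]] := edge_set_cover x noiso.
have [g FE] := hF E eE; exists g, (tree_action g^-1%g x); split; last first.
  by rewrite -tree_action_is_action.2 mulgV tree_action_is_action.1.
exists (act g @^-1` E) => //; exists t => //=.
rewrite e gset_preimage -gset_compl -!gvert_vt//; last exact: cf_compl cf _ _.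
exact: (bary_comp _ _ _ (gvert_automorphism g^-1%g)).
Qed.

End BoundaryOfCuts.

(** * From a homeomorphism to a quasimobius map *)

Section MobiusTransfer.
Variables (B : choiceType) (G : groupType) (act : G -> B -> B) (p p' : B -> B -> nat) (n0 : nat).
Hypotheses (p_sym : forall x y, p x y = p y x).
Hypothesis (p_min : forall x y z, x <> z -> (minn (p x y) (p y z) <= p x z)%N).
Hypotheses (actP : is_action act) (qm : uniformly_mobius p act) (qm' : uniformly_mobius p' act).
Hypothesis cc : triple_bounded p act n0.
Hypothesis bounded : forall n, exists n', forall x y, x <> y -> (p x y < n -> p' x y < n')%N.

(* Moving three of the four points apart by the action makes all the terms of
   both inequalities bounded. *)
Lemma mobius_transfer L : exists M, forall a b c d, uniq [:: a; b; c; d] ->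
  (p a b + p c d <= p a d + p b c + L)%N -> (p' a b + p' c d <= p' a d + p' b c + M)%N.
Proof.
have [M1 hM1] := qm L; have [n1 hn1] := bounded n0.
have [n2 hn2] := bounded (M1 + n0 + n0).+1; have [M2 hM2] := qm' (n1 + n2)%N.
exists M2 => a b c d u le; have [[ab ac ad] [bc bd cd]] := uniq4P u.
have [g [h1 h2 h3]] := cc ab ac bc.
have ug := act_uniq4 actP g u; have [[gab gac gad] [gbc gbd gcd]] := uniq4P ug.
have le1 := hM1 g _ _ _ _ u le.
have lt : (p (act g c) (act g d) < (M1 + n0 + n0).+1)%N.
  have := p_min (act g d) gac; rewrite (p_sym (act g d)); lia.
have := hM2 g^-1%g _ _ _ _ ug; rewrite !(actK actP); apply.
by have := hn1 _ _ gab h1; have := hn2 _ _ gcd lt; lia.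
Qed.

End MobiusTransfer.

Section CoarseMobius.
Variables (R : realType) (T T' : tree) (o : vertex T) (o' : vertex T').
Variable phi : boundary (realization R T) -> boundary (realization R T').

Lemma coarse_quasimobius : injective phi ->
  (forall L, exists M, forall a b c d, uniq [:: a; b; c; d] ->
    mobius_le o L a b c d -> mobius_le o' M (phi a) (phi b) (phi c) (phi d)) ->
  (forall L, exists M, forall a b c d, uniq [:: a; b; c; d] ->
    mobius_le o' L (phi a) (phi b) (phi c) (phi d) -> mobius_le o M a b c d) ->
  exists I, proper_increasing I /\ quasimobius I phi.
Proof.
move=> phi_inj /choice[M1 hM1] /choice[M2 hM2].
pose W n := (\sum_(i < n.+1) (M1 i + M2 i))%N.
have Wle n : (M1 n + M2 n <= W n)%N by rewrite /W big_ord_recr leq_addl.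
have Wmono : {homo W : m n / (m <= n)%N}.
  by apply: homo_leq leq_trans _ => // n; rewrite /W [leqRHS]big_ord_recr leq_addr.
(* An integer at least [s + 3], as [cross_ratio_ge] requires. *)
pose N (s : R) := (Num.truncn s).+4.
(* The summand [s] makes [I] strictly increasing and proper; the exponential is the bound of
   [cross_ratio_le], with the monotone majorant [W] of [M1] and [M2]. *)
pose I (s : R) := s + expR ((W (N s))%:R + 4).
have N_gt s : 0 <= s -> s + 3 <= (N s)%:R.
  move=> s0; have := truncnS_gt s; rewrite /N -(addn3 (Num.truncn s).+1) natrD.
  by move=> /ltW h; rewrite lerD2r.
exists I; split; last first.
  move=> a b c d u; have u' := uniq4_map phi_inj u.
  have half M (s t : R) : (M <= W (N s))%N -> 0 <= s -> t <= expR (M%:R + 4) -> t <= I s.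
    move=> le s0 /le_trans; apply.
    apply: (@le_trans _ _ (expR ((W (N s))%:R + 4))); last by rewrite /I lerDr.
    by rewrite ler_expR lerD2r ler_nat.
  split.
    apply: (half (M2 (N (cross_ratio (phi a) (phi b) (phi c) (phi d))))).
    - exact: leq_trans (leq_addl _ _) (Wle _).
    - exact: expR_ge0.
    - apply: (cross_ratio_le (o := o)) => //; apply: hM2 => //.
      by apply: cross_ratio_ge => //; apply: N_gt; exact: expR_ge0.
  apply: (half (M1 (N (cross_ratio a b c d)))).
  - exact: leq_trans (leq_addr _ _) (Wle _).
  - exact: expR_ge0.
  - apply: (cross_ratio_le (o := o')) => //; apply: hM1 => //.
    by apply: cross_ratio_ge => //; apply: N_gt; exact: expR_ge0.
split=> [s s0|s t s0 st|].
- by rewrite addr_ge0// expR_ge0.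
- apply: ltr_leD => //; rewrite ler_expR lerD2r ler_nat; apply: Wmono.
  by rewrite /N !ltnS; apply: le_truncn; exact: ltW.
- apply: (@ger_cvgy _ _ _ _ id) => //; near=> s.
  by rewrite /I lerDl expR_ge0.
Unshelve. all: by end_near.
Qed.

End CoarseMobius.

(** * Bounded triples and the boundary homeomorphism *)

Section Cocompact.
Variables (R : realType) (T : tree) (o : vertex T) (G : groupType).
Variable A : G -> boundary (realization R T) -> boundary (realization R T).
Hypothesis actP : is_action A.

(** Triples in [C] with unbounded products would accumulate at a triple in [C] with two equal
    points, but [C] consists of triples of distinct points. *)
Lemma cocompact_triple_bounded :
  cocompact_on (@triples (boundary (realization R T))) (fun g => triple_map (A g)) ->
  exists n0, triple_bounded (bp o) A n0.
Proof.
move=> [C [cC Cd hC]].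
have [n0 hn0] : exists n0, forall t, C t ->
    [/\ bp o t.1.1 t.1.2 < n0, bp o t.1.1 t.2 < n0 & bp o t.1.2 t.2 < n0]%N.
  apply: contrapT => no.
  have /choice[t ht] : forall n, exists t, C t /\
      ~ [/\ bp o t.1.1 t.1.2 < n, bp o t.1.1 t.2 < n & bp o t.1.2 t.2 < n]%N.
    by move=> n; apply: contrapT => h; apply: no; exists n => t Ct; apply: contrapT => h'; apply: h; exists t.
  have FC : (t @ \oo) C by exists 0%N => // n _; have [] := ht n.
  have [s [Cs cs]] := cC _ (fmap_proper_filter t eventually_filter) FC.
  pose n := (bp o s.1.1 s.1.2 + bp o s.1.1 s.2 + bp o s.1.2 s.2).+1.
  have ball (a : boundary (realization R T)) : nbhs a (level_ball (bp o) n a).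
    by apply/(nbhs_boundaryP o); exists n.
  have N : nbhs s (level_ball (bp o) n s.1.1 `*` level_ball (bp o) n s.1.2 `*` level_ball (bp o) n s.2).
    exists (level_ball (bp o) n s.1.1 `*` level_ball (bp o) n s.1.2, level_ball (bp o) n s.2) => //.
    split; last exact: ball.
    by exists (level_ball (bp o) n s.1.1, level_ball (bp o) n s.1.2) => //; split; exact: ball.
  have tail : (t @ \oo) [set x | exists2 i, (n <= i)%N & x = t i].
    by exists n => // i /= ni; exists i.
  have [_ [[i ni ->] [[/= n1 n2] n3]]] := cs _ _ tail N.
  have [_ hti] := ht i; apply: hti; have [d1 d2 d3] := Cd _ Cs.
  have lt (a b a' b' : boundary (realization R T)) : sim (bp o) n a' a -> sim (bp o) n b' b -> a <> b ->
      (bp o a b < n)%N -> (bp o a' b' < i)%N.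
    move=> /bp_sim h1 /bp_sim h2 ab l; rewrite ltnNge; apply/negP => h3.
    have /bp_sim h4 : sim (bp o) n a' b' by right; exact: leq_trans h3.
    have /bp_sim[//|] : ray o a n = ray o b n by rewrite -h1 -h2.
    by rewrite leqNgt l.
  split; [apply: (lt _ _ _ _ n1 n2 d1)|apply: (lt _ _ _ _ n1 n3 d2)|apply: (lt _ _ _ _ n2 n3 d3)];
    rewrite /n ltnS.
  - by rewrite -addnA leq_addr.
  - by rewrite addnAC leq_addl.
  - by rewrite leq_addl.
exists n0 => a b c ab ac bc.
have [g [t [Ct e]]] := hC (a, b, c) (And3 ab ac bc); have [h1 h2 h3] := hn0 t Ct.
by exists g^-1%g; case: e => <- <- <-; rewrite !(actK actP).
Qed.

End Cocompact.

Lemma homeomorphism_comp (U V W : topologicalType) (f : U -> V) (h : V -> W) :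
  homeomorphism f -> homeomorphism h -> homeomorphism (h \o f).
Proof.
move=> [f' [fK f'K fc f'c]] [h' [hK h'K hc h'c]]; exists (f' \o h'); split.
- exact: can_comp.
- exact: can_comp.
- by move=> x; apply: continuous_comp; [exact: fc|exact: hc].
- by move=> x; apply: continuous_comp; [exact: h'c|exact: f'c].
Qed.

Section BoundaryHomeomorphism.
Variables (R : realType) (T T' : tree) (o : vertex T) (o' : vertex T') (D : nat).
Local Notation B := (boundary (realization R T)).
Local Notation B' := (boundary (realization R T')).
Variable phi : B -> B'.
Hypothesis um : branching_ultrametric (@bp R T o) D.
Hypotheses (phi_inj : injective phi) (phi_surj : forall b, exists x, phi x = b).
Hypothesis phi_open : forall x k, exists m, forall y, sim (bp o) m y x ->
  ray o' (phi y) k = ray o' (phi x) k.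
Hypothesis phi_inv : forall x j, exists k, forall y,
  ray o' (phi y) k = ray o' (phi x) k -> sim (bp o) j y x.

Lemma boundary_homeomorphism : homeomorphism phi.
Proof.
have [psi psiK] := choice phi_surj.
have phiK : cancel phi psi by move=> x; apply: phi_inj.
exists psi; split=> // [x|b] U /=.
  move=> /(nbhs_boundaryP o')[k kU]; have [m hm] := phi_open x k.
  by apply/(nbhs_boundaryP o); exists m => y /hm e; apply: kU; apply/bp_sim.
move=> /(nbhs_boundaryP o)[j jU]; have [k hk] := phi_inv (psi b) j.
apply/(nbhs_boundaryP o'); exists k => c /bp_sim e; apply: jU; apply: hk.
by rewrite !psiK.
Qed.

Lemma boundary_uniform k : exists m, forall x y, sim (bp o) m x y ->
  ray o' (phi x) k = ray o' (phi y) k.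
Proof.
apply: contrapT => no.
have /choice[z hz] : forall m, exists z : B * B, sim (bp o) m z.1 z.2 /\
    ray o' (phi z.1) k <> ray o' (phi z.2) k.
  move=> m; apply: contrapT => h; apply: no; exists m => x y xy.
  by apply: contrapT => ne; apply: h; exists (x, y).
have [x [s [sle hs]]] := um_cluster um (fst \o z).
have [m hm] := phi_open x k; have [h ne] := hz (s m); apply: ne.
rewrite (hm _ (hs m)); apply/esym/hm; apply: (sim_trans um) (hs m).
by apply: (sim_sym um); exact: sim_le h.
Qed.

Lemma boundary_uniform_inv j : exists k, forall x y,
  ray o' (phi x) k = ray o' (phi y) k -> sim (bp o) j x y.
Proof.
apply: contrapT => no.
have /choice[z hz] : forall k, exists z : B * B, ray o' (phi z.1) k = ray o' (phi z.2) k /\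
    ~ sim (bp o) j z.1 z.2.
  move=> k; apply: contrapT => h; apply: no; exists k => x y xy.
  by apply: contrapT => ne; apply: h; exists (x, y).
have [x [s [sle hs]]] := um_cluster um (fst \o z).
have [k hk] := phi_inv x j; have [m hm] := phi_open x k; pose n := maxn m k.
have [h ne] := hz (s n); apply: ne.
have e1 : ray o' (phi (z (s n)).1) k = ray o' (phi x) k.
  by apply: hm; apply: sim_le (hs n); exact: leq_maxl.
have e2 : ray o' (phi (z (s n)).2) k = ray o' (phi x) k.
  rewrite -e1; apply/esym; apply: ray_le h; apply: leq_trans (sle n); exact: leq_maxr.
by apply: (sim_trans um) (hk _ e1) _; apply: (sim_sym um); exact: hk.
Qed.

Lemma boundary_bp n : exists n', forall x y, x <> y ->
  (bp o x y < n -> bp o' (phi x) (phi y) < n')%N.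
Proof.
have [k hk] := boundary_uniform_inv n; exists k => x y xy lt.
rewrite ltnNge; apply/negP => le; have /bp_sim/hk[//|] : sim (bp o') k (phi x) (phi y) by right.
by rewrite leqNgt lt.
Qed.

Lemma boundary_bp_inv n : exists n', forall x y, x <> y ->
  (bp o' (phi x) (phi y) < n -> bp o x y < n')%N.
Proof.
have [m hm] := boundary_uniform n; exists m => x y xy lt.
rewrite ltnNge; apply/negP => le.
have /bp_sim[/phi_inj//|] : ray o' (phi x) n = ray o' (phi y) n by apply: hm; right.
by rewrite leqNgt lt.
Qed.

(** [mobius_transfer] is used in both directions; for the second, triples are moved into a position
    bounded for the new product by uniform continuity of the inverse. *)
Lemma boundary_quasiconformal (G : groupType) (A : G -> B -> B) n0 : is_action A ->
  uniformly_mobius (bp o) A -> triple_bounded (bp o) A n0 ->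
  uniformly_mobius (fun x y => bp o' (phi x) (phi y)) A -> quasiconformal phi.
Proof.
move=> actP qm cc qm'; split=> [f ->|]; first exact: boundary_homeomorphism.
have [n1 hn1] := boundary_bp n0.
have cc' : triple_bounded (fun x y => bp o' (phi x) (phi y)) A n1.
  move=> a b c ab ac bc; have [g [h1 h2 h3]] := cc a b c ab ac bc.
  by exists g; split; apply: hn1 => //; exact: (act_neq actP).
constructor 2.
have [I [hI qI]] : exists I, proper_increasing I /\ quasimobius I phi.
  apply: (coarse_quasimobius (o := o) (o' := o')) => //.
  - apply: (mobius_transfer _ _ actP qm qm' cc boundary_bp) => [x y|x y z].
      exact: bp_sym.
    exact: bp_min.
  - apply: (mobius_transfer _ _ actP qm' qm cc' boundary_bp_inv) => [x y|x y z xz].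
      exact: bp_sym.
    by apply: bp_min => /phi_inj.
by exists I; split=> // f ->.
Qed.

End BoundaryHomeomorphism.

Lemma bounded_valence_finite (T : tree) : bounded_valence T ->
  forall v : vertex T, finite_set [set u | adj v u].
Proof.
move=> [N hN] v; have [s _ hs] := hN v.
by apply: (@sub_finite_set _ _ [set` s]) => //; exact: hs.
Qed.

Theorem theorem5 (R : realType) (T : tree)
    (G : groupType)
    (A : G -> boundary (realization R T) -> boundary (realization R T)) :
  bounded_valence T ->
  bushy R T ->
  is_action A ->
  uniformly_quasiconformal (range A) ->
  cocompact_on (@triples (boundary (realization R T)))
    (fun g => triple_map (A g)) ->
  exists (T' : tree)
         (phi : boundary (realization R T) -> boundary (realization R T'))
         (A' : G -> boundary (realization R T') -> boundary (realization R T'))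
         (rho : G -> realization R T' -> realization R T'),
    [/\ proper_space (realization R T'),
        quasiconformal phi,
        is_action A' /\ (forall g b, phi (A g b) = A' g (phi b)),
        is_action rho /\ (forall g, self_isometry (rho g)) &
        cocompact_on setT rho /\
          (forall g, extends_to_boundary (rho g) (A' g))].
Proof.
move=> /bounded_valence_finite lf bu actP qcA cocA.
case: (tree_nonempty T) => o.
have [x0 _] := bushy_boundary_point lf bu.
have [D /(boundary_ultrametric lf) um] := bushy_branching o lf bu.
have qm : uniformly_mobius (bp o) A.
  move=> L; have [M hM] := uniformly_quasiconformal_mobius o lf qcA L.
  by exists M => g a b c d u le; apply: hM => //; exists g.
have [n0 cc] := cocompact_triple_bounded o actP cocA.
have act_cont := act_continuous x0 um actP qm.
have [EE cf] := cut_family_ex x0 um actP qm cc.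
pose T' := cut_tree x0 um cf.
pose phi : boundary (realization R T) -> boundary (realization R T') := end_point R x0 um cf.
case: (tree_nonempty T') => o'.
have phi_inj : injective phi := @end_point_inj _ _ _ _ _ _ _ _ um cf.
have phi_homeo : homeomorphism phi.
  apply: (boundary_homeomorphism (o := o) (o' := o')) => //.
  - exact: end_point_surj.
  - exact: end_point_open_map.
  - exact: end_point_continuous_inv.
have [psi [phiK psiK phic psic]] := phi_homeo.
have psi_homeo : homeomorphism psi by exists phi.
(* Conjugation makes the action laws and equivariance formal; the substance is that [rho g] extends
   to [A' g]. *)
pose A' g := phi \o A g \o psi.
have A'phi g x : A' g (phi x) = phi (A g x) by rewrite /A' /= phiK.
pose rho : G -> realization R T' -> realization R T' := tree_action actP.
have rho_iso g : self_isometry (rho g) by exact: realization_map_isometry.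
have rho_ext g : extends_to_boundary (rho g) (A' g) by exact: tree_action_extends.
have qm' : uniformly_mobius (fun x y => bp o' (phi x) (phi y)) A.
  (* Every [A' g] is the boundary value of an isometry, a quasi-isometry with constants 1 and 0, so
     the first criterion applies in the new tree. *)
  have qmA' : uniform_mobius o' (range A').
    apply: uniform_mobius_ext => [_ [g _ <-]|].
      do 2 apply: homeomorphism_comp => //; exact: (qcA.1).
    exists 1, 0; split=> // _ [g _ <-]; exists (rho g); split; last exact: rho_ext.
    have [iso surj] := rho_iso g; split=> [x y|y].
      by rewrite iso invr1 !mul1r subr0 addr0 lexx.
    by have [x <-] := surj y; exists x; rewrite mdistxx.
  move=> L; have [M hM] := qmA' L; exists M => g a b c d u le.
  rewrite -!A'phi; apply: hM => //; exact: uniq4_map.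
exists T', phi, A', rho; split.
- apply: locally_finite_proper => v; first exact: finite_neighbours.
  have [E eE ->] := vsetP v; exists (vt x0 um cf (~` E)).
  by apply/adj_vtP; exists E.
- apply: (boundary_quasiconformal (o := o) (o' := o') um _ _ _ _ actP qm cc qm') => //.
  + exact: end_point_surj.
  + exact: end_point_open_map.
  + exact: end_point_continuous_inv.
- split=> [|g b]; last by rewrite A'phi.
  split=> [b|g h b]; rewrite /A' /=; first by rewrite actP.1 psiK.
  by rewrite phiK actP.2.
- by split=> //; exact: tree_action_is_action.
- by split=> //; exact: tree_action_cocompact.
Qed.
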